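(* (a) Let $k$ be a field with $\operatorname{char} k\neq 2$, let $K$ be a separable closure of $k$, and let $S\subset\mathbb{P}^{2}(K)$ be a finite set of $n$ points with field of moduli $k_{S}$. If $n\le 5$, then $S$ descends to a finite subscheme of $\mathbb{P}^{2}_{k_{S}}$. (b) For every integer $n\ge 6$, there exists a subset $S\subset\mathbb{P}^{2}(\mathbb{C})$ with exactly $n$ points whose field of moduli (with respect to $k=\mathbb{R}$, $K=\mathbb{C}$) is equal to $\mathbb{R}$ and which does not descend to a finite subscheme of $\mathbb{P}^{2}_{\mathbb{R}}$.
   Context: Let $k$ be a field with separable closure $K$. The Galois group $\operatorname{Gal}(K/k)$ acts on $\mathbb{P}^{2}(K)$ coordinatewise. Two finite subsets $S_1,S_2\subset\mathbb{P}^{2}(K)$ are linearly equivalent if there is $g\in\mathrm{PGL}_{3}(K)$ with $g(S_1)=S_2$. Field of moduli: for a finite subset $S\subset\mathbb{P}^{2}(K)$, the field of moduli $k_{S}$ of $S$ is the subfield of $K$ of elements fixed by all $\sigma\in\operatorname{Gal}(K/k)$ such that $\sigma(S)$ is linearly equivalent to $S$. Descent: for an intermediate field $k\subseteq k'\subseteq K$, one says that $S$ descends to a finite subscheme of $\mathbb{P}^{2}_{k'}$ (or descends to $\mathbb{P}^2_{k'}$) if there is a finite closed subscheme $Z\subset\mathbb{P}^{2}_{k'}$ such that the pair $(\mathbb{P}^{2}_{K},Z_{K})$ is isomorphic over $K$ to $(\mathbb{P}^{2}_{K},S)$, where $S$ is regarded as a reduced closed subscheme. Equivalently, there is $g\in\mathrm{PGL}_{3}(K)$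 such that $g(S)$ is stable under $\operatorname{Gal}(K/k')$. *)

(* Defs.v *)
From HB Require Import structures.
From mathcomp Require Import all_boot all_order all_algebra all_field.
From mathcomp Require Import finmap mpoly complex reals.
Set Implicit Arguments.
Unset Strict Implicit.
Unset Printing Implicit Defensive.
Import GRing.Theory.
Local Open Scope ring_scope.

Definition separable_closure (k K : fieldType) (iota : {rmorphism k -> K}) :
    Prop :=
  (forall x : K, exists p : {poly k},
     [/\ p != 0, separable_poly p & root (map_poly iota p) x]) /\
  (forall q : {poly K}, separable_poly q -> (1 < size q)%N ->
     exists x, root q x).

Definition galois_aut (k K : fieldType) (iota : {rmorphism k -> K})
    (sigma : {rmorphism K -> K}) : Prop :=
  bijective sigma /\ forall a : k, sigma (iota a) = iota a.

Section ProjectivePlane.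
Variable K : fieldType.

Definition P2 := {L : {vspace 'cV[K]_3} | \dim L == 1%N}.

Lemma point_subproof (v : 'cV[K]_3) : v != 0 -> \dim <[v]>%VS == 1%N.
Proof. by move=> nz_v; rewrite dim_vline nz_v. Qed.

Definition point (v : 'cV[K]_3) (nz_v : v != 0) : P2 :=
  exist _ <[v]>%VS (point_subproof nz_v).

(* Homogeneous coordinates of a point, determined up to a nonzero scalar. *)
Definition coords (p : P2) : 'cV[K]_3 := vpick (val p).

Lemma coords_neq0 (p : P2) : coords p != 0.
Proof.
rewrite /coords vpick0; case: p => L /= dimL; apply/eqP => L0.
by move: dimL; rewrite L0 dimv0.
Qed.

(* Elements of PGL_3(K) are represented by invertible matrices; matrices that *)
(* differ by a scalar act in the same way on P2.                              *)
Definition GL3 := {g : 'M[K]_3 | g \in unitmx}.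

Lemma GL3_coords_neq0 (g : GL3) (p : P2) : val g *m coords p != 0.
Proof.
apply/eqP => /(congr1 (mulmx (invmx (val g)))).
rewrite mulmxA mulVmx ?(valP g) // mul1mx mulmx0.
by apply/eqP; exact: coords_neq0.
Qed.

Definition GL3_act (g : GL3) (p : P2) : P2 := point (GL3_coords_neq0 g p).

Lemma aut_coords_neq0 (sigma : {rmorphism K -> K}) (p : P2) :
  map_mx sigma (coords p) != 0.
Proof. by rewrite map_mx_eq0 coords_neq0. Qed.

Definition aut_act (sigma : {rmorphism K -> K}) (p : P2) : P2 :=
  point (aut_coords_neq0 sigma p).

Definition linearly_equivalent (S1 S2 : {fset P2}) : Prop :=
  exists g : GL3, [fset GL3_act g p | p in S1]%fset = S2.

Definition vanishes_at (f : {mpoly K[3]}) (p : P2) : Prop :=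
  f.@[fun i => coords p i 0] = 0.

Definition in_ideal (G : {mpoly K[3]} -> Prop) (f : {mpoly K[3]}) : Prop :=
  exists r : seq ({mpoly K[3]} * {mpoly K[3]}),
    (forall c, c \in r -> G c.2) /\ f = \sum_(c <- r) c.1 * c.2.

(* A closed subscheme Z of the projective plane over a subfield k' of K is    *)
(* given by a set G of homogeneous equations with coefficients in k'; the     *)
(* same equations define its base change to K.                                *)
Definition equations_over (k' : K -> Prop) (G : {mpoly K[3]} -> Prop) : Prop :=
  forall f, G f ->
    (exists d : nat, f \is d.-homog) /\ (forall m, k' f@_m).

(* Equality, as closed subschemes of the plane over K, of the subscheme       *)
(* defined by G and of T with its reduced structure: the two ideal sheaves    *)
(* have the same sections in every twist. A form f is a section of the ideal  *)
(* sheaf of the former iff on each chart 'X_i != 0 it lies in the ideal       *)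
(* generated by G, i.e. some 'X_i ^+ m * f lies in the homogeneous ideal.     *)
Definition defines_reduced (G : {mpoly K[3]} -> Prop) (T : {fset P2}) : Prop :=
  forall (d : nat) (f : {mpoly K[3]}), f \is d.-homog ->
    ((forall i : 'I_3, exists m : nat, in_ideal G ('X_i ^+ m * f)) <->
     (forall p, p \in T -> vanishes_at f p)).

(* Z need not be required to be finite: this holds as soon as its base change *)
(* to K is the finite scheme g(S).                                            *)
Definition descends_to (k' : K -> Prop) (S : {fset P2}) : Prop :=
  exists (G : {mpoly K[3]} -> Prop) (g : GL3),
    equations_over k' G /\ defines_reduced G [fset GL3_act g p | p in S]%fset.

End ProjectivePlane.

Definition field_of_moduli (k K : fieldType) (iota : {rmorphism k -> K})
    (S : {fset P2 K}) (x : K) : Prop :=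
  forall sigma : {rmorphism K -> K}, galois_aut iota sigma ->
    linearly_equivalent [fset aut_act sigma p | p in S]%fset S ->
    sigma x = x.

Definition real_in_complex (R : realType) : {rmorphism R -> R[i]} :=
  @real_complex R.

Definition is_real_number (R : realType) (z : R[i]) : Prop :=
  exists r : R, z = real_in_complex R r.

(* Main.v *)
(* A finite set that is stable under the automorphisms fixing k' descends to k': a
   form vanishing on it, of minimal support among such forms and with one
   coefficient 1, has coefficients in k', and such forms span. Conversely the
   points of a scheme defined over k' are permuted by these automorphisms.

   (a) It is enough to find coordinates in which S is stable under every sigma for
   which sigma(S) is equivalent to S. On the affine line, center S and divide by w
   with w^d = E, where E spans the semi-invariants of minimal positive degree d. On
   the projective line, five points all of whose projective symmetries are trivial
   have enough covariant vectors to form a frame; otherwise a symmetry of order 3 or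
   5 puts the points in a rigid normal form, or there is a canonical point, which is
   sent to infinity; four points are reduced to this by a transitive group of
   involutions. In the plane, five points in general position lie on a conic, that
   is, on a projective line, and the degenerate configurations are rigid or reduce
   to points on a line.

   (b) On a line of the plane take the points 2, ..., m + 1, their images under the
   antipodal map z |-> -1 / conj z, the antipodal pair 2i, -i/2, and for odd n one
   point off the line. The antipodal map makes S equivalent to its conjugate. A real
   model would give h with h conj(h) = 1 mapping conj(S) to S; comparing cross ratios,
   h maps real points to real points, hence is a multiple of a real matrix, and its
   action on the remaining pair forces h conj(h) to be negative or the real points
   to be moved off S. *)
Require Import Defs.
From mathcomp Require Import all_boot all_order all_fingroup all_algebra all_solvable all_field.
From mathcomp Require Import finmap mpoly complex reals.
From mathcomp Require Import boolp ring lra zify.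
Set Implicit Arguments.
Unset Strict Implicit.
Unset Printing Implicit Defensive.
Import GRing.Theory.
Local Open Scope ring_scope.

(** * Points up to scalars *)

(** For points on a line without symmetries, the obstruction to compatible coordinates is a twisted
    form of the line, that is, a conic which may lack a rational point. An odd number of points
    gives a divisor of odd degree on it, hence a rational point. Concretely, two brackets absorb
    four of five points and leave one vector, so five points have covariants with values in the
    plane [K^2] itself. For an even number the analogous covariants have even order, and antipodal
    pairs realize the conic without real points. A marked point on the line leaves only affine maps.
    Their translation part is removed by an equivariant center, their scaling part by a root of a
    semi-invariant. As the closure is only separable, the degree of that root must be invertible in
    [K], which follows from the points being distinct. The centroid needs an invertible number of
    points: four points beside a marked one are fine outside characteristic 2, but three points in
    characteristic 3 require another center. *)

Section ProjectiveEquality.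
Variables (K : fieldType) (m : nat).
Implicit Types (u v w : 'cV[K]_m) (s t : seq 'cV[K]_m) (g h : 'M[K]_m).
Implicit Types sigma : {rmorphism K -> K}.

Definition proj_eq u v := exists2 c : K, c != 0 & u = c *: v.
Local Notation "u === v" := (proj_eq u v) (at level 70).

Lemma proj_eq_refl u : u === u.
Proof. by exists 1; rewrite ?oner_neq0 ?scale1r. Qed.

Lemma proj_eq_sym u v : u === v -> v === u.
Proof.
by case=> c c0 ->; exists c^-1; rewrite ?invr_neq0 // scalerA mulVf ?scale1r.
Qed.

Lemma proj_eq_trans u v w : u === v -> v === w -> u === w.
Proof.
by case=> c c0 -> [d d0 ->]; exists (c * d); rewrite ?mulf_neq0 ?scalerA.
Qed.

Lemma proj_eq_scale (c : K) u : c != 0 -> c *: u === u.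
Proof. by exists c. Qed.

Lemma proj_eq_mul g u v : u === v -> g *m u === g *m v.
Proof. by case=> c c0 ->; exists c; rewrite // scalemxAr. Qed.

Lemma proj_eq_mul_inj g u v : g \in unitmx -> g *m u === g *m v -> u === v.
Proof.
by move=> gU /(proj_eq_mul (invmx g)); rewrite !mulmxA mulVmx // !mul1mx.
Qed.

Lemma proj_eq_map sigma u v : u === v -> map_mx sigma u === map_mx sigma v.
Proof.
by case=> c c0 ->; exists (sigma c); rewrite ?fmorph_eq0 ?map_mxZ.
Qed.

(** An endomorphism of [K] need not be onto, so the scalar has to be recognized as a value of
    [sigma]: at a nonzero coordinate of [v] it is the image of a quotient of coordinates. *)
Lemma proj_eq_map_inj sigma u v :
  u != 0 -> v != 0 -> map_mx sigma u === map_mx sigma v -> u === v.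
Proof.
move=> u0 v0 [c c0] E.
have [i vi0] : exists i, v i 0 != 0.
  apply/existsP; apply: contraNT v0 => /existsPn v0.
  by apply/eqP/matrixP => i j; rewrite ord1 mxE; apply/eqP/negPn/v0.
have Ei k : sigma (u k 0) = c * sigma (v k 0).
  by have /matrixP/(_ k 0) := E; rewrite !mxE.
have cE : c = sigma (u i 0 / v i 0).
  by rewrite fmorph_div Ei mulfK // fmorph_eq0.
exists (u i 0 / v i 0); first by rewrite -(fmorph_eq0 sigma) -cE.
apply/matrixP => k j; rewrite ord1 mxE.
by apply: (fmorph_inj sigma); rewrite rmorphM -cE Ei.
Qed.

Definition pincl s t := forall u, u \in s -> exists2 v, v \in t & u === v.
Definition mximg g s := [seq g *m u | u <- s].
Definition conjs sigma s := [seq map_mx sigma u | u <- s].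

Lemma pincl_refl s : pincl s s.
Proof. by move=> u us; exists u => //; apply: proj_eq_refl. Qed.

Lemma pincl_trans s t r : pincl s t -> pincl t r -> pincl s r.
Proof.
move=> st tr u /st[v /tr[w wr vw] uv]; exists w => //.
exact: proj_eq_trans vw.
Qed.

Arguments pincl_trans {s t r} _ _ _ _.

Lemma sub_pincl s t : {subset s <= t} -> pincl s t.
Proof. by move=> st u /st ut; exists u => //; apply: proj_eq_refl. Qed.

Lemma pincl_mximg g s t : pincl s t -> pincl (mximg g s) (mximg g t).
Proof.
move=> st _ /mapP[u /st[v vt uv] ->]; exists (g *m v); first exact: map_f.
exact: proj_eq_mul.
Qed.

Arguments pincl_mximg g {s t} _ _ _.

Lemma pincl_conjs sigma s t :
  pincl s t -> pincl (conjs sigma s) (conjs sigma t).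
Proof.
move=> st _ /mapP[u /st[v vt uv] ->].
by exists (map_mx sigma v); [exact: map_f | exact: proj_eq_map].
Qed.

Arguments pincl_conjs sigma {s t} _ _ _.

Lemma mximgM g h s : mximg (g *m h) s = mximg g (mximg h s).
Proof. by rewrite /mximg -map_comp; apply: eq_map => u /=; rewrite mulmxA. Qed.

Lemma mximg1 s : mximg 1%:M s = s.
Proof. by rewrite /mximg -[RHS]map_id; apply: eq_map => u; rewrite mul1mx. Qed.

Lemma mximgK g s : g \in unitmx -> mximg (invmx g) (mximg g s) = s.
Proof. by move=> gU; rewrite -mximgM mulVmx // mximg1. Qed.

Lemma conjs_mximg sigma g s :
  conjs sigma (mximg g s) = mximg (map_mx sigma g) (conjs sigma s).
Proof.
rewrite /conjs /mximg -!map_comp; apply: eq_map => u /=; exact: map_mxM.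
Qed.

(* For representatives s of a finite set of points: moduli s sigma says that
   sigma(s) is projectively equivalent to s, and good s that one change of
   coordinates makes s stable under all such sigma. An inclusion suffices, since
   both sides have as many points; sigma ranges over all endomorphisms of K. *)
Definition moduli s sigma :=
  exists2 h, h \in unitmx & pincl (mximg h (conjs sigma s)) s.

Definition good s :=
  exists2 g, g \in unitmx &
    forall sigma, moduli s sigma -> pincl (conjs sigma (mximg g s)) (mximg g s).

Lemma rigid_good s : (forall sigma, pincl (conjs sigma s) s) -> good s.
Proof.
by move=> Hs; exists 1%:M => [|sigma _]; rewrite ?unitmx1 // mximg1.
Qed.

Lemma moduli_equiv P s t sigma : P \in unitmx ->
  pincl t (mximg P s) -> pincl (mximg P s) t -> moduli t sigma ->
  moduli s sigma.
Proof.
move=> PU ts st [h hU Hh].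
(* Twisted conjugation: [sigma] also acts on the entries of the change of coordinates. *)
exists (invmx P *m h *m map_mx sigma P).
  by rewrite !unitmx_mul unitmx_inv PU hU map_unitmx.
rewrite !mximgM -conjs_mximg.
have := pincl_mximg h (pincl_conjs sigma st) => /pincl_trans/(_ Hh).
by move/pincl_trans/(_ ts)/(pincl_mximg (invmx P)); rewrite mximgK.
Qed.

Lemma good_equiv P s t : P \in unitmx ->
  pincl t (mximg P s) -> pincl (mximg P s) t -> good s -> good t.
Proof.
move=> PU ts st [g gU Hg]; exists (g *m invmx P).
  by rewrite unitmx_mul gU unitmx_inv.
move=> sigma /(moduli_equiv PU ts st)/Hg Hs.
have EP r : mximg (g *m invmx P) (mximg P r) = mximg g r.
  by rewrite -mximgM -mulmxA mulVmx // mulmx1.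
have st' := pincl_mximg (g *m invmx P) st.
have ts' := pincl_mximg (g *m invmx P) ts.
rewrite EP in st'; rewrite EP in ts'.
apply: pincl_trans st'; apply: pincl_trans Hs.
exact: pincl_conjs.
Qed.

Lemma good_eq_mem s t : s =i t -> good s -> good t.
Proof.
move=> st; apply: (@good_equiv 1%:M); rewrite ?unitmx1 ?mximg1 //;
by apply: sub_pincl => u; rewrite st.
Qed.

End ProjectiveEquality.
Notation "u === v" := (proj_eq u v) (at level 70).

Arguments pincl_trans {K m s t r} _ _ _ _.
Arguments pincl_mximg {K m} g {s t} _ _ _.
Arguments pincl_conjs {K m} sigma {s t} _ _ _.

(** * Finite subsets of the affine line *)

Section AffineLine.
Variable K : fieldType.
Hypothesis sep_closed : forall q : {poly K},
  separable_poly q -> (1 < size q)%N -> exists x, root q x.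
Implicit Types (x : seq K) (sigma : {rmorphism K -> K}).

(** Euclidean descent by the least positive element. It is meant for the degrees of semi-invariants,
    which are closed under differences because semi-invariants can be divided. *)
Lemma diff_closed_dvdn (P : nat -> Prop) :
  (forall d e, P d -> P e -> (e <= d)%N -> P (d - e)%N) ->
  (exists2 d, (0 < d)%N & P d) ->
  exists2 d, (0 < d)%N /\ P d & forall e, P e -> (d %| e)%N.
Proof.
move=> Pdiff exP.
have ex : exists d, (0 < d)%N && `[< P d >].
  by case: exP => d d0 Pd; exists d; rewrite d0; apply/asboolP.
case: (ex_minnP ex) => d /andP[d0 /asboolP Pd] dmin.
exists d => // e; have [n] := ubnP e; elim: n e => // n IHn e; rewrite ltnS => len Pe.
have [->|e0] := posnP e; first exact: dvdn0.
have led : (d <= e)%N by apply: dmin; rewrite e0; apply/asboolP.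
rewrite -(subnK led) dvdn_addl // IHn //; last exact: Pdiff.
by apply: leq_trans len; rewrite ltn_subrL d0 e0.
Qed.

Lemma perm_affine x (f : K -> K) :
  uniq x -> injective f -> (forall y, y \in x -> f y \in x) ->
  perm_eq x [seq f y | y <- x].
Proof.
move=> Ux injf fx; rewrite perm_sym; apply: uniq_perm; rewrite ?map_inj_uniq //.
have sub : {subset map f x <= x} by move=> _ /mapP[y yx ->]; exact: fx.
by have [] := uniq_min_size (etrans (map_inj_uniq injf _) Ux) sub _; rewrite ?size_map.
Qed.

Lemma twisted_scale_inj sigma (u v : K) :
  u != 0 -> injective (fun y => u * sigma y + v).
Proof.
by move=> u0 y z /addIr/(mulfI u0); apply: fmorph_inj.
Qed.

(** The map [y -> u * sigma y] permutes the roots of [f], so [f] and the polynomial [g] with the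
    transformed coefficients are both monic with these [n] roots; their difference has degree less
    than [n], hence vanishes. *)
Lemma coef_scaled_roots x sigma (u : K) (f := \prod_(y <- x) ('X - y%:P)) :
  uniq x -> u != 0 -> (forall y, y \in x -> u * sigma y \in x) ->
  forall i, (i <= size x)%N -> f`_i = u ^+ (size x - i) * sigma f`_i.
Proof.
move=> Ux u0 ux; set n := size x.
have szf : size f = n.+1 by rewrite size_prod_XsubC.
have f_monic : f`_n = 1.
  by have /monicP := monic_prod_XsubC x predT id; rewrite /lead_coef szf.
pose g := \poly_(i < n.+1) (u ^+ (n - i) * sigma f`_i).
have perm_x : perm_eq x [seq u * sigma y | y <- x].
  apply: perm_affine => // y z; have := @twisted_scale_inj sigma u 0 u0 y z.
  by rewrite !addr0.
have fg : f - g = 0.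
  apply: (@roots_geq_poly_eq0 _ _ x) => //.
    apply/allP => z; rewrite (perm_mem perm_x) => /mapP[y yx ->].
    rewrite rootE hornerD hornerN subr_eq0.
    have /rootP -> : root f (u * sigma y) by rewrite root_prod_XsubC ux.
    suff -> : g.[u * sigma y] = u ^+ n * sigma f.[y].
      by have /rootP -> : root f y; rewrite ?root_prod_XsubC // rmorph0 mulr0.
    rewrite horner_poly horner_coef szf rmorph_sum mulr_sumr.
    apply: eq_bigr => i _; rewrite rmorphM rmorphXn exprMn.
    have -> : u ^+ n = u ^+ (n - i) * u ^+ i by rewrite -exprD subnK ?leq_ord.
    ring.
  rewrite -/n; apply/leq_sizeP => j; rewrite leq_eqVlt coefB coef_poly => /orP[/eqP<-|nj].
    by rewrite ltnSn subnn expr0 mul1r f_monic rmorph1 subrr.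
  by rewrite ltnNge nj subr0 nth_default // szf.
move=> i lein; have /polyP/(_ i) := fg; rewrite coefB coef_poly ltnS lein coef0.
by move/eqP; rewrite subr_eq0 => /eqP.
Qed.

(** The nonzero coefficients of [f] are semi-invariants. With [d] the least positive degree of a
    semi-invariant [E] and [w ^+ d = E], the defect [z = u * sigma w / w] is a [d]-th root of unity.
    All exponents occurring in [f] are congruent modulo [d], so the roots of [f] are stable under
    division by [z], and [w] serves for all [sigma] and [u] at once. *)
Lemma scale_good x : uniq x -> (1 < size x)%N ->
  exists2 w : K, w != 0 &
    forall sigma (u : K), u != 0 -> (forall y, y \in x -> u * sigma y \in x) ->
    forall y, y \in x -> exists2 z, z \in x & sigma (y / w) = z / w.
Proof.
move=> Ux szx; set n := size x; pose f := \prod_(y <- x) ('X - y%:P).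
have szf : size f = n.+1 by rewrite size_prod_XsubC.
have f_sep : separable_poly f by rewrite separable_prod_XsubC.
pose adm (su : {rmorphism K -> K} * K) := su.2 != 0 /\
  forall y, y \in x -> su.2 * su.1 y \in x.
pose semi d E := forall su, adm su -> su.2 ^+ d * su.1 E = E.
pose P d := exists2 E : K, E != 0 & semi d E.
have Pcoef i : (i <= n)%N -> f`_i != 0 -> P (n - i)%N.
  move=> lein fi0; exists f`_i => // -[sigma u] [/= u0 ux].
  by rewrite -(coef_scaled_roots Ux u0 ux).
(* If [d] vanished in [K], all exponents occurring in [f] would have the same image in [K], giving
   the Euler relation [X f' = n f]. Being coprime to [f'], the polynomial [f] would divide [X],
   although it has at least two roots. *)
have f_nonreg (d : nat) : (forall i, (i <= n)%N -> f`_i != 0 -> (d %| n - i)%N) ->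
    d%:R != 0 :> K.
  move=> Hd; apply/eqP => d0.
  have Xf' : 'X * f^`() = n%:R *: f.
    apply/polyP => i; rewrite coefXM coefZ coef_deriv.
    have [fi0|fi0] := eqVneq f`_i 0.
      by rewrite fi0 mulr0; case: i fi0 => [|i] //= ->; rewrite mul0rn.
    have lein : (i <= n)%N.
      by rewrite leqNgt; apply: contraNN fi0 => ?; rewrite nth_default ?szf.
    have nE : n%:R = i%:R :> K.
      have /dvdnP[q qE] := Hd i lein fi0.
      by rewrite -(subnK lein) natrD qE natrM d0 mulr0 add0r.
    by rewrite nE mulr_natl; case: i {fi0 lein nE} => [|i] /=; rewrite ?mulr0n.
  have : f %| 'X.
    have f_cop : coprimep f f^`() by move: f_sep; rewrite unlock.
    by rewrite -(Gauss_dvdpl _ f_cop) Xf' -mul_polyC dvdp_mulIr.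
  move/dvdp_leq; rewrite polyX_eq0 szf size_polyX => /(_ isT).
  by rewrite ltnS leqNgt szx.
have [d [d0 [E E0 semiE]] dvdP] : exists2 d, (0 < d)%N /\ P d & forall e, P e -> (d %| e)%N.
  apply: diff_closed_dvdn.
    move=> d e [E E0 semiE] [F F0 semiF] led; exists (E / F).
      by rewrite mulf_neq0 ?invr_neq0.
    move=> su adm_su; rewrite -[in RHS](semiE _ adm_su) -[in RHS](semiF _ adm_su).
    rewrite -[in RHS](subnK led) exprD fmorph_div; case: adm_su => u0 _.
    by field; rewrite fmorph_eq0 F0 expf_neq0.
  (* This is [f_nonreg] at [d = 0]: were the leading coefficient the only nonzero one, 0 would
     divide every [n - i] that occurs. *)
  have [i lein fi0] : exists2 i, (i < n)%N & f`_i != 0.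
    apply: contrapT => noi.
    have : (0 : K) != 0; last by rewrite eqxx.
    rewrite -[X in X != _](mulr0n 1) f_nonreg // => i lein fi0.
    have := lein; rewrite leq_eqVlt => /orP[/eqP->|ltin]; first by rewrite subnn.
    by case: noi; exists i.
  by exists (n - i)%N; [rewrite subn_gt0 | apply: Pcoef => //; exact: ltnW].
have d_neq0 : d%:R != 0 :> K.
  by apply: f_nonreg => i lein fi0; apply: dvdP; exact: Pcoef.
have [w /rootP] : exists w, root ('X^d - E%:P) w.
  apply: sep_closed; last by rewrite size_XnsubC.
  rewrite unlock derivB derivXn derivC subr0.
  apply/Bezout_eq1_coprimepP.
  (* Bezout relation between [X^d - E] and its derivative [d X^(d-1)]; it divides by [d]. *)
  exists (- (E^-1)%:P, (E^-1 / d%:R) *: 'X) => /=.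
  rewrite -scalerAl mulrnAr -exprS prednK // -scaler_nat scalerA divfK //.
  have EE : (E^-1)%:P * E%:P = 1 by rewrite -polyCM mulVf.
  by rewrite -mul_polyC -[RHS]EE; ring.
rewrite !hornerE => /eqP; rewrite subr_eq0 => /eqP wd.
have w0 : w != 0 by apply: contraNneq E0 => w0; rewrite -wd w0 expr0n gtn_eqF.
exists w => // sigma u u0 ux y yx.
pose z := u * sigma w / w.
have zd : z ^+ d = 1.
  rewrite exprMn exprVn exprMn -rmorphXn wd (semiE (sigma, u)) ?divff //.
have z0 : z != 0 by rewrite !mulf_neq0 ?invr_neq0 ?fmorph_eq0.
exists (u * sigma y / z); last first.
  by rewrite fmorph_div /z; field; rewrite u0 w0 fmorph_eq0 w0.
have /rootP : root f (u * sigma y) by rewrite root_prod_XsubC ux.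
rewrite -root_prod_XsubC -/f horner_coef szf => f0.
rewrite rootE horner_coef szf; apply/eqP.
(* Multiplying the value at [u * sigma y / z] by [z ^+ n] gives back, term by term, the value at
   [u * sigma y], because [z ^+ n = z ^+ i] wherever the coefficient is nonzero. *)
apply: (mulfI (expf_neq0 n z0)); rewrite mulr0 -[RHS]f0 mulr_sumr.
apply: eq_bigr => i _; have [->|fi0] := eqVneq f`_i 0; first by rewrite !mul0r mulr0.
have /dvdnP[q qE] := dvdP _ (Pcoef i (leq_ord i) fi0).
have -> : z ^+ n = z ^+ i.
  transitivity (z ^+ (q * d + i)); first by rewrite -qE subnK ?leq_ord.
  by rewrite exprD mulnC exprM zd expr1n mul1r.
by rewrite mulrCA -exprMn [z * _]mulrC divfK.
Qed.

Definition affine_moduli x sigma := exists u v : K,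
  u != 0 /\ forall y, y \in x -> u * sigma y + v \in x.

Definition affine_good x := exists a b : K, a != 0 /\
  forall sigma, affine_moduli x sigma ->
  forall y, y \in x -> exists2 z, z \in x & sigma (a * y + b) = a * z + b.

(** Moving an equivariant center to the origin kills the translation parts of all twisted affine
    symmetries, which leaves the scalings of [scale_good]. *)
Lemma center_good x c : uniq x -> (1 < size x)%N ->
  (forall sigma (u v : K), u != 0 ->
     (forall y, y \in x -> u * sigma y + v \in x) -> u * sigma c + v = c) ->
  affine_good x.
Proof.
move=> Ux szx Hc; pose x0 := [seq y - c | y <- x].
have Ux0 : uniq x0 by rewrite map_inj_uniq //; apply: addIr.
have [|w w0 Hw] := scale_good Ux0; first by rewrite size_map.
exists w^-1, (- c / w); split=> [|sigma [u [v [u0 uvx]]] y yx].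
  by rewrite invr_eq0.
have Eyc z : w^-1 * z + - c / w = (z - c) / w by rewrite mulrC -mulrDl.
have [||_ /mapP[z zx ->] Hz] := Hw sigma u u0 _ (y - c); last 1 first.
- by exists z; rewrite // !Eyc.
- move=> _ /mapP[z zx ->]; apply/mapP; exists (u * sigma z + v); first exact: uvx.
  by rewrite -[in RHS](Hc _ _ _ u0 uvx) rmorphB mulrBr; ring.
- exact: map_f.
Qed.

Lemma sum_affine x sigma (u v : K) (F : K -> K) : uniq x -> u != 0 ->
  (forall y, y \in x -> u * sigma y + v \in x) ->
  \sum_(y <- x) F y = \sum_(y <- x) F (u * sigma y + v).
Proof.
move=> Ux u0 uvx; rewrite (perm_big _ (perm_affine Ux _ uvx)) ?big_map //.
exact: twisted_scale_inj.
Qed.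

Lemma affine_line_good x : uniq x -> (1 < size x)%N ->
  (size x)%:R != 0 :> K \/ size x = 3%N -> affine_good x.
Proof.
move=> Ux szx.
pose S := \sum_(y <- x) y; pose n := size x.
have sum_const (c : K) : \sum_(y <- x) c = n%:R * c.
  by rewrite big_const_seq count_predT iter_addr_0 mulr_natl.
have SE sigma u v : u != 0 -> (forall y, y \in x -> u * sigma y + v \in x) ->
    S = u * sigma S + n%:R * v.
  move=> u0 uvx; rewrite [LHS](sum_affine _ Ux u0 uvx) rmorph_sum mulr_sumr.
  by rewrite big_split /= sum_const.
have [n0|n0] := eqVneq (n%:R : K) 0; last first.
  move=> _; apply: (@center_good _ (S / n%:R)) => // sigma u v u0 uvx.
  by rewrite [in RHS](SE _ _ _ u0 uvx) fmorph_div rmorph_nat; field.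
case=> [/eqP//|n3].
have three0 : 3%:R = 0 :> K by rewrite -n3.
(* In characteristic 3, three points of sum zero form an arithmetic progression, hence an affine
   copy of the prime field, which every [sigma] fixes pointwise. *)
have [S0|S0] := eqVneq S 0.
  case: x n3 Ux @S @n {szx} sum_const SE n0 S0 => [|x1 [|x2 [|x3 []]]] // _ Ux S n _ _ _ S0.
  have d0 : x2 - x1 != 0.
    by move: Ux; rewrite /= !inE subr_eq0 eq_sym => /andP[/norP[]].
  have x3E : x3 = x1 + 2%:R * (x2 - x1).
    have : x1 + x2 + x3 = 0 by move: S0; rewrite /S !big_cons big_nil addr0 addrA.
    move=> s0; have -> : x3 = (x1 + x2 + x3) - x2 - x1 by ring.
    rewrite s0; have -> : 0 - x2 - x1 = x1 + 2%:R * (x2 - x1) - 3%:R * x2 by ring.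
    by rewrite three0 mul0r subr0.
  exists (x2 - x1)^-1, (- x1 / (x2 - x1)); split; first by rewrite invr_eq0.
  move=> sigma _ y yx; exists y => //.
  have [k _ ->] : exists2 k : nat, True & (x2 - x1)^-1 * y + - x1 / (x2 - x1) = k%:R.
    move: yx; rewrite !inE => /or3P[]/eqP->.
    - by exists 0%N => //; rewrite mulr0n; field.
    - by exists 1%N => //; rewrite mulr1n; field.
    - by exists 2%N => //; rewrite x3E; field.
  exact: rmorph_nat.
(* In characteristic 3 the centroid is not available; S - p2 / S is another
   equivariant center, because - 2 v = v. *)
pose p2 := \sum_(y <- x) y ^+ 2.
apply: (@center_good _ (S - p2 / S)) => // sigma u v u0 uvx.
have SE' : S = u * sigma S by rewrite [LHS](SE _ _ _ u0 uvx) n0 mul0r addr0.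
have p2E : p2 = u ^+ 2 * sigma p2 + 2%:R * v * (u * sigma S).
  rewrite [LHS](sum_affine _ Ux u0 uvx) /S !rmorph_sum !mulr_sumr.
  transitivity (\sum_(y <- x) ((u ^+ 2 * sigma (y ^+ 2) + 2%:R * v * (u * sigma y)) + v ^+ 2)).
    by apply: eq_bigr => y _; rewrite rmorphXn; ring.
  by rewrite !big_split /= sum_const n0 mul0r addr0.
have sS0 : sigma S != 0 by rewrite fmorph_eq0.
rewrite rmorphB fmorph_div.
transitivity (u * sigma S - (u ^+ 2 * sigma p2 + 2%:R * v * (u * sigma S)) /
                            (u * sigma S)); last by rewrite -p2E -SE'.
apply/eqP; rewrite -subr_eq0; apply/eqP.
transitivity (3%:R * v); last by rewrite three0 mul0r.
by field; rewrite u0 sS0.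
Qed.

End AffineLine.

(** * Finite subsets of the projective line *)

Section ProjectiveLine.
Variable K : fieldType.
Implicit Types (u v w : 'cV[K]_2) (g h : 'M[K]_2) (sigma : {rmorphism K -> K}).

Definition cv2 (a b : K) : 'cV[K]_2 := \col_i (if i == 0 then a else b).

Lemma cv2E0 a b : cv2 a b 0 0 = a. Proof. by rewrite mxE. Qed.
Lemma cv2E1 a b : cv2 a b 1 0 = b. Proof. by rewrite mxE. Qed.
Definition cv2E := (cv2E0, cv2E1).

Lemma eq_cv2 u v : u 0 0 = v 0 0 -> u 1 0 = v 1 0 -> u = v.
Proof.
move=> E0 E1; apply/matrixP => i j; rewrite ord1.
by case: i => [[|[|//]] lti]; [move: E0 | move: E1]; congr (_ = _); congr (_ _ _);
  apply: val_inj.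
Qed.

Lemma mul_mx2E g u i : (g *m u) i 0 = g i 0 * u 0 0 + g i 1 * u 1 0.
Proof.
rewrite mxE !big_ord_recl big_ord0 addr0.
by congr (_ + g i _ * u _ _); apply: val_inj.
Qed.

Lemma det_mx2E g : \det g = g 0 0 * g 1 1 - g 0 1 * g 1 0.
Proof.
rewrite (expand_det_row _ 0) !big_ord_recl big_ord0 addr0 /cofactor !det_mx11 !mxE /=.
have -> : lift (0 : 'I_2) (0 : 'I_1) = 1 by apply: val_inj.
have -> : lift (1 : 'I_2) (0 : 'I_1) = 0 by apply: val_inj.
rewrite /= expr0 expr1; ring.
Qed.

Definition br u v := u 0 0 * v 1 0 - u 1 0 * v 0 0.

Lemma br_anti u v : br v u = - br u v.
Proof. rewrite /br; ring. Qed.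

Lemma br_mul g u v : br (g *m u) (g *m v) = \det g * br u v.
Proof. rewrite /br !mul_mx2E det_mx2E; ring. Qed.

Lemma br_scale (a b : K) u v : br (a *: u) (b *: v) = a * b * br u v.
Proof. rewrite /br !mxE; ring. Qed.

Lemma br_map sigma u v : br (map_mx sigma u) (map_mx sigma v) = sigma (br u v).
Proof. by rewrite /br !mxE rmorphB !rmorphM. Qed.

Lemma plucker u v w : br u v *: w = br w v *: u + br u w *: v.
Proof. apply: eq_cv2; rewrite !mxE /br; ring. Qed.

Lemma br_proj_eq u v : u === v -> br u v = 0.
Proof. case=> c _ ->; rewrite /br !mxE; ring. Qed.

Lemma proj_eq_br u v : u != 0 -> v != 0 -> br u v = 0 -> u === v.
Proof.
move=> u0 v0 uv0.
have [i vi0] : exists i, v i 0 != 0.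
  apply/existsP; apply: contraNT v0 => /existsPn v0.
  by apply/eqP/matrixP => i j; rewrite ord1 mxE; apply/eqP/negPn/v0.
have uE : u = (u i 0 / v i 0) *: v.
  suff : v i 0 *: u = u i 0 *: v.
    by move/(congr1 ( *:%R (v i 0)^-1)); rewrite !scalerA mulVf // scale1r mulrC.
  move: uv0 => /eqP; rewrite subr_eq0 => /eqP uv0.
  have i01 : i = 0 \/ i = 1.
    by case: (i) => [[|[|//]] lti]; [left | right]; apply: val_inj.
  by apply: eq_cv2; rewrite !mxE; case: i01 => ->; rewrite ?uv0; try ring;
     rewrite mulrC -uv0 mulrC.
exists (u i 0 / v i 0) => //.
by apply: contraNneq u0 => c0; rewrite uE c0 scale0r.
Qed.

Lemma br_neq0 u v : br u v != 0 -> u != 0 /\ v != 0.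
Proof.
by move=> uv0; split; apply: contraNneq uv0 => ->; rewrite /br !mxE ?mul0r ?mulr0 subr0.
Qed.

Definition mx2 u v : 'M[K]_2 := \matrix_(i, j) (if j == 0 then u i 0 else v i 0).

Lemma det_mx2 u v : \det (mx2 u v) = br u v.
Proof. by rewrite det_mx2E !mxE /br /=; ring. Qed.

Lemma mx2_unit u v : (mx2 u v \in unitmx) = (br u v != 0).
Proof. by rewrite unitmxE unitfE det_mx2. Qed.

Lemma mul_mx2 u v w : mx2 u v *m w = w 0 0 *: u + w 1 0 *: v.
Proof. by apply: eq_cv2; rewrite mul_mx2E !mxE /=; ring. Qed.

Definition pairwise_distinct n (t : 'I_n -> 'cV[K]_2) :=
  forall i j, i != j -> br (t i) (t j) != 0.

(** By [plucker], two of the vectors can be rescaled so that their sum is proportional to the third;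
    each triple is then the image of the frame (1,0), (0,1), (1,1). *)
Lemma three_transitive (s t : 'I_3 -> 'cV[K]_2) :
  pairwise_distinct s -> pairwise_distinct t ->
  exists2 h, h \in unitmx & forall i, s i === h *m t i.
Proof.
pose o0 := @Ordinal 3 0 isT; pose o1 := @Ordinal 3 1 isT; pose o2 := @Ordinal 3 2 isT.
pose M (t : 'I_3 -> 'cV[K]_2) :=
  mx2 (br (t o2) (t o1) *: t o0) (br (t o0) (t o2) *: t o1).
have MU r : pairwise_distinct r -> M r \in unitmx.
  by move=> Ht; rewrite mx2_unit br_scale !mulf_neq0 ?Ht.
have M0 r : M r *m cv2 1 0 = br (r o2) (r o1) *: r o0.
  by rewrite mul_mx2 !cv2E scale1r scale0r addr0.
have M1 r : M r *m cv2 0 1 = br (r o0) (r o2) *: r o1.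
  by rewrite mul_mx2 !cv2E scale1r scale0r add0r.
have M2 r : M r *m cv2 1 1 = br (r o0) (r o1) *: r o2.
  by rewrite mul_mx2 !cv2E !scale1r -plucker.
pose e (i : 'I_3) := if i == o0 then cv2 1 0 else if i == o1 then cv2 0 1 else cv2 1 1.
have Me r i : pairwise_distinct r -> r i === M r *m e i.
  move=> Ht; have [->|->|->] : [\/ i = o0, i = o1 | i = o2].
    by case: i => [[|[|[|//]]] lti]; [constructor 1 | constructor 2 | constructor 3]; apply: val_inj.
  - by rewrite /e /= M0; apply/proj_eq_sym/proj_eq_scale/Ht.
  - by rewrite /e /= M1; apply/proj_eq_sym/proj_eq_scale/Ht.
  - by rewrite /e /= M2; apply/proj_eq_sym/proj_eq_scale/Ht.
move=> Hs Ht; exists (M s *m invmx (M t)).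
  by rewrite unitmx_mul unitmx_inv !MU.
move=> i; apply: proj_eq_trans (Me s i Hs) _.
rewrite -mulmxA; apply: proj_eq_mul; apply: (proj_eq_mul_inj (MU t Ht)).
by rewrite mulmxA mulmxV ?MU // mul1mx; apply/proj_eq_sym/Me.
Qed.

Definition cr u v w z := br u w * br v z / (br u z * br v w).

Lemma cr_mul h u v w z : h \in unitmx ->
  cr (h *m u) (h *m v) (h *m w) (h *m z) = cr u v w z.
Proof.
rewrite unitmxE unitfE => d0; rewrite /cr !br_mul.
by rewrite mulrACA [X in _ / X]mulrACA -[LHS]mulf_div divff ?mul1r ?mulf_neq0.
Qed.

Lemma cr_proj_eq u v w z u' v' w' z' : u === u' -> v === v' -> w === w' ->
  z === z' -> cr u v w z = cr u' v' w' z'.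
Proof.
move=> [a a0 ->] [b b0 ->] [c c0 ->] [d d0 ->]; rewrite /cr !br_scale.
have -> : a * c * br u' w' * (b * d * br v' z') =
  (a * b * c * d) * (br u' w' * br v' z') by ring.
have -> : a * d * br u' z' * (b * c * br v' w') =
  (a * b * c * d) * (br u' z' * br v' w') by ring.
by rewrite -[LHS]mulf_div divff ?mul1r ?mulf_neq0.
Qed.

Lemma cr_map sigma u v w z :
  cr (map_mx sigma u) (map_mx sigma v) (map_mx sigma w) (map_mx sigma z) =
  sigma (cr u v w z).
Proof. by rewrite /cr !br_map fmorph_div !rmorphM. Qed.

(** By a Plucker relation the difference of the two cross ratios is [br z z'] times a nonzero
    factor. *)
Lemma cr_inj u v w z z' : br u v != 0 -> br u w != 0 -> br v w != 0 ->
  br u z != 0 -> br u z' != 0 -> cr u v w z = cr u v w z' -> z === z'.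
Proof.
move=> uv uw vw uz uz' E.
have [_ z0] := br_neq0 uz; have [_ z'0] := br_neq0 uz'.
apply: proj_eq_br => //.
have : cr u v w z - cr u v w z' = 0 by rewrite E subrr.
have -> : cr u v w z - cr u v w z' =
    br u w * br u v * br z z' / (br u z * br u z' * br v w) * -1.
  have P : br v z * br u z' - br v z' * br u z = - (br u v * br z z').
    rewrite /br; ring.
  rewrite /cr; transitivity (br u w * (br v z * br u z' - br v z' * br u z) /
     (br u z * br u z' * br v w)); first by field; rewrite vw uz uz'.
  by rewrite P; field; rewrite vw uz uz'.
move/eqP; rewrite mulrN1 oppr_eq0 !mulf_eq0 invr_eq0 !mulf_eq0.
by rewrite (negPf uw) (negPf uv) (negPf uz) (negPf uz') (negPf vw) !orbF /= => /eqP.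
Qed.

End ProjectiveLine.

(** * The projective line with a marked point *)

Section MarkedLine.
Variable K : fieldType.
Hypothesis sep_closed : forall q : {poly K},
  separable_poly q -> (1 < size q)%N -> exists x, root q x.

Lemma cv2_scale (u : 'cV[K]_2) : u 1 0 != 0 -> u = u 1 0 *: cv2 (u 0 0 / u 1 0) 1.
Proof.
by move=> u1; apply: eq_cv2; rewrite mxE !cv2E ?mulr1 // mulrCA divff ?mulr1.
Qed.

(** With [r] at infinity the symmetries fixing it become affine. The vector [g *m r] is normalized
    exactly, not only up to a scalar, because [three_plus_two_good] adds [r] to another vector. *)
Lemma marked_line_good (r : 'cV[K]_2) (t : seq 'cV[K]_2) :
  (forall v, v \in t -> br r v != 0) -> pairwise (fun u v => br u v != 0) t ->
  (1 < size t)%N -> (size t)%:R != 0 :> K \/ size t = 3%N ->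
  exists g, [/\ g \in unitmx, g *m r = cv2 1 0 &
    forall sigma : {rmorphism K -> K},
      (exists h, [/\ h \in unitmx, h *m map_mx sigma r === r &
         pincl (mximg h (conjs sigma t)) t]) ->
      pincl (conjs sigma (mximg g t)) (mximg g t)].
Proof.
move=> rt Ut szt nt.
have [w rw] : exists w, br r w != 0.
  by case: t szt rt {Ut nt} => [|w t] // _ rt; exists w; rewrite rt ?mem_head.
pose P := invmx (mx2 r w).
have MU : mx2 r w \in unitmx by rewrite mx2_unit.
have PU : P \in unitmx by rewrite unitmx_inv.
have Pr : P *m r = cv2 1 0.
  have <- : mx2 r w *m cv2 1 0 = r by rewrite mul_mx2 !cv2E scale1r scale0r addr0.
  by rewrite mulmxA mulVmx // mul1mx.
have Pt v : v \in t -> (P *m v) 1 0 != 0.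
  move=> vt; have := br_mul P r v; rewrite Pr /br !cv2E mul1r mul0r subr0 => ->.
  by rewrite mulf_neq0 ?rt // -unitfE -unitmxE.
pose y (v : 'cV[K]_2) := (P *m v) 0 0 / (P *m v) 1 0.
have Py v : v \in t -> P *m v = (P *m v) 1 0 *: cv2 (y v) 1.
  by move=> vt; apply: cv2_scale; apply: Pt.
have yE v : v \in t -> P *m v === cv2 (y v) 1.
  by move=> vt; rewrite {1}Py //; apply/proj_eq_scale/Pt.
pose x := [seq y v | v <- t].
have Ux : uniq x.
  rewrite uniq_pairwise pairwise_map; apply/(pairwiseP 0) => i j ilt jlt ij /=.
  have /(pairwiseP 0)/(_ i j ilt jlt ij) := Ut; apply: contraNneq => yij.
  apply/eqP/br_proj_eq/(proj_eq_mul_inj PU).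
  apply: proj_eq_trans (yE _ (mem_nth _ ilt)) _; rewrite yij.
  exact/proj_eq_sym/yE/mem_nth.
have [|| a [b [a0 Hab]]] := affine_line_good sep_closed Ux; rewrite ?size_map //.
pose g := mx2 (cv2 a 0) (cv2 b 1) *m P.
have gt v : v \in t -> g *m v === cv2 (a * y v + b) 1.
  move=> vt; rewrite -mulmxA; apply: proj_eq_trans (proj_eq_mul _ (yE _ vt)) _.
  rewrite mul_mx2 !cv2E; have -> : y v *: cv2 a 0 + 1 *: cv2 b 1 = cv2 (a * y v + b) 1.
    by apply: eq_cv2; rewrite !mxE /=; ring.
  exact: proj_eq_refl.
exists (a^-1 *: g); split.
- by rewrite unitmxZ ?unitfE ?invr_eq0 // unitmx_mul PU mx2_unit /br !cv2E mulr1 mul0r subr0 a0.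
- rewrite -scalemxAl -mulmxA Pr mul_mx2 !cv2E scale1r scale0r addr0.
  by apply: eq_cv2; rewrite mxE !cv2E ?mulVf ?mulr0.
move=> sigma [h [hU hr ht]].
have xmod : affine_moduli x sigma.
  pose k := P *m h *m invmx (map_mx sigma P).
  have sPU : map_mx sigma P \in unitmx by rewrite map_unitmx.
  have kU : k \in unitmx by rewrite !unitmx_mul PU hU unitmx_inv.
  have kE v : k *m map_mx sigma (P *m v) = P *m (h *m map_mx sigma v).
    by rewrite map_mxM !mulmxA -[_ *m map_mx sigma P]mulmxA mulVmx // mulmx1.
  have k10 : k 1 0 = 0.
    have [c _ /matrixP/(_ 1 0)] := proj_eq_mul P hr.
    by rewrite -kE Pr mul_mx2E !mxE /= rmorph1 rmorph0 mulr1 !mulr0 addr0.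
  have k11 : k 1 1 != 0 /\ k 0 0 != 0.
    apply/andP; rewrite -negb_or orbC -mulf_eq0.
    by move: kU; rewrite unitmxE unitfE det_mx2E k10 mulr0 subr0.
  case: k11 => k11 k00.
  exists (k 0 0 / k 1 1), (k 0 1 / k 1 1); split.
    by rewrite mulf_neq0 ?invr_neq0.
  move=> _ /mapP[v vt ->].
  have [v' v't hv] : exists2 v', v' \in t & h *m map_mx sigma v === v'.
    by apply: ht; apply/map_f/map_f.
  apply/mapP; exists v' => //.
  have : k *m cv2 (sigma (y v)) 1 === cv2 (y v') 1.
    apply: proj_eq_trans (yE _ v't); apply: proj_eq_trans (proj_eq_mul P hv).
    rewrite -kE; apply: proj_eq_mul.
    have := proj_eq_sym (proj_eq_map sigma (yE _ vt)); congr (_ === _).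
    by apply: eq_cv2; rewrite !mxE /= ?rmorph1.
  case=> c c0 E.
  have /matrixP/(_ 1 0) := E; rewrite mul_mx2E [in RHS]mxE !cv2E k10 mul0r add0r !mulr1 => cE.
  have /matrixP/(_ 0 0) := E; rewrite mul_mx2E [in RHS]mxE !cv2E !mulr1 -cE => E0.
  by apply: (mulfI k11); rewrite -E0; field.
move=> _ /mapP[_ /mapP[v vt ->] ->].
have [_ /mapP[v' v't ->] E] := Hab sigma xmod _ (map_f y vt).
exists ((a^-1 *: g) *m v'); first exact: map_f.
have scl u : (a^-1 *: g) *m u === g *m u.
  by rewrite -scalemxAl; apply/proj_eq_scale; rewrite invr_eq0.
apply: proj_eq_trans (proj_eq_map _ (scl _)) _.
apply: proj_eq_trans _ (proj_eq_sym (scl _)).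
apply: proj_eq_trans (proj_eq_map _ (gt _ vt)) _.
apply: proj_eq_trans _ (proj_eq_sym (gt _ v't)).
have -> : map_mx sigma (cv2 (a * y v + b) 1) = cv2 (a * y v' + b) 1.
  by apply: eq_cv2; rewrite !mxE /= ?rmorph1.
exact: proj_eq_refl.
Qed.

End MarkedLine.

(** * Cross ratios and symmetries of five points on a line *)

Local Notation q0 := (@Ordinal 5 0 isT).
Local Notation q1 := (@Ordinal 5 1 isT).
Local Notation q2 := (@Ordinal 5 2 isT).
Local Notation q3 := (@Ordinal 5 3 isT).
Local Notation q4 := (@Ordinal 5 4 isT).

Section FivePoints.
Variable K : fieldType.
Implicit Types (s t : 'I_5 -> 'cV[K]_2) (p q : 'S_5) (sigma : {rmorphism K -> K}).

Lemma br_neq0_proj_eq (u v u' v' : 'cV[K]_2) :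
  u === u' -> v === v' -> br u' v' != 0 -> br u v != 0.
Proof. by move=> [a a0 ->] [b b0 ->] uv; rewrite br_scale !mulf_neq0. Qed.

Lemma pairwise_distinct_mul n (t : 'I_n -> 'cV[K]_2) h : h \in unitmx ->
  pairwise_distinct t -> pairwise_distinct (fun i => h *m t i).
Proof.
by rewrite unitmxE unitfE => h0 Ht i j ij; rewrite br_mul mulf_neq0 ?Ht.
Qed.

Lemma pairwise_distinct_map n (t : 'I_n -> 'cV[K]_2) sigma :
  pairwise_distinct t -> pairwise_distinct (fun i => map_mx sigma (t i)).
Proof. by move=> Ht i j ij; rewrite br_map fmorph_eq0 Ht. Qed.

Lemma pairwise_distinct_inj n m (t : 'I_n -> 'cV[K]_2) (f : 'I_m -> 'I_n) :
  injective f -> pairwise_distinct t -> pairwise_distinct (fun i => t (f i)).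
Proof. by move=> injf Ht i j ij; rewrite Ht // inj_eq. Qed.

Lemma pairwise_distinct_eq n (t : 'I_n -> 'cV[K]_2) i j :
  pairwise_distinct t -> t i === t j -> i = j.
Proof.
move=> Ht ij; apply/eqP; apply: contraT => /Ht.
by rewrite br_proj_eq ?eqxx.
Qed.

(* The family of all cross ratios of four of the five points, indexed by the
   orderings p; for q : 'S_5, sigma acts on the points through q iff it carries
   lam t p to lam t (p * q). *)
Definition lam t p := cr (t (p q0)) (t (p q1)) (t (p q2)) (t (p q3)).

Lemma lam_perm t q p : lam (fun i => t (q i)) p = lam t (p * q)%g.
Proof. by rewrite /lam !permM. Qed.

Lemma lam_map t sigma p : lam (fun i => map_mx sigma (t i)) p = sigma (lam t p).
Proof. exact: cr_map. Qed.

Lemma lam_mul s t h p : h \in unitmx -> (forall i, s i === h *m t i) ->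
  lam s p = lam t p.
Proof. by move=> hU st; rewrite -[RHS](cr_mul _ _ _ _ hU); apply: cr_proj_eq. Qed.

Lemma forall_I5 (P : 'I_5 -> Prop) :
  P q0 -> P q1 -> P q2 -> P q3 -> P q4 -> forall i, P i.
Proof.
move=> P0 P1 P2 P3 P4 [[|[|[|[|[|//]]]]] lti]; rewrite (bool_irrelevance lti isT);
  assumption.
Qed.

(** Points 0, 1, 2 determine the projective map; the two cross ratios then locate points 3 and 4. *)
Lemma lam_projective s t : pairwise_distinct s -> pairwise_distinct t ->
  lam s 1%g = lam t 1%g -> lam s (tperm q3 q4) = lam t (tperm q3 q4) ->
  exists2 h, h \in unitmx & forall i, s i === h *m t i.
Proof.
move=> Hs Ht E1 E2.
pose f : 'I_3 -> 'I_5 := @widen_ord 3 5 isT.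
have injf : injective f by move=> i j /(congr1 val)/= ij; apply: val_inj.
have [h hU Hh] := three_transitive (pairwise_distinct_inj injf Hs)
                                   (pairwise_distinct_inj injf Ht).
exists h => //.
have H0 : s q0 === h *m t q0 by have := Hh ord0; congr (s _ === h *m t _); apply: val_inj.
have H1 : s q1 === h *m t q1.
  by have := Hh (Ordinal (isT : 1 < 3)%N); congr (s _ === h *m t _); apply: val_inj.
have H2 : s q2 === h *m t q2.
  by have := Hh (Ordinal (isT : 2 < 3)%N); congr (s _ === h *m t _); apply: val_inj.
have Hht := pairwise_distinct_mul hU Ht.
have Hi i : i != q0 -> cr (s q0) (s q1) (s q2) (s i) = cr (t q0) (t q1) (t q2) (t i) ->
    s i === h *m t i.
  rewrite eq_sym => i0 E; apply: (@cr_inj _ (s q0) (s q1) (s q2)); try exact: Hs.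
    exact: br_neq0_proj_eq H0 (proj_eq_refl _) (Hht _ _ i0).
  rewrite E -(cr_mul _ _ _ _ hU); apply: cr_proj_eq; try exact: proj_eq_sym.
  exact: proj_eq_refl.
apply: forall_I5 => //; apply: Hi => //.
  by move: E1; rewrite /lam !perm1.
by move: E2; rewrite /lam tpermL !tpermD.
Qed.

(** Each of its elements is induced by a projective map, by [lam_stab_projective]. The description
    by equalities in [K] makes it a finite group, to which Cauchy's theorem and the count of fixed
    points apply. *)
Definition lam_stab t := [set p | [forall q, lam t (q * p)%g == lam t q]].

Lemma lam_stabP t p : reflect (forall q, lam t (q * p)%g = lam t q) (p \in lam_stab t).
Proof.
rewrite inE; apply: (iffP forallP) => H q; first exact/eqP/H.
exact/eqP/H.
Qed.

Lemma lam_stab_group_set t : group_set (lam_stab t).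
Proof.
apply/group_setP; split=> [|p q /lam_stabP Hp /lam_stabP Hq]; apply/lam_stabP => r.
  by rewrite mulg1.
by rewrite mulgA Hq Hp.
Qed.
Canonical lam_stab_group t := Group (lam_stab_group_set t).

Lemma lam_stab_projective t p : pairwise_distinct t -> p \in lam_stab t ->
  exists2 h, h \in unitmx & forall i, h *m t i === t (p i).
Proof.
move=> Ht /lam_stabP pA.
have [|||h hU Hh] := @lam_projective (fun i => t (p i)) t _ Ht.
- exact: pairwise_distinct_inj (@perm_inj _ p) Ht.
- by rewrite lam_perm pA.
- by rewrite lam_perm pA.
- by exists h => // i; apply/proj_eq_sym/Hh.
Qed.

Lemma lam_stab_fix3 t p i j k : pairwise_distinct t -> p \in lam_stab t ->
  uniq [:: i; j; k] -> p i = i -> p j = j -> p k = k -> p = 1%g.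
Proof.
move=> Ht pA; rewrite /= !inE negb_or andbT => /andP[/andP[ij ik] jk] pi pj pk.
have [h hU Hh] := lam_stab_projective Ht pA.
apply/permP => l; rewrite perm1.
have [->//|li] := eqVneq l i.
apply: (@pairwise_distinct_eq _ t) => //.
rewrite eq_sym in li.
apply: (@cr_inj _ (t i) (t j) (t k)); try exact: Ht.
  by apply: Ht; rewrite -{1}pi (inj_eq perm_inj).
rewrite -[RHS](cr_mul _ _ _ _ hU); apply/esym/cr_proj_eq => //.
- by rewrite -{2}pi.
- by rewrite -{2}pj.
- by rewrite -{2}pk.
Qed.

Definition lam_moduli t sigma :=
  exists q, forall p, sigma (lam t p) = lam t (p * q)%g.

Definition lam_good t := exists2 g, g \in unitmx &
  forall sigma, lam_moduli t sigma ->
  forall i, exists j, map_mx sigma (g *m t i) === g *m t j.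

Lemma lam_moduli_projective t sigma q : pairwise_distinct t ->
  (forall p, sigma (lam t p) = lam t (p * q)%g) ->
  exists2 h, h \in unitmx & forall i, h *m map_mx sigma (t i) === t (q i).
Proof.
move=> Ht Hq.
have [|||h hU Hh] := @lam_projective (fun i => t (q i)) (fun i => map_mx sigma (t i)) _
  (pairwise_distinct_map sigma Ht).
- exact: pairwise_distinct_inj (@perm_inj _ q) Ht.
- by rewrite lam_perm lam_map Hq.
- by rewrite lam_perm lam_map Hq.
- by exists h => // i; apply/proj_eq_sym/Hh.
Qed.

End FivePoints.

(** * Five points with a symmetry of order 3 or 5 *)

Section RigidFivePoints.
Variable K : fieldType.
Hypothesis sep_closed : forall q : {poly K},
  separable_poly q -> (1 < size q)%N -> exists x, root q x.
Hypothesis char2 : 2%N \notin [pchar K].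
Implicit Types (t : 'I_5 -> 'cV[K]_2) (p : 'S_5) (sigma : {rmorphism K -> K}).

Lemma natr2_neq0 : 2%:R != 0 :> K.
Proof. by apply: contraNN char2 => two0; rewrite inE. Qed.

Lemma sqrt_exists (D : K) : exists d, d ^+ 2 = D.
Proof.
have [->|D0] := eqVneq D 0; first by exists 0; rewrite expr0n.
have [d /rootP] : exists d, root ('X^2 - D%:P) d.
  apply: sep_closed; last by rewrite size_XnsubC.
  rewrite unlock derivB derivXn derivC subr0.
  apply/Bezout_eq1_coprimepP.
  exists (- (D^-1)%:P, (D^-1 / 2%:R)%:P * 'X) => /=.
  have EE : (D^-1)%:P * D%:P = 1 by rewrite -polyCM mulVf.
  have EF : (D^-1 / 2%:R)%:P * 2%:R = (D^-1)%:P.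
    by rewrite -polyC_natr -polyCM divfK ?natr2_neq0.
  have -> : (D^-1 / 2%:R)%:P * 'X * ('X^1 *+ 2) = ((D^-1 / 2%:R)%:P * 2%:R) * 'X^2 by ring.
  rewrite EF -[RHS]EE; ring.
by rewrite !hornerE => /eqP; rewrite subr_eq0 => /eqP; exists d.
Qed.

(** Quadratic formula: outside characteristic 2 the discriminant has a square root in a separable
    closure. The transpose appears because [det0P] yields row vectors. *)
Lemma eigenvector2 (h : 'M[K]_2) :
  exists a : K, exists2 e : 'cV[K]_2, e != 0 & h *m e = a *: e.
Proof.
have [d dE] := sqrt_exists ((h 0 0 + h 1 1) ^+ 2 - 4%:R * \det h).
pose a := (h 0 0 + h 1 1 + d) / 2%:R; exists a.
have : \det (h - a%:M)^T == 0.
  have dE' : d ^+ 2 = (h 0 0 - h 1 1) ^+ 2 + 4%:R * h 0 1 * h 1 0.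
    by rewrite dE det_mx2E; ring.
  rewrite det_tr det_mx2E !mxE /= !mulr1n !mulr0n !subr0.
  apply/eqP; transitivity ((d ^+ 2 - ((h 0 0 - h 1 1) ^+ 2 + 4%:R * h 0 1 * h 1 0)) / 4%:R).
    rewrite /a; field.
    by rewrite natr2_neq0 -[4%N]/(2 * 2)%N natrM mulf_neq0 ?natr2_neq0.
  by rewrite dE' subrr mul0r.
case/det0P => e e0 eh; exists e^T; first by rewrite trmx_eq0.
apply/eqP; rewrite -subr_eq0 -mul_scalar_mx -mulmxBl -[X in X == _]trmxK.
by rewrite trmx_mul trmxK eh trmx0.
Qed.

(** In the eigenbasis the orbit of [e + f] consists of the points (1, z^k) with [z = b / a]. As [n]
    is prime and [z] is not 1, [z] is a primitive [n]-th root of unity, so [sigma z] is a power of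
    [z]. *)
Lemma diag_cycle_stable (h : 'M[K]_2) (e f : 'cV[K]_2) (a b : K) n :
  prime n -> br e f != 0 -> h *m e = a *: e -> h *m f = b *: f ->
  a != 0 -> b != 0 -> a != b -> iter n (mulmx h) (e + f) === e + f ->
  let g := invmx (mx2 e f) in
  [/\ forall sigma, map_mx sigma (g *m e) === g *m e,
      forall sigma, map_mx sigma (g *m f) === g *m f
    & forall sigma k, exists m,
      map_mx sigma (g *m iter k (mulmx h) (e + f)) ===
      g *m iter m (mulmx h) (e + f)].
Proof.
move=> n_pr ef he hf a0 b0 ab hn g.
have MU : mx2 e f \in unitmx by rewrite mx2_unit.
have gM x y : g *m (x *: e + y *: f) = cv2 x y.
  have -> : x *: e + y *: f = mx2 e f *m cv2 x y by rewrite mul_mx2 !cv2E.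
  by rewrite mulmxA mulVmx // mul1mx.
have ge : g *m e = cv2 1 0 by rewrite -(gM 1 0) scale1r scale0r addr0.
have gf : g *m f = cv2 0 1 by rewrite -(gM 0 1) scale1r scale0r add0r.
have hk k : iter k (mulmx h) (e + f) = a ^+ k *: e + b ^+ k *: f.
  elim: k => [|k IHk] /=; first by rewrite !scale1r.
  by rewrite IHk mulmxDr -!scalemxAr he hf !scalerA -!exprSr.
pose z := b / a.
have ghk k : g *m iter k (mulmx h) (e + f) === cv2 1 (z ^+ k).
  rewrite hk gM; exists (a ^+ k); first exact: expf_neq0.
  apply: eq_cv2; rewrite !mxE /= ?mulr1 // exprMn exprVn mulrCA divff ?mulr1 //.
  exact: expf_neq0.
have zn : z ^+ n = 1.
  have := proj_eq_mul g hn; rewrite -[e + f]/(iter 0 (mulmx h) (e + f)).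
  move/(proj_eq_trans (proj_eq_sym (ghk n))) => /proj_eq_trans/(_ (ghk 0%N)).
  case=> c c0 E; have /matrixP/(_ 0 0) := E; have /matrixP/(_ 1 0) := E.
  by rewrite !mxE /= expr0 !mulr1 => -> <-.
have z1 : z != 1.
  by apply: contraNneq ab => z1; rewrite -(divfK a0 b) -/z z1 mul1r.
have z_prim : n.-primitive_root z.
  have [m m_prim mn] := prim_order_exists (prime_gt0 n_pr) zn.
  have [_ /(_ m mn)/pred2P[m1|mE]] := primeP n_pr; last by rewrite -mE.
  by have := prim_expr_order m_prim; rewrite m1 expr1 => /eqP; rewrite (negPf z1).
split=> sigma.
- rewrite ge (_ : map_mx _ _ = cv2 1 0); first exact: proj_eq_refl.
  by apply: eq_cv2; rewrite !mxE /= ?rmorph1 ?rmorph0.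
- rewrite gf (_ : map_mx _ _ = cv2 0 1); first exact: proj_eq_refl.
  by apply: eq_cv2; rewrite !mxE /= ?rmorph1 ?rmorph0.
move=> k; have [j sz] : {j : 'I_n | sigma z = z ^+ j}.
  by apply: prim_rootP; rewrite // -rmorphXn zn rmorph1.
exists (j * k)%N; apply: proj_eq_trans (proj_eq_map sigma (ghk k)) _.
apply: proj_eq_trans _ (proj_eq_sym (ghk _)).
rewrite (_ : map_mx _ _ = cv2 1 (z ^+ (j * k))); first exact: proj_eq_refl.
by apply: eq_cv2; rewrite !mxE /= ?rmorph1 // rmorphXn sz -exprM.
Qed.

Lemma iter_projective t p h : (forall i, h *m t i === t (p i)) ->
  forall k i, iter k (mulmx h) (t i) === t ((p ^+ k)%g i).
Proof.
move=> Hh; elim=> [|k IHk] i /=; first by rewrite expg0 perm1; apply: proj_eq_refl.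
by apply: proj_eq_trans (proj_eq_mul _ (IHk i)) _; rewrite expgSr permM.
Qed.

Definition rigid t := exists2 g, g \in unitmx &
  forall sigma i, exists j, map_mx sigma (g *m t i) === g *m t j.

Lemma rigid_lam_good t : rigid t -> lam_good t.
Proof. by case=> g gU Hg; exists g => // sigma _ i; apply: Hg. Qed.

Lemma rigid_orbit t p h (g : 'M[K]_2) i : g \in unitmx ->
  (forall j, h *m t j === t (p j)) ->
  (forall sigma k, exists m, map_mx sigma (g *m iter k (mulmx h) (t i)) ===
     g *m iter m (mulmx h) (t i)) ->
  forall sigma k, exists j, map_mx sigma (g *m t ((p ^+ k)%g i)) === g *m t j.
Proof.
move=> gU Hh Hg sigma k; have [m Hm] := Hg sigma k.
exists ((p ^+ m)%g i); apply: proj_eq_trans (proj_eq_mul _ (iter_projective Hh _ _)).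
apply: proj_eq_trans Hm; apply/proj_eq_map/proj_eq_mul/proj_eq_sym.
exact: iter_projective.
Qed.

Lemma card_fix_mod (G : {group 'S_5}) (n : nat) : (n.-group G)%g ->
  #|('Fix_('P)(G))%g| = 5 %[mod n].
Proof.
move=> Gn; have := pgroup_fix_mod (to := perm_action 'I_5) (S := setT) Gn.
rewrite setTI cardsT card_ord => -> //.
by apply/actsP => a _ x; rewrite !inE.
Qed.

Lemma prime_order_group p n : prime n -> #[p]%g = n -> (n.-group <[p]>)%g.
Proof. by move=> n_pr pn; rewrite /pgroup -orderE pn pnat_id. Qed.

Lemma mem_fix_cycle p i : (i \in 'Fix_('P)(<[p]>)%g) = (p i == i).
Proof. by rewrite afix_cycle; apply/afix1P/eqP. Qed.

(** The five points are one orbit of [h]. If [h] has two eigenvalues they become the fifth roots of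
    unity; if it has one they become an arithmetic progression. *)
Lemma rigid_order5 t p : pairwise_distinct t -> p \in lam_stab t ->
  #[p]%g = 5 -> rigid t.
Proof.
move=> Ht pA p5; have [h hU Hh] := lam_stab_projective Ht pA.
(* The number of fixed points is divisible by 5, so a single one would make [p] trivial. *)
have no_fix i : p i != i.
  apply/eqP => pi; have := card_fix_mod (@prime_order_group p 5 isT p5).
  set F := ('Fix_('P)(<[p]>))%g => cF.
  have F5 : #|F| = 5.
    have : (0 < #|F| <= 5)%N.
      have := max_card F; rewrite card_ord => ->; rewrite andbT; apply/card_gt0P.
      by exists i; rewrite mem_fix_cycle pi.
    by move: cF; case: #|F| => [|[|[|[|[|[|]]]]]].
  have FT : F = setT by apply/eqP; rewrite eqEcard subsetT cardsT card_ord F5.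
  have p1 : p = 1%g.
    apply/permP => j; rewrite perm1; apply/eqP.
    by rewrite -mem_fix_cycle -/F FT inE.
  by move: p5; rewrite p1 order1.
pose i0 := @Ordinal 5 0 isT; pose c := t i0.
have orb j : exists k, j = (p ^+ k)%g i0.
  apply/porbitP; suff -> : porbit p i0 = setT by rewrite inE.
  apply/eqP; rewrite eqEcard subsetT cardsT card_ord.
  have := dvdn_orbit 'P <[p]>%G i0; rewrite -porbitE -orderE p5.
  have [_ H5] := primeP (isT : prime 5); move/H5/orP => [|/eqP->//].
  move=> /cards1P[x E]; have := no_fix i0.
  have := mem_porbit p 1 i0; have := mem_porbit p 0 i0.
  by rewrite expg0 perm1 expg1 E !inE => /eqP-> /eqP->; rewrite eqxx.
suff [g gU Hg] : exists2 g, g \in unitmx & forall sigma k, exists m,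
    map_mx sigma (g *m iter k (mulmx h) c) === g *m iter m (mulmx h) c.
  exists g => // sigma i; have [k ->] := orb i.
  exact: rigid_orbit Hg sigma k.
have [a [e e0 he]] := eigenvector2 h.
have c0 : c != 0.
  by have [] := @br_neq0 _ c (t (@Ordinal 5 1 isT)); rewrite // Ht.
have a0 : a != 0.
  apply: contraNneq e0 => a0; rewrite -(mulKmx hU e) he a0 scale0r mulmx0 //.
have ec : br e c != 0.
  apply/eqP => /(proj_eq_br e0 c0) ec.
  have : t i0 === t (p i0).
    apply: proj_eq_trans (Hh i0); apply: proj_eq_trans (proj_eq_sym ec) _.
    apply: proj_eq_trans (proj_eq_mul h ec); rewrite he.
    exact/proj_eq_sym/proj_eq_scale.
  by move/(pairwise_distinct_eq Ht)/esym/eqP; rewrite (negPf (no_fix _)).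
have [b [d hc]] : exists b d, h *m c = b *: e + d *: c.
  exists (br (h *m c) c / br e c), (br e (h *m c) / br e c).
  have := plucker e c (h *m c) => /(congr1 ( *:%R (br e c)^-1)).
  by rewrite scalerA mulVf // scale1r scalerDr !scalerA ![_^-1 * _]mulrC.
have d0 : d != 0.
  have := br_mul h e c; rewrite he hc => E.
  have : br (a *: e) (b *: e + d *: c) = a * d * br e c by rewrite /br !mxE; ring.
  rewrite E => F; apply: contraTneq hU => d0.
  by rewrite unitmxE unitfE; apply/negPn; rewrite -(mulIr_eq0 _ (mulIf ec)) F d0 mulr0 mul0r.
have b0 : b != 0.
  apply: contra_neq (no_fix i0) => b0; apply: (pairwise_distinct_eq Ht).
  apply: proj_eq_trans (proj_eq_sym (Hh i0)) _; rewrite -/c hc b0 scale0r add0r.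
  exact: proj_eq_scale.
(* With equal eigenvalues [h] is, up to a scalar, the translation by 1 in the basis [f], [c]; the
   orbit has integer coordinates, which [sigma] fixes. *)
have [ad|ad] := eqVneq a d.
  pose f := (b / a) *: e.
  have fc : br f c != 0 by rewrite -[c]scale1r br_scale !mulf_neq0 ?invr_neq0 ?oner_neq0.
  have hf : h *m f = a *: f by rewrite -scalemxAr he !scalerA mulrC.
  have hk k : iter k (mulmx h) c = a ^+ k *: (k%:R *: f + c).
    elim: k => [|k IHk] /=; first by rewrite scale1r scale0r add0r.
    rewrite IHk -scalemxAr mulmxDr -scalemxAr hf hc -ad exprSr -[RHS]scalerA; congr (_ *: _).
    rewrite !scalerDr !scalerA mulrSr mulrDr mulr1 addrA; congr (_ + _).
    by rewrite -scalerDl; congr (_ *: _); field.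
  exists (invmx (mx2 f c)); first by rewrite unitmx_inv mx2_unit.
  move=> sigma k; exists k; rewrite hk -!scalemxAr map_mxZ.
  have -> : k%:R *: f + c = mx2 f c *m cv2 k%:R 1.
    by rewrite mul_mx2 !cv2E scale1r.
  rewrite mulmxA mulVmx ?mx2_unit // mul1mx.
  have -> : map_mx sigma (cv2 k%:R 1) = cv2 k%:R 1.
    by apply: eq_cv2; rewrite !mxE /= ?rmorph1 ?rmorph_nat.
  exists (sigma (a ^+ k) / a ^+ k); rewrite ?scalerA ?divfK ?mulf_neq0 ?invr_neq0 //;
  by rewrite ?fmorph_eq0 expf_neq0.
(* This multiple of [e] makes [c + f] an eigenvector for [d], so that [c] is the sum of the
   eigenvectors [- f] and [c + f]. *)
pose f := (b / (d - a)) *: e.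
have ad0 : d - a != 0 by rewrite subr_eq0 eq_sym.
have hf : h *m f = a *: f by rewrite -scalemxAr he !scalerA mulrC.
have hcf : h *m (c + f) = d *: (c + f).
  rewrite mulmxDr hf hc /f !scalerDr !scalerA addrAC -scalerDl addrC; congr (_ + _ *: _).
  by field.
have cE : c = - f + (c + f) by rewrite addrCA addNr addr0.
have hNf : h *m (- f) = a *: (- f) by rewrite mulmxN hf scalerN.
have fcf : br (- f) (c + f) != 0.
  have -> : br (- f) (c + f) = - (b / (d - a)) * br e c by rewrite /br !mxE; ring.
  by rewrite !mulf_neq0 ?oppr_eq0 ?mulf_neq0 ?invr_neq0.
have h5 : iter 5 (mulmx h) (- f + (c + f)) === - f + (c + f).
  rewrite -cE; apply: proj_eq_trans (iter_projective Hh 5 i0) _.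
  by have := expg_order p; rewrite p5 => ->; rewrite perm1; apply: proj_eq_refl.
have [_ _ Hg] := @diag_cycle_stable h (- f) (c + f) a d 5 isT fcf hNf hcf a0 d0 ad h5.
exists (invmx (mx2 (- f) (c + f))); first by rewrite unitmx_inv mx2_unit.
by rewrite -cE in Hg.
Qed.

(** Counting fixed points modulo 3 shows that [p] fixes exactly two points and cycles the others.
    The fixed ones are eigenvectors of [h], and the normal form is zero, infinity and the cube roots
    of unity. *)
Lemma rigid_order3 t p : pairwise_distinct t -> p \in lam_stab t ->
  #[p]%g = 3 -> rigid t.
Proof.
move=> Ht pA p3; have [h _ Hh] := lam_stab_projective Ht pA.
have p1 : p != 1%g by apply: contra_eq_neq p3 => ->; rewrite order1.
have := card_fix_mod (@prime_order_group p 3 isT p3).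
set F := ('Fix_('P)(<[p]>))%g => cF.
have F2 : #|F| == 2.
  have : (#|F| <= 5)%N by have := max_card F; rewrite card_ord.
  have : #|F| != 5.
    apply: contraNneq p1 => F5; apply/eqP/permP => j; rewrite perm1; apply/eqP.
    by rewrite -mem_fix_cycle -/F (_ : F = setT) ?inE //; apply/eqP;
       rewrite eqEcard subsetT cardsT card_ord F5.
  by move: cF; case: #|F| => [|[|[|[|[|[|]]]]]].
have /cards2P[x [y [xy FE]]] := F2.
have px : p x = x by apply/eqP; rewrite -mem_fix_cycle -/F FE !inE eqxx.
have py : p y = y by apply/eqP; rewrite -mem_fix_cycle -/F FE !inE eqxx orbT.
have [z pz] : exists z, p z != z.
  apply/existsP; apply: contraNT p1 => /existsPn H; apply/eqP/permP => z.
  by rewrite perm1; apply/eqP/negPn.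
have p3z i : p (p (p i)) = i.
  by have := expg_order p; rewrite p3 !expgS expg0 mulg1 => /permP/(_ i); rewrite !permM perm1.
have Us : uniq [:: x; y; z; p z; p (p z)].
  rewrite /= !inE !negb_or xy /= !andbT.
  have zx : x != z by apply: contraNneq pz => <-; rewrite px.
  have zy : y != z by apply: contraNneq pz => <-; rewrite py.
  have xpz : x != p z by rewrite -{1}px (inj_eq perm_inj).
  have ypz : y != p z by rewrite -{1}py (inj_eq perm_inj).
  have xppz : x != p (p z) by rewrite -{1}px (inj_eq perm_inj).
  have yppz : y != p (p z) by rewrite -{1}py (inj_eq perm_inj).
  rewrite zx zy xpz ypz xppz yppz (inj_eq perm_inj) ![z == p z]eq_sym pz /= andbT.
  by apply: contraNneq pz => E; rewrite -[X in _ == X](p3z z) -E.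
have sT : [:: x; y; z; p z; p (p z)] =i enum 'I_5.
  have := @uniq_min_size _ [:: x; y; z; p z; p (p z)] (enum 'I_5) Us.
  by rewrite -cardE card_ord => -[] // i _; rewrite mem_enum.
have [a a0 hx] : h *m t x === t x by rewrite -{2}px.
have [b b0 hy] : h *m t y === t y by rewrite -{2}py.
pose k1 := br (t z) (t y) / br (t x) (t y); pose k2 := br (t x) (t z) / br (t x) (t y).
have [zx zy] : z != x /\ z != y.
  by split; apply: contraNneq pz => ->; rewrite ?px ?py.
have txy := Ht _ _ xy.
have k10 : k1 != 0 by rewrite mulf_neq0 ?invr_neq0 ?Ht.
have k20 : k2 != 0 by rewrite mulf_neq0 ?invr_neq0 // Ht // eq_sym.
have tz : t z = k1 *: t x + k2 *: t y.
  have := plucker (t x) (t y) (t z) => /(congr1 ( *:%R (br (t x) (t y))^-1)).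
  by rewrite scalerA mulVf // scale1r scalerDr !scalerA ![_^-1 * _]mulrC.
have ab : a != b.
  apply: contra_neq pz => ab; apply: (pairwise_distinct_eq Ht).
  apply: proj_eq_trans (proj_eq_sym (Hh z)) _.
  suff -> : h *m t z = a *: t z by apply: proj_eq_scale.
  by rewrite tz mulmxDr -!scalemxAr hx hy -ab scalerDr !scalerA ![a * _]mulrC.
have ef : br (k1 *: t x) (k2 *: t y) != 0 by rewrite br_scale (mulf_neq0 (mulf_neq0 k10 k20) txy).
have he : h *m (k1 *: t x) = a *: (k1 *: t x) by rewrite -scalemxAr hx !scalerA mulrC.
have hf : h *m (k2 *: t y) = b *: (k2 *: t y) by rewrite -scalemxAr hy !scalerA mulrC.
have h3 : iter 3 (mulmx h) (k1 *: t x + k2 *: t y) === k1 *: t x + k2 *: t y.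
  rewrite -tz; apply: proj_eq_trans (iter_projective Hh 3 z) _.
  by have := expg_order p; rewrite p3 => ->; rewrite perm1; apply: proj_eq_refl.
have [Hx Hy Hz] := @diag_cycle_stable h _ _ a b 3 isT ef he hf a0 b0 ab h3.
set g := invmx _ in Hx Hy Hz; rewrite -tz in Hz.
have gU : g \in unitmx by rewrite unitmx_inv mx2_unit.
exists g => // sigma i.
have fixed (k : K) u : k != 0 -> map_mx sigma (g *m (k *: u)) === g *m (k *: u) ->
    map_mx sigma (g *m u) === g *m u.
  move=> k0 H; have gk : g *m (k *: u) === g *m u by apply/proj_eq_mul/proj_eq_scale.
  exact: proj_eq_trans (proj_eq_map _ (proj_eq_sym gk)) (proj_eq_trans H gk).
have orb := rigid_orbit gU Hh Hz sigma.
have : i \in [:: x; y; z; p z; p (p z)] by rewrite sT mem_enum.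
rewrite !inE => /or4P[/eqP->|/eqP->|/eqP->|/orP[]/eqP->].
- by exists x; apply: (fixed k1).
- by exists y; apply: (fixed k2).
- by have := orb 0%N; rewrite expg0 perm1.
- by have := orb 1%N; rewrite expg1.
- by have := orb 2%N; rewrite expgS expg1 permM.
Qed.

End RigidFivePoints.

(** * Covariants of five points without symmetries *)

Section Covariants.
Variable K : fieldType.
Implicit Types (s t : 'I_5 -> 'cV[K]_2) (p q : 'S_5) (sigma : {rmorphism K -> K}).

Definition lam2 t p := lam t (tperm q3 q4 * p)%g.

Definition cov_term t p :=
  (br (t (p q1)) (t (p q2)) * br (t (p q3)) (t (p q4))) *: t (p q0).

(* The sum runs over all labellings and cov_term has degree 1 in each point, so up
   to a scalar cov t m n depends only on the set of points. *)
Definition cov t m n := \sum_p (lam t p ^+ m * lam2 t p ^+ n) *: cov_term t p.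

Lemma cov_perm t q m n : cov (fun i => t (q i)) m n = cov t m n.
Proof.
rewrite [RHS](reindex_inj (mulIg q)); apply: eq_bigr => p _.
by rewrite /lam2 !lam_perm /cov_term !permM mulgA.
Qed.

Lemma cov_map t sigma m n :
  cov (fun i => map_mx sigma (t i)) m n = map_mx sigma (cov t m n).
Proof.
rewrite [RHS]raddf_sum; apply: eq_bigr => p _ /=.
rewrite map_mxZ rmorphM !rmorphXn /lam2 -!lam_map; congr (_ *: _).
by rewrite /cov_term map_mxZ rmorphM -!br_map.
Qed.

Lemma cov_mul s t h (c : 'I_5 -> K) m n : h \in unitmx ->
  (forall i, c i != 0) -> (forall i, s i = c i *: (h *m t i)) ->
  cov s m n = (\prod_i c i * \det h ^+ 2) *: (h *m cov t m n).
Proof.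
move=> hU c0 st; rewrite mulmx_sumr scaler_sumr; apply: eq_bigr => p _.
have lamE q : lam s q = lam t q.
  by apply: (lam_mul _ hU) => i; rewrite st; apply: proj_eq_scale.
rewrite /lam2 !lamE -scalemxAr [RHS]scalerA [X in _ = X *: _]mulrC -[RHS]scalerA.
congr (_ *: _).
rewrite /cov_term -scalemxAr !st !br_scale !br_mul !scalerA; congr (_ *: _).
rewrite (reindex_inj (@perm_inj _ p)) /= !big_ord_recl big_ord0.
have -> : c (p ord0) = c (p q0) by congr (c (p _)); apply: val_inj.
set i1 := lift _ _; have -> : i1 = q1 by apply: val_inj.
set i2 := lift _ _; have -> : i2 = q2 by apply: val_inj.
set i3 := lift _ _; have -> : i3 = q3 by apply: val_inj.
set i4 := lift _ _; have -> : i4 = q4 by apply: val_inj.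
ring.
Qed.

Lemma br_sumr (w : 'cV[K]_2) (c : 'S_5 -> K) (x : 'S_5 -> 'cV[K]_2) :
  br w (\sum_p c p *: x p) = \sum_p c p * br w (x p).
Proof.
rewrite /br !summxE !mulr_sumr -sumrB; apply: eq_bigr => p _; rewrite !mxE; ring.
Qed.

(* When no nontrivial permutation of the points is projective, the pairs
   (lam, lam2) are pairwise distinct, so that interpolation recovers every
   cov_term from the covariants. *)
Lemma cov_independent t : pairwise_distinct t ->
  (forall p, p \in lam_stab t -> p = 1%g) ->
  exists m n m' n', br (cov t m n) (cov t m' n') != 0.
Proof.
move=> Ht triv; apply: contrapT => H.
have br0 m n m' n' : br (cov t m n) (cov t m' n') = 0.
  by apply/eqP; apply: contraT => H1; case: H; exists m, n, m', n'.
(* If all covariants are parallel, they lie on the line of one vector [w]; when all of them vanish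
   any nonzero vector serves. *)
have [w w0 Hw] : exists2 w : 'cV[K]_2, w != 0 & forall m n, br w (cov t m n) = 0.
  have [H0|] := pselect (exists m n, cov t m n != 0).
    by case: H0 => m [n H0]; exists (cov t m n).
  move=> H0; exists (t q0); first by have [] := br_neq0 (Ht q0 q1 isT).
  move=> m n; rewrite (_ : cov t m n = 0) /br ?mxE ?mulr0 ?subrr //.
  by apply/eqP; apply: contraT => H1; case: H0; exists m, n.
(* The weights [f] in [kills] contain 1 and are closed under multiplication by [lam - c] and
   [lam2 - c]. Products of such factors isolate one permutation, so every single term has zero
   bracket with [w], which makes all five points equal to [w]. *)
pose kills (f : 'S_5 -> K) := forall m n,
  \sum_p (f p * (lam t p ^+ m * lam2 t p ^+ n)) * br w (cov_term t p) = 0.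
have kills1 : kills (fun=> 1).
  move=> m n; rewrite -[RHS](Hw m n) /cov br_sumr; apply: eq_bigr => p _.
  by rewrite mul1r.
have killsM f c : kills f -> kills (fun p => f p * (lam t p - c)).
  move=> Hf m n; transitivity
    ((\sum_p (f p * (lam t p ^+ m.+1 * lam2 t p ^+ n)) * br w (cov_term t p)) -
     c * (\sum_p (f p * (lam t p ^+ m * lam2 t p ^+ n)) * br w (cov_term t p))).
    by rewrite mulr_sumr -sumrB; apply: eq_bigr => p _; rewrite exprS; ring.
  by rewrite !Hf mulr0 subrr.
have killsM2 f c : kills f -> kills (fun p => f p * (lam2 t p - c)).
  move=> Hf m n; transitivity
    ((\sum_p (f p * (lam t p ^+ m * lam2 t p ^+ n.+1)) * br w (cov_term t p)) -
     c * (\sum_p (f p * (lam t p ^+ m * lam2 t p ^+ n)) * br w (cov_term t p))).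
    by rewrite mulr_sumr -sumrB; apply: eq_bigr => p _; rewrite exprS; ring.
  by rewrite !Hf mulr0 subrr.
have sep p q : lam t p = lam t q -> lam2 t p = lam2 t q -> p = q.
  move=> E1 E2.
  have [||||h hU Hh] := @lam_projective _ (fun i => t (p i)) (fun i => t (q i)).
  - exact: pairwise_distinct_inj (@perm_inj _ p) Ht.
  - exact: pairwise_distinct_inj (@perm_inj _ q) Ht.
  - by rewrite !lam_perm !mul1g.
  - by rewrite !lam_perm.
  have : (q^-1 * p)%g \in lam_stab t.
    apply/lam_stabP => r; rewrite -lam_perm -[RHS](lam_mul (s := fun i => t (p (q^-1 i))%g) _ hU).
      by rewrite /lam !permM.
    by move=> i; have := Hh (q^-1 i)%g; rewrite permKV.
  by move/triv/(congr1 (mulg q)); rewrite mulKVg mulg1.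
have isolate p0 (s : seq 'S_5) : p0 \notin s -> exists2 f, kills f &
    f p0 != 0 /\ forall p, p \in s -> f p = 0.
  elim: s => [_|p s IHs].
    by exists (fun=> 1); rewrite ?oner_neq0.
  rewrite inE negb_or => /andP[p0p /IHs[f Hf [fp0 fs]]].
  have [E1|N1] := eqVneq (lam t p0) (lam t p); last first.
    exists (fun q => f q * (lam t q - lam t p)); first exact: killsM.
    split=> [|q]; first by rewrite mulf_neq0 // subr_eq0.
    by rewrite inE => /predU1P[->|/fs->]; rewrite ?subrr ?mulr0 ?mul0r.
  have N2 : lam2 t p0 != lam2 t p by apply: contraNneq p0p => /(sep _ _ E1)->.
  exists (fun q => f q * (lam2 t q - lam2 t p)); first exact: killsM2.
  split=> [|q]; first by rewrite mulf_neq0 // subr_eq0.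
  by rewrite inE => /predU1P[->|/fs->]; rewrite ?subrr ?mulr0 ?mul0r.
have term0 p : br w (t (p q0)) = 0.
  have [|f Hf [fp fq]] := @isolate p (rem p (enum {perm 'I_5})).
    by rewrite mem_rem_uniq ?enum_uniq // !inE eqxx.
  have := Hf 0%N 0%N; rewrite (bigD1 p) //= big1 ?addr0 => [|q qp]; last first.
    by rewrite fq ?mul0r // mem_rem_uniq ?enum_uniq // !inE qp mem_enum.
  rewrite !mulr1 /cov_term => /eqP; rewrite mulf_eq0 (negPf fp) /= => /eqP.
  rewrite -[w in br w _]scale1r br_scale mul1r => /eqP.
  rewrite !mulf_eq0 (negPf (Ht _ _ _)) ?(inj_eq perm_inj) //=.
  by rewrite (negPf (Ht _ _ _)) ?(inj_eq perm_inj) //= => /eqP.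
have tw i : t i != 0 -> br w (t i) = 0 -> t i === w.
  by move=> ti0 /(proj_eq_br w0 ti0)/proj_eq_sym.
have [t0 t1] := br_neq0 (Ht q0 q1 isT).
have E0 : t q0 === w by apply: tw => //; have := term0 1%g; rewrite perm1.
have E1 : t q1 === w by apply: tw => //; have := term0 (tperm q0 q1); rewrite tpermL.
by have := Ht q0 q1 isT; rewrite (br_proj_eq (proj_eq_trans E0 (proj_eq_sym E1))) eqxx.
Qed.

(** Two independent covariants form a frame [B]. All covariants are multiplied by the same scalar
    [C], so [sigma] carries [B] to [C *: (invmx h *m B)], and the unknown [h] cancels from the
    coordinates of the points relative to [B]. *)
Lemma trivial_stab_lam_good t : pairwise_distinct t ->
  (forall p, p \in lam_stab t -> p = 1%g) -> lam_good t.
Proof.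
move=> Ht triv; have [m [n [m' [n' B0]]]] := cov_independent Ht triv.
pose B := mx2 (cov t m n) (cov t m' n').
have BU : B \in unitmx by rewrite mx2_unit.
exists (invmx B); first by rewrite unitmx_inv.
move=> sigma [q Hq]; have [h hU Hh] := lam_moduli_projective Ht Hq.
have /choice[c Hc] : forall i, exists c, c != 0 /\
    map_mx sigma (t i) = c *: (invmx h *m t (q i)).
  move=> i; have [c c0 E] := Hh i; exists c; split=> //.
  by rewrite scalemxAr -E mulKmx.
pose C := \prod_i c i * \det (invmx h) ^+ 2.
have C0 : C != 0.
  rewrite mulf_neq0 ?expf_neq0 //; last by rewrite -unitfE -unitmxE unitmx_inv.
  by apply/prodf_neq0 => i _; case: (Hc i).
have covE k l : map_mx sigma (cov t k l) = C *: (invmx h *m cov t k l).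
  rewrite -cov_map -[cov t k l in RHS](cov_perm _ q).
  by apply: cov_mul; rewrite ?unitmx_inv // => i; case: (Hc i).
have BE : map_mx sigma B = C *: (invmx h *m B).
  apply/matrixP => i j; rewrite !mxE (fun_if sigma).
  have E k l : sigma (cov t k l i 0) = C * (invmx h *m cov t k l) i 0.
    by have /matrixP/(_ i 0) := covE k l; rewrite !mxE.
  case: ifP => j0; rewrite E [in LHS]mxE; congr (_ * _); apply: eq_bigr => l _;
  by rewrite mxE j0.
move=> i; exists (q i).
have sBU : map_mx sigma B \in unitmx by rewrite map_unitmx.
rewrite map_mxM map_invmx; apply: (proj_eq_mul_inj sBU); rewrite mulKVmx //.
have [c0 ->] := Hc i; exists (c i / C); first by rewrite mulf_neq0 ?invr_neq0.
by rewrite BE -scalemxAl scalerA divfK // -!mulmxA mulKVmx.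
Qed.

End Covariants.

(** * Descent for at most five points of the projective line *)

Lemma perm_pairwise (T : eqType) (r : rel T) (s t : seq T) :
  ssrbool.symmetric r -> perm_eq s t -> pairwise r s -> pairwise r t.
Proof.
move=> symr; apply: (catCA_perm_ind (P := pairwise r)) => s1 s2 s3.
have -> : pairwise r (s2 ++ s1 ++ s3) = pairwise r (s1 ++ s2 ++ s3).
  rewrite !pairwise_cat !allrel_catr.
  have -> : allrel r s2 s1 = allrel r s1 s2.
    by rewrite allrelC; apply: eq_allrel => x y; rewrite symr.
  by case: (allrel r s1 s2) (allrel r s1 s3) (allrel r s2 s3) (pairwise r s1)
    (pairwise r s2) => [] [] [] [] [].
by [].
Qed.

Lemma pairwise_of_mem (T : eqType) (r : rel T) (s : seq T) : uniq s ->
  (forall x y, x \in s -> y \in s -> x != y -> r x y) -> pairwise r s.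
Proof.
elim: s => // x s IHs /= /andP[xs Us] Hr; apply/andP; split.
  apply/allP => y ys; apply: Hr; rewrite ?inE ?eqxx ?ys ?orbT //.
  by apply: contraNneq xs => ->.
by apply: IHs => // y z ys zs; apply: Hr; rewrite inE ?ys ?zs orbT.
Qed.

Section ProjectiveLineDescent.
Variable K : fieldType.
Hypothesis sep_closed : forall q : {poly K},
  separable_poly q -> (1 < size q)%N -> exists x, root q x.
Hypothesis char2 : 2%N \notin [pchar K].
Implicit Types (sigma : {rmorphism K -> K}).

Lemma lam_stab_conj (t : 'I_5 -> 'cV[K]_2) sigma p q :
  (forall r, sigma (lam t r) = lam t (r * q)%g) -> p \in lam_stab t ->
  (q^-1 * p * q)%g \in lam_stab t.
Proof.
move=> Hq /lam_stabP pA; apply/lam_stabP => r.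
by rewrite !mulgA -Hq pA Hq mulgKV.
Qed.

(** A 2-group acting on five points has an odd number of fixed points. A nontrivial symmetry has at
    most two, hence exactly one, so [i0] is the only fixed point of [p]. If [sigma] acts through
    [q], the conjugate of [p] by [q] fixes both [i0] and [q i0], which forces [q i0 = i0]. With this
    point at infinity four points remain, and 4 is invertible. *)
Lemma fixed_point_lam_good (t : 'I_5 -> 'cV[K]_2) p :
  pairwise_distinct t -> (2.-group (lam_stab t))%g -> p \in lam_stab t ->
  p != 1%g -> lam_good t.
Proof.
move=> Ht A2 pA p1.
have two_fix q i j : q \in lam_stab t -> q i = i -> q j = j -> i != j -> q = 1%g.
  move=> qA qi qj ij.
  have q2 : (2.-group <[q]>)%g by apply: pgroupS A2; rewrite gen_subG sub1set.
  have := card_fix_mod q2; set F := ('Fix_('P)(<[q]>))%g => cF.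
  have iF : i \in F by rewrite mem_fix_cycle qi.
  have jF : j \in F by rewrite mem_fix_cycle qj.
  have : [exists k, (k \in F) && (k \notin [set i; j])].
    apply: contraTT (isT : odd 5) => /existsPn H; rewrite -[odd 5]/(odd (5 %% 2)) -cF.
    suff -> : F = [set i; j] by rewrite cards2 ij.
    apply/eqP; rewrite eqEsubset; apply/andP; split; apply/subsetP => k.
      by move=> kF; have := H k; rewrite kF negbK.
    by case/set2P=> ->.
  case/existsP => k /andP[kF]; rewrite !inE negb_or => /andP[ki kj].
  apply: (lam_stab_fix3 (i := i) (j := j) (k := k) Ht qA) => //.
    by rewrite /= !inE negb_or ij ![_ == k]eq_sym ki kj.
  by apply/eqP; rewrite -mem_fix_cycle.
have [i0 i0fix] : exists i0, forall q, q \in lam_stab t -> q i0 = i0.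
  have := card_fix_mod A2; set F := ('Fix_('P)(_))%g => cF.
  have : (0 < #|F|)%N by move: cF; case: #|F|.
  case/card_gt0P => i0 i0F; exists i0 => q qA; by move/afixP/(_ q qA): i0F.
pose x := [seq t j | j <- enum (predC1 i0)].
have mem_x v : v \in x -> exists2 j, j != i0 & v = t j.
  by case/mapP => j; rewrite mem_enum inE => ji ->; exists j.
have szx : size x = 4.
  by rewrite size_map -cardE cardC1 card_ord.
have x_distinct : pairwise (fun u v => br u v != 0) x.
  rewrite pairwise_map; have := enum_uniq (predC1 i0); rewrite uniq_pairwise.
  by apply: sub_pairwise => i j; apply: Ht.
have [|||g [gU gi0 Hg]] := marked_line_good sep_closed (r := t i0) _ x_distinct.
- by move=> v /mem_x[j ji ->]; rewrite Ht // eq_sym.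
- by rewrite szx.
- left; rewrite szx (_ : 4%:R = 2%:R * 2%:R :> K); last by rewrite -natrM.
  exact: mulf_neq0 (natr2_neq0 char2) (natr2_neq0 char2).
exists g => // sigma [q Hq] i.
have qi0 : q i0 = i0.
  have pqA := lam_stab_conj Hq pA.
  apply/eqP; apply: contraR p1 => qi0.
  have : (q^-1 * p * q)%g = 1%g.
    apply: (two_fix _ (q i0) i0) => //; last exact: i0fix.
    by rewrite !permM permK i0fix.
  by move/(congr1 (fun r => q * r * q^-1)%g); rewrite !mulgA mulgV mul1g mulgK mulg1 mulgV => ->.
have [h hU Hh] := lam_moduli_projective Ht Hq.
have [->|ii0] := eqVneq i i0.
  exists i0; rewrite gi0 (_ : map_mx _ _ = cv2 1 0); first exact: proj_eq_refl.
  by apply: eq_cv2; rewrite !mxE /= ?rmorph1 ?rmorph0.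
have [||_ /mapP[v /mem_x[j _ ->] ->] E] := Hg sigma _ (map_mx sigma (g *m t i)).
- exists h; split=> //; first by rewrite -{2}qi0.
  move=> _ /mapP[_ /mapP[_ /mem_x[j ji ->] ->] ->]; exists (t (q j)); last exact: Hh.
  apply: map_f; by rewrite mem_enum inE -[X in _ != X]qi0 (inj_eq perm_inj).
- by apply: map_f; apply: map_f; apply: map_f; rewrite mem_enum.
by exists j.
Qed.

Lemma five_points_lam_good (t : 'I_5 -> 'cV[K]_2) : pairwise_distinct t -> lam_good t.
Proof.
move=> Ht.
have [d3|n3] := boolP (3 %| #|lam_stab t|)%N.
  have [p pA p3] := Cauchy (G := lam_stab_group t) (isT : prime 3) d3.
  exact/rigid_lam_good/(rigid_order3 Ht pA p3).
have [d5|n5] := boolP (5 %| #|lam_stab t|)%N.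
  have [p pA p5] := Cauchy (G := lam_stab_group t) (isT : prime 5) d5.
  exact/rigid_lam_good/(rigid_order5 sep_closed char2 Ht pA p5).
(* The order divides 120 and is prime to 3 and 5. *)
have A2 : (2.-group (lam_stab t))%g.
  apply/pnatP; first exact: (cardG_gt0 (lam_stab_group t)).
  move=> p p_pr pA; have : (p %| 2 * 2 * 2 * 3 * 5)%N.
    apply: dvdn_trans pA _; have := cardSg (subsetT (lam_stab_group t)).
    by rewrite cardsT card_Sn.
  rewrite !Euclid_dvdM // !dvdn_prime2 // !inE => /orP[/orP[/orP[/orP[]|]|]|]//.
    by move/eqP => E; rewrite E in pA; rewrite pA in n3.
  by move/eqP => E; rewrite E in pA; rewrite pA in n5.
have [triv|] := pselect (forall p, p \in lam_stab t -> p = 1%g).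
  exact: trivial_stab_lam_good.
move=> nt; have [p pA p1] : exists2 p, p \in lam_stab t & p != 1%g.
  apply: contrapT => H; apply: nt => p pA; apply/eqP; apply: contraT => p1.
  by case: H; exists p.
exact: fixed_point_lam_good p1.
Qed.

(** Take [k] sending [u], [v], [w] to [v], [u], [z]. The cross ratio is invariant under the double
    transposition, so [k] must send [z] to [w]. *)
Lemma klein_four (u v w z : 'cV[K]_2) :
  pairwise (fun u v => br u v != 0) [:: u; v; w; z] ->
  exists k, [/\ k \in unitmx, k *m u === v, k *m v === u, k *m w === z & k *m z === w].
Proof.
rewrite /= !andbT => /andP[/and3P[uv uw uz] /andP[/andP[vw vz] wz]].
have anti (a b : 'cV[K]_2) : br a b != 0 -> br b a != 0.
  by rewrite br_anti oppr_eq0.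
pose f (a b c : 'cV[K]_2) (i : 'I_3) := if i == 0%N :> nat then a else if i == 1%N :> nat then b else c.
have Hf a b c : br a b != 0 -> br a c != 0 -> br b c != 0 -> pairwise_distinct (f a b c).
  by move=> ab ac bc [[|[|[|//]]] ?] [[|[|[|//]]] ?] //= _; rewrite /f /=; try apply: anti.
have [k kU Hk] := three_transitive (Hf v u z (anti _ _ uv) vz uz) (Hf u v w uv uw vw).
have ku : k *m u === v := proj_eq_sym (Hk (@Ordinal 3 0 isT)).
have kv : k *m v === u := proj_eq_sym (Hk (@Ordinal 3 1 isT)).
have kw : k *m w === z := proj_eq_sym (Hk (@Ordinal 3 2 isT)).
exists k; split=> //; apply: (@cr_inj _ v u z) => //; try exact: anti.
  apply: br_neq0_proj_eq (proj_eq_sym ku) (proj_eq_refl _) _.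
  by rewrite br_mul mulf_neq0 // -unitfE -unitmxE.
transitivity (cr u v w z).
  rewrite -(cr_mul u v w z kU); apply: cr_proj_eq; try exact: proj_eq_sym.
  exact: proj_eq_refl.
by rewrite /cr; congr (_ / _); rewrite mulrC.
Qed.

Lemma proj_eq_cv2_map sigma (x y : K) :
  sigma x = x -> sigma y = y -> map_mx sigma (cv2 x y) === cv2 x y.
Proof.
move=> sx sy; rewrite (_ : map_mx _ _ = cv2 x y); first exact: proj_eq_refl.
by apply: eq_cv2; rewrite !mxE /= ?sx ?sy.
Qed.

(** The group of double transpositions is transitive, so any twisted symmetry can be corrected by
    some [k] into one that fixes [r]. The coordinates adapted to the marked point [r] then work for
    all of them, since [k] only permutes the four points. *)
Lemma four_points_good (r a b c : 'cV[K]_2) :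
  pairwise (fun u v => br u v != 0) [:: r; a; b; c] -> good [:: r; a; b; c].
Proof.
move=> dist; have [||||g [gU gr Hg]] :=
  marked_line_good sep_closed (r := r) (t := [:: a; b; c]).
- by case/andP: dist => /allP.
- by case/andP: dist.
- by [].
- by right.
exists g => // sigma [h hU Hh].
have [k [kU kL kr]] : exists k, [/\ k \in unitmx,
    pincl (mximg k [:: r; a; b; c]) [:: r; a; b; c] & k *m (h *m map_mx sigma r) === r].
  have [x xL hr] : exists2 x, x \in [:: r; a; b; c] & h *m map_mx sigma r === x.
    by apply: Hh; rewrite !map_f ?mem_head.
  suff [k [kU kL kx]] : exists k, [/\ k \in unitmx,
      pincl (mximg k [:: r; a; b; c]) [:: r; a; b; c] & k *m x === r].
    by exists k; split=> //; apply: proj_eq_trans (proj_eq_mul _ hr) kx.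
  have sub4 k : (forall u, u \in [:: r; a; b; c] ->
      exists2 v, v \in [:: r; a; b; c] & k *m u === v) ->
      pincl (mximg k [:: r; a; b; c]) [:: r; a; b; c].
    by move=> H _ /mapP[u /H[v vL E] ->]; exists v.
  have dist' u v w z : perm_eq [:: u; v; w; z] [:: r; a; b; c] ->
      pairwise (fun u v => br u v != 0) [:: u; v; w; z].
    rewrite perm_sym => P; apply: perm_pairwise P dist => x1 x2.
    by rewrite br_anti oppr_eq0.
  have swap u v w z : perm_eq [:: u; v; w; z] [:: r; a; b; c] -> exists k,
      [/\ k \in unitmx, pincl (mximg k [:: r; a; b; c]) [:: r; a; b; c] & k *m v === u].
    move=> P; have [k [kU ku kv kw kz]] := klein_four (dist' _ _ _ _ P).
    exists k; split=> //; apply: sub4 => y; rewrite -(perm_mem P) !inE.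
    by case/or4P => /eqP->; [exists v | exists u | exists z | exists w];
      rewrite // -(perm_mem P) !inE eqxx ?orbT.
  move: xL; rewrite !inE => /or4P[]/eqP->.
  - exists 1%:M; split; rewrite ?unitmx1 ?mximg1 ?mul1mx //; first exact: pincl_refl.
    exact: proj_eq_refl.
  - exact: (swap r a b c).
  - apply: (swap r b a c); apply/seq.permP => p /=; lia.
  - apply: (swap r c a b); apply/seq.permP => p /=; lia.
have Hr : r != 0 /\ forall v, v \in [:: a; b; c] -> br r v != 0.
  case/andP: dist => /allP Hr _; split=> //.
  by have /br_neq0[] := Hr a (mem_head _ _).
have khU : k *m h \in unitmx by rewrite unitmx_mul kU.
(* None of the other three points can be sent to [r], because [r] already is. *)
have stab : pincl (mximg (k *m h) (conjs sigma [:: a; b; c])) [:: a; b; c].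
  move=> _ /mapP[_ /mapP[v vt ->] ->].
  have [x xL hx] : exists2 x, x \in [:: r; a; b; c] & k *m h *m map_mx sigma v === x.
    have := pincl_trans (pincl_mximg k Hh) kL; rewrite -mximgM; apply.
    by apply/map_f/map_f; rewrite inE vt orbT.
  exists x => //; move: xL; rewrite inE => /predU1P[xr|//].
  have : map_mx sigma v === map_mx sigma r.
    apply: (proj_eq_mul_inj khU); rewrite xr in hx; apply: proj_eq_trans hx _.
    by apply: proj_eq_sym; rewrite -mulmxA.
  case: Hr => r0 Hr; have := Hr v vt.
  move=> rv /proj_eq_map_inj vr; have [_ v0] := br_neq0 rv.
  by move: rv; rewrite br_anti (br_proj_eq (vr v0 r0)) oppr0 eqxx.
move=> _ /mapP[_ /mapP[v vL ->] ->]; move: vL; rewrite inE => /predU1P[->|vt].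
  exists (g *m r); first by apply: map_f; rewrite mem_head.
  by rewrite gr; apply: proj_eq_cv2_map; rewrite ?rmorph1 ?rmorph0.
have [||_ /mapP[w wt ->] E] := Hg sigma _ (map_mx sigma (g *m v)).
- by exists (k *m h); split=> //; rewrite -mulmxA.
- by apply/map_f/map_f.
by exists (g *m w) => //; apply: map_f; rewrite inE wt orbT.
Qed.

Lemma pairwise_nth_distinct (s : seq 'cV[K]_2) : size s = 5 ->
  pairwise (fun u v => br u v != 0) s -> pairwise_distinct (fun i : 'I_5 => nth 0 s i).
Proof.
move=> s5 /(pairwiseP 0) dist i j ij.
have := ij; rewrite -val_eqE neq_ltn => /orP[] lt_ij.
  by apply: dist; rewrite ?inE ?s5 //=.
by rewrite br_anti oppr_eq0; apply: dist; rewrite ?inE ?s5 //=.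
Qed.

Lemma five_points_good (s : seq 'cV[K]_2) : size s = 5 ->
  pairwise (fun u v => br u v != 0) s -> good s.
Proof.
move=> s5 dist; pose t (i : 'I_5) := nth 0 s i.
have Ht : pairwise_distinct t := pairwise_nth_distinct s5 dist.
have mem_t i : t i \in s by rewrite mem_nth ?s5.
have sP u : u \in s -> exists i, u = t i.
  by case/(nthP 0) => i; rewrite s5 => lti <-; exists (Ordinal lti).
have [g gU Hg] := five_points_lam_good Ht; exists g => // sigma [h hU Hh].
have /choice[f Hf] : forall i, exists j, h *m map_mx sigma (t i) === t j.
  move=> i; have [_ /sP[j ->] E] : exists2 v, v \in s & h *m map_mx sigma (t i) === v.
    by apply: Hh; apply/map_f/map_f.
  by exists j.
have t0 i : t i != 0.
  have [j ij] : exists j : 'I_5, i != j.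
    by case: (eqVneq i ord0) => [->|?]; [exists (@Ordinal 5 1 isT) | exists ord0].
  by have [] := br_neq0 (Ht i j ij).
have injf : injective f.
  move=> i j fij; apply: (pairwise_distinct_eq Ht).
  apply: (proj_eq_map_inj (t0 i) (t0 j)) (_ : map_mx sigma _ === _).
  apply: (proj_eq_mul_inj hU); apply: proj_eq_trans (Hf i) _.
  by rewrite fij; apply: proj_eq_sym.
have mod_s : lam_moduli t sigma.
  exists (perm injf) => p; rewrite -lam_map -lam_perm.
  rewrite -(lam_mul (s := fun i => h *m map_mx sigma (t i)) p hU) => [|i].
    by apply: cr_proj_eq; rewrite permE; apply: Hf.
  exact: proj_eq_refl.
move=> _ /mapP[_ /mapP[_ /sP[i ->] ->] ->]; have [j E] := Hg sigma mod_s i.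
by exists (g *m t j) => //; apply: map_f.
Qed.

Lemma line_good (s : seq 'cV[K]_2) : (forall v, v \in s -> v != 0) ->
  pairwise (fun u v => br u v != 0) s -> (size s <= 5)%N -> good s.
Proof.
move=> s0 dist; case: s s0 dist => [|u [|v [|w [|z [|x [|]]]]]] // s0 dist _.
- by apply: rigid_good => sigma v.
- have [w uw] : exists w, br u w != 0.
    apply: contrapT => H; have /negP[] := s0 u (mem_head _ _); apply/eqP/eq_cv2.
      by apply/eqP; rewrite mxE; apply: contraT => u0; case: H; exists (cv2 0 1);
         rewrite /br !cv2E mulr1 mulr0 subr0.
    by apply/eqP; rewrite mxE; apply: contraT => u0; case: H; exists (cv2 1 0);
       rewrite /br !cv2E mulr1 mulr0 sub0r oppr_eq0.
  have uE : mximg (mx2 u w) [:: cv2 1 0] = [:: u].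
    by rewrite /mximg /= mul_mx2 !cv2E scale1r scale0r addr0.
  apply: (@good_equiv _ _ (mx2 u w) [:: cv2 1 0]); rewrite ?mx2_unit ?uE //; try exact: pincl_refl.
  apply: rigid_good => sigma y /mapP[v]; rewrite inE => /eqP-> ->.
  exists (cv2 1 0); first exact: mem_head.
  by apply: proj_eq_cv2_map; rewrite ?rmorph1 ?rmorph0.
- have uv : br u v != 0 by case/andP: dist => /andP[].
  have uE : mximg (mx2 u v) [:: cv2 1 0; cv2 0 1] = [:: u; v].
    by rewrite /mximg /= !mul_mx2 !cv2E !scale1r !scale0r addr0 add0r.
  apply: (@good_equiv _ _ (mx2 u v) [:: cv2 1 0; cv2 0 1]); rewrite ?mx2_unit ?uE //; try exact: pincl_refl.
  apply: rigid_good => sigma _ /mapP[y yL ->]; exists y => //.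
  by move: yL; rewrite !inE => /orP[]/eqP->; apply: proj_eq_cv2_map; rewrite ?rmorph1 ?rmorph0.
- have [uv uw vw] : [/\ br u v != 0, br u w != 0 & br v w != 0].
    by move: dist; rewrite /= !andbT => /andP[/andP[]].
  have wv : br w v != 0 by rewrite br_anti oppr_eq0.
  pose P := mx2 (br w v *: u) (br u w *: v).
  have PU : P \in unitmx by rewrite mx2_unit br_scale !mulf_neq0.
  have uE : mximg P [:: cv2 1 0; cv2 0 1; cv2 1 1] =
      [:: br w v *: u; br u w *: v; br u v *: w].
    rewrite /mximg /= !mul_mx2 !cv2E !scale1r !scale0r addr0 add0r.
    by rewrite -plucker.
  apply: (good_equiv PU (s := [:: cv2 1 0; cv2 0 1; cv2 1 1])); rewrite ?uE.
  + move=> y; rewrite !inE => /or3P[]/eqP->.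
    * by exists (br w v *: u); rewrite ?inE ?eqxx //; apply/proj_eq_sym/proj_eq_scale.
    * by exists (br u w *: v); rewrite ?inE ?eqxx ?orbT //; apply/proj_eq_sym/proj_eq_scale.
    * by exists (br u v *: w); rewrite ?inE ?eqxx ?orbT //; apply/proj_eq_sym/proj_eq_scale.
  + move=> y; rewrite !inE => /or3P[]/eqP->.
    * by exists u; rewrite ?inE ?eqxx //; apply/proj_eq_scale.
    * by exists v; rewrite ?inE ?eqxx ?orbT //; apply/proj_eq_scale.
    * by exists w; rewrite ?inE ?eqxx ?orbT //; apply/proj_eq_scale.
  apply: rigid_good => sigma _ /mapP[y yL ->]; exists y => //.
  by move: yL; rewrite !inE => /or3P[]/eqP->; apply: proj_eq_cv2_map; rewrite ?rmorph1 ?rmorph0.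
- exact: four_points_good.
- exact: five_points_good.
Qed.

End ProjectiveLineDescent.

Local Notation x0 := (@Ordinal 3 0 isT).
Local Notation x1 := (@Ordinal 3 1 isT).
Local Notation x2 := (@Ordinal 3 2 isT).

(** * Finite subsets of the projective plane *)

Section PlaneAlgebra.
Variable K : fieldType.
Implicit Types (u v w : 'cV[K]_3) (g h : 'M[K]_3) (sigma : {rmorphism K -> K}).

Lemma proj_eq_minors m (u v : 'cV[K]_m) : u != 0 -> v != 0 ->
  (forall i j, u i 0 * v j 0 = u j 0 * v i 0) -> u === v.
Proof.
move=> u0 v0 uv.
have [i vi0] : exists i, v i 0 != 0.
  apply/existsP; apply: contraNT v0 => /existsPn v0.
  by apply/eqP/matrixP => i j; rewrite ord1 mxE; apply/eqP/negPn/v0.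
have uE : u = (u i 0 / v i 0) *: v.
  apply/matrixP => k j; rewrite ord1 mxE mulrAC uv mulfK //.
exists (u i 0 / v i 0) => //.
by apply: contraNneq u0 => c0; rewrite uE c0 scale0r.
Qed.

Definition cv3 (a b c : K) : 'cV[K]_3 :=
  \col_i (if i == x0 then a else if i == x1 then b else c).

Lemma cv3E0 a b c : cv3 a b c x0 0 = a. Proof. by rewrite mxE. Qed.
Lemma cv3E1 a b c : cv3 a b c x1 0 = b. Proof. by rewrite mxE. Qed.
Lemma cv3E2 a b c : cv3 a b c x2 0 = c. Proof. by rewrite mxE. Qed.
Definition cv3E := (cv3E0, cv3E1, cv3E2).

Lemma forall_I3 (P : 'I_3 -> Prop) : P x0 -> P x1 -> P x2 -> forall i, P i.
Proof.
by move=> P0 P1 P2 [[|[|[|//]]] lti]; rewrite (bool_irrelevance lti isT).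
Qed.

Lemma eq_cv3 u v : u x0 0 = v x0 0 -> u x1 0 = v x1 0 -> u x2 0 = v x2 0 -> u = v.
Proof.
by move=> E0 E1 E2; apply/matrixP => i j; rewrite ord1; move: i; apply: forall_I3.
Qed.

Lemma cv3_eta u : u = cv3 (u x0 0) (u x1 0) (u x2 0).
Proof. by apply: eq_cv3; rewrite cv3E. Qed.

Lemma cv3_map sigma a b c : map_mx sigma (cv3 a b c) = cv3 (sigma a) (sigma b) (sigma c).
Proof. by apply: eq_cv3; rewrite !mxE. Qed.

Lemma cv3_neq0 u i : u i 0 != 0 -> u != 0.
Proof. by apply: contraNneq => ->; rewrite mxE. Qed.

Lemma mul_mx3E g u i :
  (g *m u) i 0 = g i x0 * u x0 0 + g i x1 * u x1 0 + g i x2 * u x2 0.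
Proof.
rewrite mxE !big_ord_recl big_ord0 addr0 addrA.
by congr (g i _ * u _ _ + g i _ * u _ _ + g i _ * u _ _); apply: val_inj.
Qed.

Definition det3 u v w :=
  u x0 0 * (v x1 0 * w x2 0 - v x2 0 * w x1 0)
  - v x0 0 * (u x1 0 * w x2 0 - u x2 0 * w x1 0)
  + w x0 0 * (u x1 0 * v x2 0 - u x2 0 * v x1 0).

Definition mx3 u v w : 'M[K]_3 :=
  \matrix_(i, j) (if j == x0 then u i 0 else if j == x1 then v i 0 else w i 0).

Lemma mul_mx3 u v w x : mx3 u v w *m x = x x0 0 *: u + x x1 0 *: v + x x2 0 *: w.
Proof. by apply: eq_cv3; rewrite mul_mx3E !mxE /=; ring. Qed.

Lemma lin3E (a b c : K) u v w i :
  (a *: u + b *: v + c *: w) i 0 = a * u i 0 + b * v i 0 + c * w i 0.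
Proof. by rewrite !mxE. Qed.

Lemma mulmx_mx3 g u v w : g *m mx3 u v w = mx3 (g *m u) (g *m v) (g *m w).
Proof.
apply/matrixP => i j; rewrite !mxE; move: j; apply: forall_I3 => /=;
by apply: eq_bigr => k _; rewrite mxE.
Qed.

Lemma det_mx3E g : \det g =
  det3 (col x0 g) (col x1 g) (col x2 g).
Proof.
pose G (i j : nat) := g (inord i) (inord j).
have gE i j : g i j = G i j by rewrite /G !inord_val.
rewrite (expand_det_row _ x0) !big_ord_recl big_ord0 addr0 /cofactor !det_mx2E.
rewrite /det3 !mxE !gE /= /bump /= !expr0 !expr1 expr2.
ring.
Qed.

Lemma det_mx3 u v w : \det (mx3 u v w) = det3 u v w.
Proof. by rewrite det_mx3E; congr det3; apply/matrixP => i j; rewrite ord1 !mxE. Qed.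

Lemma mx3_unit u v w : (mx3 u v w \in unitmx) = (det3 u v w != 0).
Proof. by rewrite unitmxE unitfE det_mx3. Qed.

Lemma det3_mul g u v w : det3 (g *m u) (g *m v) (g *m w) = \det g * det3 u v w.
Proof. by rewrite -!det_mx3 -mulmx_mx3 det_mulmx. Qed.

Lemma det3_scale (a b c : K) u v w :
  det3 (a *: u) (b *: v) (c *: w) = a * b * c * det3 u v w.
Proof. rewrite /det3 !mxE; ring. Qed.

Lemma cramer u v w x :
  det3 u v w *: x = det3 x v w *: u + det3 u x w *: v + det3 u v x *: w.
Proof. apply: eq_cv3; rewrite !mxE /det3; ring. Qed.

Lemma det3_rot u v w : det3 v w u = det3 u v w.
Proof. rewrite /det3; ring. Qed.

Lemma det3_proj_eq_neq0 u v w u' v' w' : u === u' -> v === v' -> w === w' ->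
  (det3 u v w != 0) = (det3 u' v' w' != 0).
Proof.
by move=> [a a0 ->] [b b0 ->] [c c0 ->]; rewrite det3_scale !mulf_eq0 !negb_or a0 b0 c0.
Qed.

Definition e1 := cv3 1 0 0.
Definition e2 := cv3 0 1 0.
Definition e3 := cv3 0 0 1.

Lemma mul_mx3_e1 u v w : mx3 u v w *m e1 = u.
Proof. by rewrite mul_mx3 !cv3E scale1r !scale0r !addr0. Qed.
Lemma mul_mx3_e2 u v w : mx3 u v w *m e2 = v.
Proof. by rewrite mul_mx3 !cv3E scale1r !scale0r addr0 add0r. Qed.
Lemma mul_mx3_e3 u v w : mx3 u v w *m e3 = w.
Proof. by rewrite mul_mx3 !cv3E scale1r !scale0r !add0r. Qed.

Lemma det3_e : det3 e1 e2 e3 = 1.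
Proof. rewrite /det3 !cv3E; ring. Qed.

Lemma extend_basis2 u v : u != 0 -> v != 0 -> ~ u === v ->
  exists w, det3 u v w != 0.
Proof.
move=> u0 v0 uv; apply: contrapT => H; apply: uv; apply: proj_eq_minors => //.
have D w : det3 u v w = 0.
  by apply/eqP; apply: contraT => ?; case: H; exists w.
have M01 : u x0 0 * v x1 0 = u x1 0 * v x0 0.
  by apply/eqP; rewrite -subr_eq0 -(D e3) /det3 !cv3E; apply/eqP; ring.
have M02 : u x0 0 * v x2 0 = u x2 0 * v x0 0.
  by apply/eqP; rewrite -subr_eq0 -oppr_eq0 -(D e2) /det3 !cv3E; apply/eqP; ring.
have M12 : u x1 0 * v x2 0 = u x2 0 * v x1 0.
  by apply/eqP; rewrite -subr_eq0 -(D e1) /det3 !cv3E; apply/eqP; ring.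
by do 2!apply: forall_I3.
Qed.

Lemma extend_basis1 u : u != 0 -> exists v w, det3 u v w != 0.
Proof.
move=> u0; have [v [v0 uv]] : exists v, v != 0 /\ ~ u === v.
  apply: contrapT => H.
  have E v : v != 0 -> u === v.
    by move=> v0; apply: contrapT => uv; apply: H; exists v.
  have N1 : e1 != 0 by apply: (@cv3_neq0 _ x0); rewrite cv3E oner_neq0.
  have N2 : e2 != 0 by apply: (@cv3_neq0 _ x1); rewrite cv3E oner_neq0.
  have [c c0 /matrixP/(_ x0 0)] := proj_eq_trans (proj_eq_sym (E _ N1)) (E _ N2).
  by rewrite !mxE /= mulr0 => /eqP; rewrite oner_eq0.
have [w] := extend_basis2 u0 v0 uv; by exists v, w.
Qed.

Lemma det3_eq0_span u v w : u != 0 -> v != 0 -> ~ u === v -> det3 u v w = 0 ->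
  exists a b, w = a *: u + b *: v.
Proof.
move=> u0 v0 uv w0; have [x D] := extend_basis2 u0 v0 uv.
exists (det3 w v x / det3 u v x), (det3 u w x / det3 u v x).
have := cramer u v x w; rewrite w0 scale0r addr0.
move/(congr1 ( *:%R (det3 u v x)^-1)); rewrite scalerA mulVf // scale1r => E.
by rewrite [LHS]E scalerDr !scalerA ![_^-1 * _]mulrC.
Qed.

Definition emb (v : 'cV[K]_2) := cv3 (v 0 0) (v 1 0) 0.

Lemma embZ a (v : 'cV[K]_2) : emb (a *: v) = a *: emb v.
Proof. by apply: eq_cv3; rewrite !mxE /= ?mulr0. Qed.
Lemma emb_inj : injective emb.
Proof.
move=> u v E; have /matrixP H := E; apply: eq_cv2.
  by have := H x0 0; rewrite !cv3E.
by have := H x1 0; rewrite !cv3E.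
Qed.
Lemma emb_map sigma (v : 'cV[K]_2) : map_mx sigma (emb v) = emb (map_mx sigma v).
Proof. by apply: eq_cv3; rewrite !mxE /= ?rmorph0. Qed.
Lemma emb_proj_eq (v w : 'cV[K]_2) : emb v === emb w <-> v === w.
Proof.
split=> [[c c0]|[c c0 ->]]; last by exists c; rewrite ?embZ.
by rewrite -embZ => /emb_inj ->; exists c.
Qed.
Lemma det3_emb (u v : 'cV[K]_2) w : det3 (emb u) (emb v) w = br u v * w x2 0.
Proof. rewrite /det3 /br !cv3E; ring. Qed.

Definition blk (g : 'M[K]_2) := mx3 (emb (g *m cv2 1 0)) (emb (g *m cv2 0 1)) e3.

Lemma blk_emb (g : 'M[K]_2) (v : 'cV[K]_2) : blk g *m emb v = emb (g *m v).
Proof. by apply: eq_cv3; rewrite mul_mx3 lin3E !cv3E ?mul_mx2E ?cv2E; ring. Qed.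
Lemma blk_e3 (g : 'M[K]_2) : blk g *m e3 = e3.
Proof. exact: mul_mx3_e3. Qed.
Lemma blk_unit (g : 'M[K]_2) : (blk g \in unitmx) = (g \in unitmx).
Proof.
rewrite mx3_unit det3_emb cv3E mulr1 br_mul unitmxE unitfE.
by rewrite (_ : br _ _ = 1) ?mulr1 // /br !cv2E; ring.
Qed.

Definition ublk (h : 'M[K]_3) : 'M[K]_2 :=
  mx2 (cv2 (h x0 x0) (h x1 x0)) (cv2 (h x0 x1) (h x1 x1)).

Lemma plane_line_block h (u v : 'cV[K]_2) : br u v != 0 ->
  (h *m emb u) x2 0 = 0 -> (h *m emb v) x2 0 = 0 -> h x2 x0 = 0 /\ h x2 x1 = 0.
Proof.
rewrite !mul_mx3E !cv3E !mulr0 !addr0 => uv Eu Ev; split; apply: (mulIf uv).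
  rewrite mul0r /br; transitivity ((h x2 x0 * u 0 0 + h x2 x1 * u 1 0) * v 1 0 -
    (h x2 x0 * v 0 0 + h x2 x1 * v 1 0) * u 1 0); first by ring.
  by rewrite Eu Ev !mul0r subrr.
rewrite mul0r /br; transitivity ((h x2 x0 * v 0 0 + h x2 x1 * v 1 0) * u 0 0 -
    (h x2 x0 * u 0 0 + h x2 x1 * u 1 0) * v 0 0); first by ring.
by rewrite Eu Ev !mul0r subrr.
Qed.

Lemma ublk_emb h (v : 'cV[K]_2) : h x2 x0 = 0 -> h x2 x1 = 0 -> h *m emb v = emb (ublk h *m v).
Proof.
have lin2E (a b : K) (x y : 'cV[K]_2) i : (a *: x + b *: y) i 0 = a * x i 0 + b * y i 0.
  by rewrite !mxE.
by move=> h0 h1; apply: eq_cv3; rewrite mul_mx3E !cv3E ?mul_mx2 ?lin2E ?cv2E ?h0 ?h1; ring.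
Qed.

Lemma ublk_unit h : h \in unitmx -> h x2 x0 = 0 -> h x2 x1 = 0 ->
  ublk h \in unitmx /\ h x2 x2 != 0.
Proof.
move=> hU h0 h1; apply/andP; rewrite mx2_unit -negb_or -mulf_eq0.
move: hU; rewrite unitmxE unitfE det_mx3E; congr (_ != _).
rewrite /det3 /br !cv2E ![col _ _ _ _]mxE h0 h1; ring.
Qed.

Definition veronese (v : 'cV[K]_2) := cv3 (v 0 0 ^+ 2) (v 0 0 * v 1 0) (v 1 0 ^+ 2).

Lemma veronese_proj_eq (u v : 'cV[K]_2) : u === v -> veronese u === veronese v.
Proof.
case=> c c0 ->; exists (c ^+ 2); first exact: expf_neq0.
by apply: eq_cv3; rewrite !mxE /=; ring.
Qed.

Lemma det3_veronese (u v w : 'cV[K]_2) :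
  det3 (veronese u) (veronese v) (veronese w) = br u v * br v w * br u w.
Proof. rewrite /det3 /br !cv3E; ring. Qed.

Lemma veronese_map sigma (v : 'cV[K]_2) : map_mx sigma (veronese v) = veronese (map_mx sigma v).
Proof. by apply: eq_cv3; rewrite !mxE /= ?rmorphXn ?rmorphM. Qed.

(** The symmetric square of [g] in the monomials x^2, xy, y^2; it acts on the conic parametrized by
    [veronese]. *)
Definition sym2 (g : 'M[K]_2) := mx3
  (cv3 (g 0 0 ^+ 2) (g 0 0 * g 1 0) (g 1 0 ^+ 2))
  (cv3 (2%:R * g 0 0 * g 0 1) (g 0 0 * g 1 1 + g 0 1 * g 1 0) (2%:R * g 1 0 * g 1 1))
  (cv3 (g 0 1 ^+ 2) (g 0 1 * g 1 1) (g 1 1 ^+ 2)).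

Lemma sym2_veronese (g : 'M[K]_2) (v : 'cV[K]_2) : sym2 g *m veronese v = veronese (g *m v).
Proof. by apply: eq_cv3; rewrite mul_mx3 lin3E !cv3E ?mul_mx2E; ring. Qed.

Lemma sym2_unit (g : 'M[K]_2) : g \in unitmx -> sym2 g \in unitmx.
Proof.
rewrite !unitmxE !unitfE det_mx3 => g0.
have -> : det3 (cv3 (g 0 0 ^+ 2) (g 0 0 * g 1 0) (g 1 0 ^+ 2))
  (cv3 (2%:R * g 0 0 * g 0 1) (g 0 0 * g 1 1 + g 0 1 * g 1 0) (2%:R * g 1 0 * g 1 1))
  (cv3 (g 0 1 ^+ 2) (g 0 1 * g 1 1) (g 1 1 ^+ 2)) = \det g ^+ 3.
  by rewrite det_mx2E /det3 !cv3E; ring.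
exact: expf_neq0.
Qed.

(* The cross ratio of the lines joining m to u, v, w, z. *)
Definition cr3 u v w z m := det3 u w m * det3 v z m / (det3 u z m * det3 v w m).

Lemma cr3_mul h u v w z m : h \in unitmx ->
  cr3 (h *m u) (h *m v) (h *m w) (h *m z) (h *m m) = cr3 u v w z m.
Proof.
rewrite unitmxE unitfE => d0; rewrite /cr3 !det3_mul.
by rewrite mulrACA [X in _ / X]mulrACA -[LHS]mulf_div divff ?mul1r ?mulf_neq0.
Qed.

Lemma cr3_proj_eq u v w z m u' v' w' z' m' : u === u' -> v === v' -> w === w' ->
  z === z' -> m === m' -> cr3 u v w z m = cr3 u' v' w' z' m'.
Proof.
move=> [a a0 ->] [b b0 ->] [c c0 ->] [d d0 ->] [e e0 ->]; rewrite /cr3 !det3_scale.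
have -> : a * c * e * det3 u' w' m' * (b * d * e * det3 v' z' m') =
  (a * b * c * d * e * e) * (det3 u' w' m' * det3 v' z' m') by ring.
have -> : a * d * e * det3 u' z' m' * (b * c * e * det3 v' w' m') =
  (a * b * c * d * e * e) * (det3 u' z' m' * det3 v' w' m') by ring.
by rewrite -[LHS]mulf_div divff ?mul1r ?mulf_neq0.
Qed.

(** Chasles: each determinant of three points of the conic splits into brackets, and those
    containing [m] cancel. *)
Lemma cr3_veronese (u v w z m : 'cV[K]_2) : br u m != 0 -> br v m != 0 ->
  br w m != 0 -> br z m != 0 -> br u z != 0 -> br v w != 0 ->
  cr3 (veronese u) (veronese v) (veronese w) (veronese z) (veronese m) = cr u v w z.
Proof.
move=> um vm wm zm uz vw; rewrite /cr3 /cr !det3_veronese; field.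
by rewrite um vm wm zm uz vw.
Qed.

End PlaneAlgebra.

(** * Configurations supported by a conic or a line *)

Section PlaneDescent.
Variable K : fieldType.
Hypothesis sep_closed : forall q : {poly K},
  separable_poly q -> (1 < size q)%N -> exists x, root q x.
Hypothesis char2 : 2%N \notin [pchar K].
Implicit Types (sigma : {rmorphism K -> K}).

(** Instead of showing that [h] preserves the conic, the cross ratios of four points are read off
    from the lines joining them to the fifth; these are invariant under any plane projectivity. *)
Lemma veronese_good (t : 'I_5 -> 'cV[K]_2) : pairwise_distinct t ->
  good [seq veronese (t i) | i <- enum 'I_5].
Proof.
move=> Ht; set s := [seq _ | _ <- _].
have [g gU Hg] := five_points_lam_good sep_closed char2 Ht.
exists (sym2 g); first exact: sym2_unit.
move=> sigma [h hU Hh].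
have mem_s i : veronese (t i) \in s by apply: map_f; rewrite mem_enum.
have t0 i : t i != 0.
  have [j ij] : exists j : 'I_5, i != j.
    by case: (eqVneq i ord0) => [->|?]; [exists (@Ordinal 5 1 isT) | exists ord0].
  by have [] := br_neq0 (Ht i j ij).
have veronese_inj (u v : 'cV[K]_2) : u != 0 -> v != 0 -> veronese u === veronese v -> u === v.
  move=> u0 v0 [c c0 E]; apply: proj_eq_br => //; apply/eqP; rewrite -sqrf_eq0.
  have /matrixP H := E; move: (H x0 0) (H x1 0) (H x2 0); rewrite !mxE /= => E0 E1 E2.
  apply/eqP; rewrite /br; transitivity (u 0 0 ^+ 2 * v 1 0 ^+ 2
    - 2%:R * (u 0 0 * u 1 0) * (v 0 0 * v 1 0) + u 1 0 ^+ 2 * v 0 0 ^+ 2); first by ring.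
  by rewrite E0 E1 E2; ring.
have /choice[f Hf] : forall i, exists j, h *m map_mx sigma (veronese (t i)) === veronese (t j).
  move=> i; have [_ /mapP[j _ ->] E] : exists2 v, v \in s &
      h *m map_mx sigma (veronese (t i)) === v by apply: Hh; do 2!apply: map_f.
  by exists j.
have injf : injective f.
  move=> i j fij; apply: (pairwise_distinct_eq Ht).
  apply: (proj_eq_map_inj (t0 i) (t0 j)) (_ : map_mx sigma _ === _).
  apply: veronese_inj; rewrite ?map_mx_eq0 //.
  apply: (proj_eq_mul_inj hU); rewrite -!veronese_map; apply: proj_eq_trans (Hf i) _.
  by rewrite fij; apply: proj_eq_sym.
have mod_s : lam_moduli t sigma.
  exists (perm injf) => p; rewrite -lam_map -lam_perm /lam.
  have Ht' := pairwise_distinct_inj (@perm_inj _ p) Ht.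
  have Hs := pairwise_distinct_map sigma Ht'.
  have Hf' := pairwise_distinct_inj (@perm_inj _ (perm injf)) Ht.
  have Hf'' := pairwise_distinct_inj (@perm_inj _ p) Hf'.
  rewrite -(cr3_veronese (m := map_mx sigma (t (p q4)))); try exact: Hs.
  rewrite -[RHS](cr3_veronese (m := t (perm injf (p q4)))); try exact: Hf''.
  rewrite -(cr3_mul _ _ _ _ _ hU) -!veronese_map; apply: cr3_proj_eq;
  by rewrite permE; apply: Hf.
move=> _ /mapP[_ /mapP[_ /mapP[i _ ->] ->] ->]; have [j E] := Hg sigma mod_s i.
exists (sym2 g *m veronese (t j)); first exact/map_f/mem_s.
by rewrite !sym2_veronese veronese_map; apply: veronese_proj_eq.
Qed.

Lemma pairwise_mem (T : eqType) (r : rel T) (s : seq T) x y :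
  ssrbool.symmetric r -> pairwise r s -> x \in s -> y \in s -> x != y -> r x y.
Proof.
move=> symr; elim: s => // z s IHs /=; rewrite !inE.
case/andP=> /allP zs ps /predU1P[->|xs] /predU1P[->|ys]; rewrite ?eqxx //.
- by move=> _; apply: zs.
- by move=> _; rewrite symr; apply: zs.
- exact: IHs.
Qed.

Lemma br_neq0_sym : ssrbool.symmetric (fun u v : 'cV[K]_2 => br u v != 0).
Proof. by move=> u v; rewrite br_anti oppr_eq0. Qed.

Lemma br_map_neq0 sigma (u v : 'cV[K]_2) :
  br u v != 0 -> br (map_mx sigma u) (map_mx sigma v) != 0.
Proof. by rewrite br_map fmorph_eq0. Qed.

Lemma emb_good (t : seq 'cV[K]_2) :
  pairwise (fun u v => br u v != 0) t -> (1 < size t)%N -> good t ->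
  good [seq emb v | v <- t].
Proof.
move=> dist szt [g gU Hg]; exists (blk g); first by rewrite blk_unit.
move=> sigma [h hU Hh].
have hE v : v \in t -> exists2 v', v' \in t & h *m emb (map_mx sigma v) === emb v'.
  move=> vt; have [_ /mapP[v' v't ->] E] : exists2 w, w \in [seq emb v | v <- t] &
      h *m map_mx sigma (emb v) === w by apply: Hh; do 3!apply: map_f.
  by exists v' => //; rewrite -emb_map.
have h2 v : v \in t -> (h *m emb (map_mx sigma v)) x2 0 = 0.
  by move=> /hE[v' _ [c _ ->]]; rewrite mxE cv3E mulr0.
have [h0 h1] : h x2 x0 = 0 /\ h x2 x1 = 0.
  case: t szt dist h2 {Hg Hh hE} => [|u [|v t]] //= _ /andP[/andP[uv _] _] h2.
  apply: (plane_line_block (br_map_neq0 sigma uv)); apply: h2;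
  by rewrite !inE eqxx ?orbT.
have [h'U _] := ublk_unit hU h0 h1.
have : pincl (conjs sigma (mximg g t)) (mximg g t).
  apply: Hg; exists (ublk h) => // _ /mapP[_ /mapP[v vt ->] ->].
  have [v' v't E] := hE v vt; exists v' => //.
  by apply/emb_proj_eq; rewrite -ublk_emb.
move=> Hs _ /mapP[_ /mapP[_ /mapP[v vt ->] ->] ->].
have [_ /mapP[v' v't ->] E] := Hs (map_mx sigma (g *m v)) (map_f _ (map_f _ vt)).
exists (blk g *m emb v'); first by do 2!apply: map_f.
by rewrite !blk_emb emb_map; apply/emb_proj_eq.
Qed.

(** If a point of the line went to [e3], two further ones would go by injectivity to distinct points
    of the line, and the images of three collinear points would not be collinear. *)
Lemma line_image sigma (h : 'M[K]_3) (t : seq 'cV[K]_2) :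
  pairwise (fun u v => br u v != 0) t -> (2 < size t)%N -> h \in unitmx ->
  pincl (mximg h (conjs sigma (e3 K :: [seq emb v | v <- t])))
        (e3 K :: [seq emb v | v <- t]) ->
  forall v, v \in t ->
  exists2 v', v' \in t & h *m emb (map_mx sigma v) === emb v'.
Proof.
move=> dist szt hU Hh.
have t_uniq : uniq t.
  rewrite uniq_pairwise; apply: sub_pairwise dist => u v; apply: contraNneq => ->.
  exact/eqP/br_proj_eq/proj_eq_refl.
have t_dist u v : u \in t -> v \in t -> u != v -> br u v != 0.
  exact: (pairwise_mem br_neq0_sym dist).
have h_inj u v : u \in t -> v \in t ->
    h *m emb (map_mx sigma u) === h *m emb (map_mx sigma v) -> u = v.
  move=> ut vt /(proj_eq_mul_inj hU)/emb_proj_eq E.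
  apply/eqP; apply: contraT => /(t_dist _ _ ut vt)/(br_map_neq0 sigma).
  by rewrite (br_proj_eq E) eqxx.
have h_img v : v \in t -> exists2 y, y \in e3 K :: [seq emb v | v <- t] &
    h *m emb (map_mx sigma v) === y.
  by move=> vt; apply: Hh; rewrite -emb_map; apply/map_f/map_f; rewrite inE map_f ?orbT.
move=> v vt; have [y] := h_img v vt; rewrite inE.
  case/predU1P => [-> hv|/mapP[v' v't ->]]; last by exists v'.
  have : (1 < size (rem v t))%N by rewrite size_rem // -(ltn_add2r 1) !addn1 prednK // (leq_trans _ szt).
  case E : (rem v t) => [|u [|w l]] // _.
  have [uw uv wv ut wt] : [/\ u != w, u != v, w != v, u \in t & w \in t].
    have := rem_uniq v t_uniq; rewrite E /= inE negb_or => /andP[/andP[uw _] _].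
    have mem x : (x \in [:: u, w & l]) = (x != v) && (x \in t).
      by rewrite -E mem_rem_uniq // inE.
    have := mem u; have := mem w; rewrite !inE !eqxx orbT /=.
    by move=> /esym/andP[-> ->] /esym/andP[-> ->].
  have not3 x : x \in t -> x != v ->
      exists2 x', x' \in t & h *m emb (map_mx sigma x) === emb x'.
    move=> xt xv; have [y'] := h_img x xt; rewrite inE.
    case/predU1P => [-> hx|/mapP[x' x't ->]]; last by exists x'.
    by move: xv; rewrite (h_inj x v) ?eqxx //; apply: proj_eq_trans hx (proj_eq_sym hv).
  have [u' u't hu] := not3 u ut uv; have [w' w't hw] := not3 w wt wv.
  have : det3 (e3 K) (emb u') (emb w') == 0.
    apply/negPn; rewrite -(det3_proj_eq_neq0 hv hu hw) det3_mul.
    by rewrite det3_emb cv3E !mulr0 eqxx.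
  rewrite -[det3 _ _ _]det3_rot det3_emb cv3E mulr1.
  have [E'|/(t_dist _ _ u't w't)/negPf->//] := eqVneq u' w'.
  move: uw; rewrite (h_inj u w) ?eqxx //; apply: proj_eq_trans hu _.
  by rewrite E'; apply: proj_eq_sym.
Qed.

Lemma line_plus_point_good (t : seq 'cV[K]_2) :
  pairwise (fun u v => br u v != 0) t -> (2 < size t)%N -> good t ->
  good (e3 K :: [seq emb v | v <- t]).
Proof.
move=> dist szt [g gU Hg]; exists (blk g); first by rewrite blk_unit.
move=> sigma [h hU Hh].
have hE := line_image dist szt hU Hh.
have h2 v : v \in t -> (h *m emb (map_mx sigma v)) x2 0 = 0.
  by move=> /hE[v' _ [c _ ->]]; rewrite mxE cv3E mulr0.
have [h0 h1] : h x2 x0 = 0 /\ h x2 x1 = 0.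
  case: t szt dist h2 {Hg Hh hE} => [|u [|v t]] //= _ /andP[/andP[uv _] _] h2.
  apply: (plane_line_block (br_map_neq0 sigma uv)); apply: h2;
  by rewrite !inE eqxx ?orbT.
have [h'U _] := ublk_unit hU h0 h1.
have : pincl (conjs sigma (mximg g t)) (mximg g t).
  apply: Hg; exists (ublk h) => // _ /mapP[_ /mapP[v vt ->] ->].
  have [v' v't E] := hE v vt; exists v' => //.
  by apply/emb_proj_eq; rewrite -ublk_emb.
move=> Hs _ /mapP[_ /mapP[y yL ->] ->]; move: yL; rewrite inE.
case/predU1P=> [->|/mapP[v vt ->]].
  exists (blk g *m e3 K); first by apply: map_f; rewrite mem_head.
  by rewrite blk_e3 cv3_map !rmorph0 rmorph1; apply: proj_eq_refl.
have [_ /mapP[v' v't ->] E] := Hs (map_mx sigma (g *m v)) (map_f _ (map_f _ vt)).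
exists (blk g *m emb v'); first by apply: map_f; rewrite inE map_f ?orbT.
by rewrite !blk_emb emb_map; apply/emb_proj_eq.
Qed.

(** The line joining the two outer points meets the line of the other three in [r], which the
    hypotheses on [a] and [b] keep distinct from them. A twisted symmetry preserves both lines,
    hence [r], so this is the case of three points with a marked one. *)
Lemma three_plus_two_good (a b : K) : a != 0 -> b != 0 -> a != b ->
  good [:: e1 K; e2 K; cv3 1 1 0; e3 K; cv3 a b 1].
Proof.
move=> a0 b0 ab; pose r := cv2 a b; pose t := [:: cv2 1 0; cv2 0 1; cv2 (1 : K) 1].
have ab0 : a - b != 0 by rewrite subr_eq0.
set s := [:: e1 K; _; _; _; _].
have embE : [seq emb v | v <- t] = [:: e1 K; e2 K; cv3 1 1 0].
  by rewrite /= /emb !cv2E.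
have qE : cv3 a b 1 = e3 K + emb r.
  by apply: eq_cv3; rewrite !mxE /= ?add0r ?addr0.
have [||||g [gU gr Hg]] := marked_line_good sep_closed (r := r) (t := t).
- move=> v; rewrite !inE => /or3P[]/eqP->; rewrite /br !cv2E.
  + by rewrite mulr0 mulr1 sub0r oppr_eq0.
  + by rewrite mulr0 mulr1 subr0.
  + by rewrite !mulr1.
- by rewrite /= /br !cv2E !(mulr1, mulr0, mul0r, subr0, sub0r) oppr_eq0 oner_eq0.
- by [].
- by right.
exists (blk g); first by rewrite blk_unit.
move=> sigma [h hU Hh].
have a_fix := fmorph_eq0 sigma a.
(* Up to sign, every determinant of distinct points with [x] off the line is 1, [a], [b] or [a - b],
   hence nonzero. *)
have three x y z : x \in s -> y \in s -> z \in s -> x != y -> x != z -> y != z ->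
    det3 x y z = 0 -> x x2 0 = 0.
  rewrite /s !inE => xs ys zs xy xz yz D.
  have contra (c : K) : c != 0 -> (det3 x y z = c \/ det3 x y z = - c) -> x x2 0 = 0.
    by rewrite D => c0 [E|/eqP]; [rewrite -E eqxx in c0 | rewrite eq_sym oppr_eq0 (negPf c0)].
  case/or4P: xs => [/eqP->|/eqP->|/eqP->|xs]; try by rewrite cv3E.
  case/orP: xs => /eqP xE; subst x;
  case/or4P: ys => [/eqP yE|/eqP yE|/eqP yE|/orP[]/eqP yE]; subst y; rewrite ?eqxx // in xy;
  case/or4P: zs => [/eqP zE|/eqP zE|/eqP zE|/orP[]/eqP zE]; subst z; rewrite ?eqxx // in xz yz;
  first [ apply: (contra 1); [exact: oner_neq0 | rewrite /det3 !cv3E; (left; ring) || (right; ring)]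
        | apply: (contra a); [exact: a0 | rewrite /det3 !cv3E; (left; ring) || (right; ring)]
        | apply: (contra b); [exact: b0 | rewrite /det3 !cv3E; (left; ring) || (right; ring)]
        | apply: (contra (a - b)); [exact: ab0 | rewrite /det3 !cv3E; (left; ring) || (right; ring)]].
have t_dist u v : u \in t -> v \in t -> u != v -> br u v != 0.
  apply: (pairwise_mem br_neq0_sym).
  by rewrite /= /br !cv2E !(mulr1, mulr0, mul0r, subr0, sub0r) oppr_eq0 oner_eq0.
have t_fix v : v \in t -> map_mx sigma v = v.
  by rewrite !inE => /or3P[]/eqP->; apply: eq_cv2; rewrite !mxE /= ?rmorph1 ?rmorph0.
have emb_s v : v \in t -> emb v \in s.
  move=> vt; have : emb v \in [seq emb v | v <- t] by rewrite map_f.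
  by rewrite embE !inE => /or3P[]->; rewrite ?orbT.
have h_img v : v \in t -> exists2 y, y \in s & h *m emb v === y.
  move=> vt; have E : emb v = map_mx sigma (emb v) by rewrite emb_map t_fix.
  by apply: Hh; rewrite E; do 2!apply: map_f; apply: emb_s.
have h_neq u v y z : u \in t -> v \in t -> u != v ->
    h *m emb u === y -> h *m emb v === z -> y != z.
  move=> ut vt /(t_dist _ _ ut vt) uv hy hz; apply: contraNneq uv => yz.
  apply/eqP/br_proj_eq/emb_proj_eq/(proj_eq_mul_inj hU).
  by apply: proj_eq_trans hy _; rewrite yz; apply: proj_eq_sym.
have [t1 t2 t3] : [/\ cv2 1 0 \in t, cv2 0 1 \in t & cv2 (1 : K) 1 \in t].
  by rewrite !inE !eqxx ?orbT.
have [n12 n13 n23] : [/\ cv2 1 0 != cv2 (0 : K) 1, cv2 1 0 != cv2 (1 : K) 1 & cv2 0 1 != cv2 (1 : K) 1].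
  split; apply/eqP => /matrixP E; move/eqP: (oner_neq0 K); apply.
  - by have := E 0 0; rewrite !mxE.
  - by have := E 1 0; rewrite !mxE.
  - by have := E 0 0; rewrite !mxE.
have hE v : v \in t -> exists2 v', v' \in t & h *m emb v === emb v'.
  have [y1 y1s hy1] := h_img _ t1; have [y2 y2s hy2] := h_img _ t2.
  have [y3 y3s hy3] := h_img _ t3.
  have m12 := h_neq _ _ _ _ t1 t2 n12 hy1 hy2; have m13 := h_neq _ _ _ _ t1 t3 n13 hy1 hy3.
  have m23 := h_neq _ _ _ _ t2 t3 n23 hy2 hy3.
  have D : det3 y1 y2 y3 = 0.
    apply/eqP/negPn; rewrite -(det3_proj_eq_neq0 hy1 hy2 hy3) det3_mul det3_emb cv3E.
    by rewrite !mulr0 eqxx.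
  have in_t y : y \in s -> y x2 0 = 0 -> exists2 v', v' \in t & y = emb v'.
    rewrite !inE => /or4P[/eqP->|/eqP->|/eqP->|/orP[]/eqP->]; rewrite ?cv3E => E.
    - by exists (cv2 1 0); rewrite // /emb !cv2E.
    - by exists (cv2 0 1); rewrite // /emb !cv2E.
    - by exists (cv2 1 1); rewrite // /emb !cv2E.
    - by move/eqP: E; rewrite oner_eq0.
    - by move/eqP: E; rewrite oner_eq0.
  rewrite !inE => /or3P[]/eqP->.
  - have [v' v't E] := in_t _ y1s (three _ _ _ y1s y2s y3s m12 m13 m23 D).
    by exists v'; rewrite -?E.
  - have m21 : y2 != y1 by rewrite eq_sym.
    have m31 : y3 != y1 by rewrite eq_sym.
    have D' : det3 y2 y3 y1 = 0 by rewrite det3_rot.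
    have [v' v't E] := in_t _ y2s (three _ _ _ y2s y3s y1s m23 m21 m31 D').
    by exists v'; rewrite -?E.
  - have m31 : y3 != y1 by rewrite eq_sym.
    have m32 : y3 != y2 by rewrite eq_sym.
    have D' : det3 y3 y1 y2 = 0 by rewrite -det3_rot.
    have [v' v't E] := in_t _ y3s (three _ _ _ y3s y1s y2s m31 m32 m12 D').
    by exists v'; rewrite -?E.
have h2 v : v \in t -> (h *m emb v) x2 0 = 0.
  by move=> /hE[v' _ [c _ ->]]; rewrite mxE cv3E mulr0.
have [h0 h1] : h x2 x0 = 0 /\ h x2 x1 = 0.
  exact: plane_line_block (t_dist _ _ t1 t2 n12) (h2 _ t1) (h2 _ t2).
have [h'U h22] := ublk_unit hU h0 h1.
have third (y : 'cV[K]_3) : (h *m y) x2 0 = h x2 x2 * y x2 0.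
  by rewrite mul_mx3E h0 h1 !mul0r !add0r.
have off_line y : y \in s -> y x2 0 != 0 -> y = e3 K \/ y = e3 K + emb r.
  rewrite !inE => /or4P[/eqP->|/eqP->|/eqP->|/orP[]/eqP->]; rewrite ?cv3E ?eqxx // => _.
    by left.
  by right.
have off_img y : y \in s -> y x2 0 = 1 -> exists z,
    h *m map_mx sigma y = h x2 x2 *: z /\ (z = e3 K \/ z = e3 K + emb r).
  move=> ys y1; have [z zs [c c0 E]] : exists2 z, z \in s & h *m map_mx sigma y === z.
    by apply: Hh; do 2!apply: map_f.
  have /matrixP/(_ x2 0) := E; rewrite third 2!mxE y1 rmorph1 mulr1 => Ec.
  have z2 : z x2 0 != 0.
    by apply: contraNneq h22 => z2; rewrite Ec z2 mulr0.
  have z1 : z x2 0 = 1.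
    by case: (off_line z zs z2) => ->; rewrite !mxE /= ?addr0.
  by exists z; split; [rewrite E Ec z1 mulr1 | apply: off_line].
have [e3s qs] : e3 K \in s /\ e3 K + emb r \in s.
  by rewrite -qE !inE !eqxx ?orbT.
have [z1 [Ez1 z1E]] := off_img _ e3s (cv3E2 _ _ _).
have [|z2 [Ez2 z2E]] := off_img _ qs; first by rewrite !mxE /= addr0.
(* The vector [emb r] is the difference of the two outer points. Their images carry the same scalar
   [h x2 x2], so its image is proportional to a difference of outer points again, that is, to
   [emb r] or to zero; zero is impossible. *)
have hr : h *m emb (map_mx sigma r) = h x2 x2 *: (z2 - z1).
  rewrite scalerBr -Ez1 -Ez2 -mulmxBr map_mxD emb_map; congr (_ *m _).
  by rewrite addrAC subrr add0r.
have hrr : ublk h *m map_mx sigma r === r.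
  apply/emb_proj_eq; rewrite -ublk_emb // hr.
  case: z1E => z1E; case: z2E => z2E; rewrite z1E z2E in hr *.
  - move: hr; rewrite subrr scaler0 => /(congr1 (mulmx (invmx h))).
    rewrite mulKmx // mulmx0 => /matrixP/(_ x0 0); rewrite !mxE /= => /eqP.
    by rewrite a_fix (negPf a0).
  - by rewrite addrAC subrr add0r; apply: proj_eq_scale.
  - by rewrite opprD addNKr scalerN -scaleNr; apply: proj_eq_scale; rewrite oppr_eq0.
  - move: hr; rewrite subrr scaler0 => /(congr1 (mulmx (invmx h))).
    rewrite mulKmx // mulmx0 => /matrixP/(_ x0 0); rewrite !mxE /= => /eqP.
    by rewrite a_fix (negPf a0).
have Hs : pincl (conjs sigma (mximg g t)) (mximg g t).
  apply: Hg; exists (ublk h); split=> // _ /mapP[_ /mapP[v vt ->] ->].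
  have [v' v't E] := hE v vt; exists v' => //.
  by apply/emb_proj_eq; rewrite -ublk_emb // t_fix.
have sE : s = [seq emb v | v <- t] ++ [:: e3 K; e3 K + emb r] by rewrite embE -qE.
move=> _ /mapP[_ /mapP[y ys ->] ->]; move: ys; rewrite sE mem_cat.
case/orP=> [/mapP[v vt ->]|].
  have [_ /mapP[v' v't ->] E] := Hs (map_mx sigma (g *m v)) (map_f _ (map_f _ vt)).
  exists (blk g *m emb v'); first by apply: map_f; rewrite mem_cat map_f.
  by rewrite !blk_emb emb_map; apply/emb_proj_eq.
rewrite !inE => /orP[]/eqP->.
  exists (blk g *m e3 K); first by apply: map_f; rewrite -sE.
  by rewrite blk_e3 cv3_map !rmorph0 rmorph1; apply: proj_eq_refl.
exists (blk g *m (e3 K + emb r)); first by apply: map_f; rewrite -sE.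
rewrite mulmxDr blk_e3 blk_emb gr (_ : map_mx _ _ = e3 K + emb (cv2 1 0)).
  exact: proj_eq_refl.
by apply: eq_cv3; rewrite !mxE /= rmorphD ?rmorph0 ?rmorph1.
Qed.

End PlaneDescent.

(** * Case analysis for at most five points of the plane *)

Section PlaneCases.
Variable K : fieldType.
Hypothesis sep_closed : forall q : {poly K},
  separable_poly q -> (1 < size q)%N -> exists x, root q x.
Hypothesis char2 : 2%N \notin [pchar K].
Implicit Types (x y : 'cV[K]_3) (sigma : {rmorphism K -> K}).
Local Notation e1 := (e1 K).
Local Notation e2 := (e2 K).
Local Notation e3 := (e3 K).

Lemma good_coord (P : 'M[K]_3) s : P \in unitmx -> good s -> good (mximg P s).
Proof. by move=> PU; apply: (good_equiv PU); apply: pincl_refl. Qed.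

Lemma good_rescale m (s t : seq 'cV[K]_m) : pincl s t -> pincl t s -> good s -> good t.
Proof. by move=> st ts; apply: (@good_equiv _ _ 1%:M); rewrite ?unitmx1 ?mximg1. Qed.

Lemma fixed_good m (s : seq 'cV[K]_m) :
  (forall sigma (u : 'cV[K]_m), u \in s -> map_mx sigma u = u) -> good s.
Proof.
move=> Hs; apply: rigid_good => sigma _ /mapP[u us ->]; exists u => //.
by rewrite Hs //; apply: proj_eq_refl.
Qed.

Definition diag3 (a b c : K) := mx3 (a *: e1) (b *: e2) (c *: e3).

Lemma diag3_unit a b c : (diag3 a b c \in unitmx) = (a * b * c != 0).
Proof. by rewrite mx3_unit det3_scale det3_e mulr1. Qed.

Lemma mul_diag3 a b c p q r : diag3 a b c *m cv3 p q r = cv3 (a * p) (b * q) (c * r).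
Proof. by apply: eq_cv3; rewrite mul_mx3 lin3E !mxE /=; ring. Qed.

(** A diagonal matrix fixes the frame and turns the coordinates of [x] into zeros and ones; the
    entry 1 is the default where a coordinate of [x] vanishes. *)
Lemma frame_point_good x : good [:: e1; e2; e3; x].
Proof.
pose d (i : 'I_3) := if x i 0 == 0 then 1 else x i 0.
have d0 i : d i != 0 by rewrite /d; case: ifPn => // _; apply: oner_neq0.
pose D := diag3 (d x0) (d x1) (d x2).
have DU : D \in unitmx by rewrite diag3_unit !mulf_neq0.
pose b (i : 'I_3) : nat := x i 0 != 0.
have bE i : d i * (b i)%:R = x i 0.
  by rewrite /d /b; case: eqVneq => [->|_]; rewrite ?mulr0 ?mulr1.
have DE : mximg D [:: e1; e2; e3; cv3 (b x0)%:R (b x1)%:R (b x2)%:R] =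
    [:: d x0 *: e1; d x1 *: e2; d x2 *: e3; x].
  rewrite /mximg /= mul_mx3_e1 mul_mx3_e2 mul_mx3_e3 mul_diag3 !bE.
  by rewrite -cv3_eta.
apply: (good_equiv DU (s := [:: e1; e2; e3; cv3 (b x0)%:R (b x1)%:R (b x2)%:R])); rewrite ?DE.
- move=> y; rewrite !inE => /or4P[]/eqP->.
  + by exists (d x0 *: e1); rewrite ?inE ?eqxx ?orbT //; apply/proj_eq_sym/proj_eq_scale.
  + by exists (d x1 *: e2); rewrite ?inE ?eqxx ?orbT //; apply/proj_eq_sym/proj_eq_scale.
  + by exists (d x2 *: e3); rewrite ?inE ?eqxx ?orbT //; apply/proj_eq_sym/proj_eq_scale.
  + by exists x; rewrite ?inE ?eqxx ?orbT //; apply: proj_eq_refl.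
- move=> y; rewrite !inE => /or4P[]/eqP->.
  + by exists e1; rewrite ?inE ?eqxx ?orbT //; apply/proj_eq_scale.
  + by exists e2; rewrite ?inE ?eqxx ?orbT //; apply/proj_eq_scale.
  + by exists e3; rewrite ?inE ?eqxx ?orbT //; apply/proj_eq_scale.
  + by exists x; rewrite ?inE ?eqxx ?orbT //; apply: proj_eq_refl.
apply: fixed_good => sigma y; rewrite !inE => /or4P[]/eqP->;
by rewrite cv3_map ?rmorph_nat ?rmorph0 ?rmorph1.
Qed.

(** This serves the values (0,1), (1,0) and (1,1) of [(i, j)], where the line joining the last two
    points passes through one of the other three. Rescaling the third coordinate removes [k]. *)
Lemma two_lines_good (i j : nat) (k : K) : k != 0 ->
  good [:: e1; e2; cv3 1 1 0; e3; cv3 (k * i%:R) (k * j%:R) 1].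
Proof.
move=> k0; pose D := diag3 1 1 k^-1.
have DU : D \in unitmx by rewrite diag3_unit !mul1r invr_neq0.
have DE : mximg D [:: e1; e2; cv3 1 1 0; e3; cv3 i%:R j%:R 1] =
    [:: e1; e2; cv3 1 1 0; k^-1 *: e3; k^-1 *: cv3 (k * i%:R) (k * j%:R) 1].
  rewrite /mximg /= mul_mx3_e1 mul_mx3_e2 mul_mx3_e3 !mul_diag3 !scale1r !mul1r mulr0 mulr1.
  do 5!congr (_ :: _); apply: eq_cv3; rewrite !mxE /= ?mulr1 //; by rewrite mulrA mulVf ?mul1r.
apply: (good_equiv DU (s := [:: e1; e2; cv3 1 1 0; e3; cv3 i%:R j%:R 1])); rewrite ?DE.
- move=> y; rewrite !inE => /or4P[/eqP->|/eqP->|/eqP->|/orP[]/eqP->].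
  + by exists e1; rewrite ?inE ?eqxx ?orbT //; apply: proj_eq_refl.
  + by exists e2; rewrite ?inE ?eqxx ?orbT //; apply: proj_eq_refl.
  + by exists (cv3 1 1 0); rewrite ?inE ?eqxx ?orbT //; apply: proj_eq_refl.
  + exists (k^-1 *: e3); rewrite ?inE ?eqxx ?orbT //.
    by apply/proj_eq_sym/proj_eq_scale/invr_neq0.
  + eexists; last by apply/proj_eq_sym/proj_eq_scale; exact: (invr_neq0 k0).
    by rewrite !inE eqxx !orbT.
- move=> y; rewrite !inE => /or4P[/eqP->|/eqP->|/eqP->|/orP[]/eqP->].
  + by exists e1; rewrite ?inE ?eqxx ?orbT //; apply: proj_eq_refl.
  + by exists e2; rewrite ?inE ?eqxx ?orbT //; apply: proj_eq_refl.
  + by exists (cv3 1 1 0); rewrite ?inE ?eqxx ?orbT //; apply: proj_eq_refl.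
  + by exists e3; rewrite ?inE ?eqxx ?orbT //; apply/proj_eq_scale/invr_neq0.
  + eexists; last by apply: proj_eq_scale; exact: (invr_neq0 k0).
    by rewrite !inE eqxx !orbT.
apply: fixed_good => sigma y; rewrite !inE => /or4P[/eqP->|/eqP->|/eqP->|/orP[]/eqP->];
by rewrite cv3_map ?rmorph_nat ?rmorph0 ?rmorph1.
Qed.

(** Either [x] lies on the line of the triple, or the case is decided by where the line joining [e3]
    and [x] meets it: in one of the three points or elsewhere. *)
Lemma collinear_triple_good x : x != 0 -> ~ x === e1 -> ~ x === e2 ->
  ~ x === cv3 1 1 0 -> ~ x === e3 -> good [:: e1; e2; cv3 1 1 0; e3; x].
Proof.
move=> xn0 xe1 xe2 xe12 xe3.
have [c0|c0] := eqVneq (x x2 0) 0.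
  pose v := cv2 (x x0 0) (x x1 0).
  have xE : x = emb v by rewrite [LHS]cv3_eta /emb !cv2E c0.
  have v0 : v != 0.
    by apply: contra_neq xn0 => v0; rewrite xE v0; apply: eq_cv3; rewrite !mxE.
  have brv (w : 'cV[K]_2) : w != 0 -> ~ x === emb w -> br w v != 0.
    move=> w0 xw; apply/eqP => /(proj_eq_br w0 v0) E; apply: xw.
    by rewrite xE; apply/emb_proj_eq/proj_eq_sym.
  have n1 : cv2 1 0 != 0 :> 'cV[K]_2 by apply/eqP => /matrixP/(_ 0 0); rewrite !mxE => /eqP; rewrite oner_eq0.
  have n2 : cv2 0 1 != 0 :> 'cV[K]_2 by apply/eqP => /matrixP/(_ 1 0); rewrite !mxE => /eqP; rewrite oner_eq0.
  have n3 : cv2 1 1 != 0 :> 'cV[K]_2 by apply/eqP => /matrixP/(_ 0 0); rewrite !mxE => /eqP; rewrite oner_eq0.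
  pose t := [:: cv2 1 0; cv2 0 1; cv2 1 1; v].
  have dist : pairwise (fun u v : 'cV[K]_2 => br u v != 0) t.
    rewrite /= !brv // /emb ?cv2E //.
    by rewrite /br !cv2E !(mulr1, mulr0, mul0r, subr0, sub0r) oppr_eq0 oner_eq0.
  apply: good_eq_mem (line_plus_point_good dist isT (four_points_good sep_closed char2 dist)).
  have -> : [seq emb v | v <- t] = [:: e1; e2; cv3 1 1 0; x] by rewrite xE /= /emb !cv2E.
  by move=> y; rewrite !inE; do !case: eqP => //=.
pose a := x x0 0 / x x2 0; pose b := x x1 0 / x x2 0.
have xE : x === cv3 a b 1.
  exists (x x2 0) => //; apply: eq_cv3; rewrite !mxE /= ?mulr1 //;
  by rewrite mulrCA divff ?mulr1.
apply: (@good_rescale _ [:: e1; e2; cv3 1 1 0; e3; cv3 a b 1]).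
- move=> y; rewrite !inE => /or4P[/eqP->|/eqP->|/eqP->|/orP[]/eqP->].
  + by exists e1; rewrite ?inE ?eqxx ?orbT //; apply: proj_eq_refl.
  + by exists e2; rewrite ?inE ?eqxx ?orbT //; apply: proj_eq_refl.
  + by exists (cv3 1 1 0); rewrite ?inE ?eqxx ?orbT //; apply: proj_eq_refl.
  + by exists e3; rewrite ?inE ?eqxx ?orbT //; apply: proj_eq_refl.
  + by exists x; rewrite ?inE ?eqxx ?orbT //; apply: proj_eq_sym.
- move=> y; rewrite !inE => /or4P[/eqP->|/eqP->|/eqP->|/orP[]/eqP->].
  + by exists e1; rewrite ?inE ?eqxx ?orbT //; apply: proj_eq_refl.
  + by exists e2; rewrite ?inE ?eqxx ?orbT //; apply: proj_eq_refl.
  + by exists (cv3 1 1 0); rewrite ?inE ?eqxx ?orbT //; apply: proj_eq_refl.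
  + by exists e3; rewrite ?inE ?eqxx ?orbT //; apply: proj_eq_refl.
  + by exists (cv3 a b 1); rewrite ?inE ?eqxx ?orbT //; apply: proj_eq_sym.
have [a0|a0] := eqVneq a 0.
  have b0 : b != 0.
    by apply/eqP => b0; apply: xe3; rewrite a0 b0 in xE.
  by have := two_lines_good 0 1 b0; rewrite mulr0 mulr1 a0.
have [b0|b0] := eqVneq b 0.
  by have := two_lines_good 1 0 a0; rewrite mulr0 mulr1 b0.
have [ab|ab] := eqVneq a b.
  by have := two_lines_good 1 1 a0; rewrite mulr1 ab.
exact: three_plus_two_good.
Qed.

Lemma general_position_good (a b c : K) : a != 0 -> b != 0 -> c != 0 ->
  a != b -> a != c -> b != c -> good [:: e1; e2; e3; cv3 1 1 1; cv3 a b c].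
Proof.
move=> a0 b0 c0 ab ac bc; pose p := a^-1; pose q := b^-1; pose r := c^-1.
have [p0 [q0 r0]] : p != 0 /\ q != 0 /\ r != 0 by rewrite !invr_neq0.
have [pq [pr qr]] : p - q != 0 /\ p - r != 0 /\ q - r != 0.
  by rewrite !subr_eq0 !(inj_eq invr_inj).
pose s := [:: cv2 p 1; cv2 q 1; cv2 r 1; cv2 1 0; cv2 0 1].
have dist : pairwise (fun u v : 'cV[K]_2 => br u v != 0) s.
  rewrite /= /br !cv2E !(mulr1, mul1r, mulr0, mul0r, subr0, sub0r, oppr_eq0) oner_neq0.
  by rewrite p0 q0 r0 pq pr qr.
have vs : good [seq veronese v | v <- s].
  have := veronese_good sep_closed char2 (pairwise_nth_distinct (erefl : size s = 5) dist).
  apply: good_eq_mem => y; apply/mapP/mapP => -[].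
    by move=> i _ ->; exists (nth 0 s i); rewrite ?mem_nth.
  move=> v /(nthP 0)[i lti <-] ->; exists (Ordinal lti) => //.
  by rewrite mem_enum.
(* The rows of [W] are the quadratic forms (x - qy)(x - ry), (x - py)(x - ry), (x - py)(x - qy). At
   [p], [q], [r] two of them vanish, at infinity all are 1, and at 0 they are proportional to [a],
   [b], [c]: this parametrizes the conic through the five points. *)
pose W := mx3 (cv3 1 1 1) (cv3 (- (q + r)) (- (p + r)) (- (p + q)))
              (cv3 (q * r) (p * r) (p * q)).
have WU : W \in unitmx.
  rewrite mx3_unit.
  have -> : det3 (cv3 1 1 1) (cv3 (- (q + r)) (- (p + r)) (- (p + q)))
      (cv3 (q * r) (p * r) (p * q)) = - ((p - q) * (p - r) * (q - r)).
    by rewrite /det3 !cv3E; ring.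
  by rewrite oppr_eq0 !mulf_neq0.
have WE : mximg W [seq veronese v | v <- s] = [:: ((p - q) * (p - r)) *: e1;
    ((q - p) * (q - r)) *: e2; ((r - p) * (r - q)) *: e3; cv3 1 1 1;
    (p * q * r) *: cv3 a b c].
  rewrite /mximg /= /veronese !cv2E.
  congr [:: _; _; _; _; _]; apply: eq_cv3; rewrite mul_mx3 lin3E !mxE /=;
    try ring; rewrite /p /q /r; field; rewrite ?a0 ?b0 ?c0 //.
have [k1 [k2 [k3 k5]]] : (p - q) * (p - r) != 0 /\ (q - p) * (q - r) != 0 /\
    (r - p) * (r - q) != 0 /\ p * q * r != 0.
  by rewrite -[q - p]opprB -[r - p]opprB -[r - q]opprB !mulf_eq0 !oppr_eq0
    !(negPf pq, negPf pr, negPf qr, negPf p0, negPf q0, negPf r0).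
apply: (good_equiv WU _ _ vs); rewrite WE.
- move=> y; rewrite !inE => /or4P[/eqP->|/eqP->|/eqP->|/orP[]/eqP->].
  + by eexists; last exact/proj_eq_sym/(proj_eq_scale _ k1); rewrite !inE eqxx ?orbT.
  + by eexists; last exact/proj_eq_sym/(proj_eq_scale _ k2); rewrite !inE eqxx ?orbT.
  + by eexists; last exact/proj_eq_sym/(proj_eq_scale _ k3); rewrite !inE eqxx ?orbT.
  + by eexists; last exact/proj_eq_refl; rewrite !inE eqxx ?orbT.
  + by eexists; last exact/proj_eq_sym/(proj_eq_scale _ k5); rewrite !inE eqxx ?orbT.
- move=> y; rewrite !inE => /or4P[/eqP->|/eqP->|/eqP->|/orP[]/eqP->].
  + by eexists; last exact/(proj_eq_scale _ k1); rewrite !inE eqxx ?orbT.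
  + by eexists; last exact/(proj_eq_scale _ k2); rewrite !inE eqxx ?orbT.
  + by eexists; last exact/(proj_eq_scale _ k3); rewrite !inE eqxx ?orbT.
  + by eexists; last exact/proj_eq_refl; rewrite !inE eqxx ?orbT.
  + by eexists; last exact/(proj_eq_scale _ k5); rewrite !inE eqxx ?orbT.
Qed.

Lemma perm_3rest (T : eqType) (s : seq T) u v w :
  uniq s -> u \in s -> v \in s -> w \in s -> u != v -> u != w -> v != w ->
  exists l, perm_eq s [:: u, v, w & l] /\ size s = (size l).+3.
Proof.
move=> Us us vs ws uv uw vw; pose l := rem w (rem v (rem u s)); exists l.
have P : perm_eq s [:: u, v, w & l].
  apply: perm_trans (perm_to_rem us) _; rewrite perm_cons.
  have v' : v \in rem u s by rewrite mem_rem_uniq // inE eq_sym uv.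
  apply: perm_trans (perm_to_rem v') _; rewrite perm_cons; apply: perm_to_rem.
  by rewrite mem_rem_uniq ?rem_uniq // inE mem_rem_uniq // inE ![w == _]eq_sym vw uw.
by split; rewrite ?(perm_size P).
Qed.

Section FivePlanePoints.
Variable s : seq 'cV[K]_3.
Hypothesis s_neq0 : forall v, v \in s -> v != 0.
Hypothesis s_neq : forall u v, u \in s -> v \in s -> u != v -> ~ u === v.

Lemma good_of_coord (P : 'M[K]_3) t l : P \in unitmx -> good t ->
  mximg P t = l -> pincl l s -> pincl s l -> good s.
Proof.
move=> PU gt Pt ls sl; apply: good_rescale ls sl _.
by rewrite -Pt; apply: good_coord.
Qed.

Lemma five_with_collinear_triple a b c p q :
  perm_eq s [:: a; b; c; p; q] -> uniq s -> det3 a b c = 0 -> det3 a b p != 0 -> good s.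
Proof.
move=> P Us abc abp.
have mem x : x \in [:: a; b; c; p; q] -> x \in s by rewrite (perm_mem P).
have [as_ bs cs ps qs] : [/\ a \in s, b \in s, c \in s, p \in s & q \in s].
  by split; apply: mem; rewrite !inE eqxx ?orbT.
move: Us; rewrite (perm_uniq P) /= !inE !negb_or !andbT.
case/and4P => /and4P[ab ac ap aq] /and3P[bc bp bq] /andP[cp cq] pq.
have [al [be cE]] := det3_eq0_span (s_neq0 as_) (s_neq0 bs) (s_neq as_ bs ab) abc.
have al0 : al != 0.
  apply/eqP => al0; apply: (s_neq bs cs bc); rewrite cE al0 scale0r add0r.
  apply/proj_eq_sym/proj_eq_scale/eqP => be0.
  by move: (s_neq0 cs); rewrite cE al0 be0 !scale0r addr0 eqxx.
have be0 : be != 0.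
  apply/eqP => be0; apply: (s_neq as_ cs ac); rewrite cE be0 scale0r addr0.
  exact/proj_eq_sym/proj_eq_scale.
pose M := mx3 (al *: a) (be *: b) p.
have MU : M \in unitmx by rewrite mx3_unit -[p]scale1r det3_scale mulr1 !mulf_neq0.
pose x := invmx M *m q.
have Mx : M *m x = q by rewrite mulmxA mulmxV // mul1mx.
have M12 : M *m cv3 1 1 0 = c.
  by rewrite mul_mx3 !cv3E !scale1r scale0r addr0 -cE.
have xn y z : M *m y === z -> z \in s -> z != q -> ~ x === y.
  move=> yz zs zq xy; apply: (s_neq zs qs zq); apply: proj_eq_sym.
  by rewrite -Mx; apply: proj_eq_trans (proj_eq_mul M xy) yz.
apply: (good_of_coord MU (t := [:: e1; e2; cv3 1 1 0; e3; x])
  (l := [:: al *: a; be *: b; c; p; q])).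
- apply: collinear_triple_good.
  + by apply: contraNneq (s_neq0 qs) => x0_; rewrite -Mx x0_ mulmx0.
  + by apply: (xn _ a) => //; rewrite mul_mx3_e1; apply: proj_eq_scale.
  + by apply: (xn _ b) => //; rewrite mul_mx3_e2; apply: proj_eq_scale.
  + by apply: (xn _ c) => //; rewrite M12; apply: proj_eq_refl.
  + by apply: (xn _ p) => //; rewrite mul_mx3_e3; apply: proj_eq_refl.
- by rewrite /mximg /= mul_mx3_e1 mul_mx3_e2 mul_mx3_e3 M12 Mx.
- move=> y; rewrite !inE => /or4P[/eqP->|/eqP->|/eqP->|/orP[]/eqP->].
  + by exists a => //; apply: proj_eq_scale.
  + by exists b => //; apply: proj_eq_scale.
  + by exists c => //; apply: proj_eq_refl.
  + by exists p => //; apply: proj_eq_refl.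
  + by exists q => //; apply: proj_eq_refl.
- move=> y; rewrite (perm_mem P) !inE => /or4P[/eqP->|/eqP->|/eqP->|/orP[]/eqP->].
  + by exists (al *: a); rewrite ?inE ?eqxx ?orbT //; apply/proj_eq_sym/proj_eq_scale.
  + by exists (be *: b); rewrite ?inE ?eqxx ?orbT //; apply/proj_eq_sym/proj_eq_scale.
  + by exists c; rewrite ?inE ?eqxx ?orbT //; apply: proj_eq_refl.
  + by exists p; rewrite ?inE ?eqxx ?orbT //; apply: proj_eq_refl.
  + by exists q; rewrite ?inE ?eqxx ?orbT //; apply: proj_eq_refl.
Qed.

Lemma five_general u v w x y : perm_eq s [:: u; v; w; x; y] -> uniq s ->
  (forall a b c, a \in s -> b \in s -> c \in s -> a != b -> a != c -> b != c ->
     det3 a b c != 0) -> good s.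
Proof.
move=> P Us gen.
have mem z : z \in [:: u; v; w; x; y] -> z \in s by rewrite (perm_mem P).
have [us vs ws xs ys] : [/\ u \in s, v \in s, w \in s, x \in s & y \in s].
  by split; apply: mem; rewrite !inE eqxx ?orbT.
move: Us; rewrite (perm_uniq P) /= !inE !negb_or !andbT.
case/and4P => /and4P[uv uw ux uy] /and3P[vw vx vy] /andP[wx wy] xy.
have D0 : det3 u v w != 0 by apply: gen.
pose P0 := mx3 u v w; have P0U : P0 \in unitmx by rewrite mx3_unit.
have span z : exists k : 'cV[K]_3, z = P0 *m k.
  by exists (invmx P0 *m z); rewrite mulmxA mulmxV // mul1mx.
have [k kE] := span x; rewrite mul_mx3 in kE.
set k0 := k x0 0 in kE; set k1 := k x1 0 in kE; set k2 := k x2 0 in kE.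
have [k0_ [k1_ k2_]] : k0 != 0 /\ k1 != 0 /\ k2 != 0.
  have L (c : K) : c * det3 u v w != 0 -> c != 0.
    by apply: contraNneq => ->; rewrite mul0r.
  split; [|split]; apply: L.
  - suff <- : det3 x v w = k0 * det3 u v w by apply: gen; rewrite // eq_sym.
    by rewrite kE /det3 !mxE; ring.
  - suff <- : det3 u x w = k1 * det3 u v w by apply: gen; rewrite // eq_sym.
    by rewrite kE /det3 !mxE; ring.
  - suff <- : det3 u v x = k2 * det3 u v w by apply: gen.
    by rewrite kE /det3 !mxE; ring.
pose M := mx3 (k0 *: u) (k1 *: v) (k2 *: w).
have MU : M \in unitmx by rewrite mx3_unit det3_scale !mulf_neq0.
pose z := invmx M *m y.
have Mz : M *m z = y by rewrite mulmxA mulmxV // mul1mx.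
have M1 : M *m cv3 1 1 1 = x by rewrite mul_mx3 !cv3E !scale1r -kE.
set a := z x0 0; set b := z x1 0; set c := z x2 0.
have yE : y = (a * k0) *: u + (b * k1) *: v + (c * k2) *: w.
  by rewrite -Mz mul_mx3 !scalerA.
have [a0 [b0 [c0 [ab [ac bc]]]]] : a != 0 /\ b != 0 /\ c != 0 /\
    a != b /\ a != c /\ b != c.
  have L (e d f : K) : f = e * d -> f != 0 -> e != 0.
    by move=> ->; apply: contraNneq => ->; rewrite mul0r.
  have E1 : det3 y v w = a * (k0 * det3 u v w) by rewrite yE /det3 !mxE; ring.
  have E2 : det3 u y w = b * (k1 * det3 u v w) by rewrite yE /det3 !mxE; ring.
  have E3 : det3 u v y = c * (k2 * det3 u v w) by rewrite yE /det3 !mxE; ring.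
  have E12 : det3 x y w = (a - b) * - (k0 * k1 * det3 u v w).
    by rewrite kE yE /det3 !mxE; ring.
  have E13 : det3 x v y = (a - c) * - (k0 * k2 * det3 u v w).
    by rewrite kE yE /det3 !mxE; ring.
  have E23 : det3 u x y = (b - c) * - (k1 * k2 * det3 u v w).
    by rewrite kE yE /det3 !mxE; ring.
  split; first by apply: (L _ _ _ E1); apply: gen; rewrite // eq_sym.
  split; first by apply: (L _ _ _ E2); apply: gen; rewrite // eq_sym.
  split; first by apply: (L _ _ _ E3); apply: gen.
  split; first by rewrite -subr_eq0; apply: (L _ _ _ E12); apply: gen; rewrite // eq_sym.
  split; first by rewrite -subr_eq0; apply: (L _ _ _ E13); apply: gen; rewrite // eq_sym.
  by rewrite -subr_eq0; apply: (L _ _ _ E23); apply: gen.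
apply: (good_of_coord MU (general_position_good a0 b0 c0 ab ac bc)
  (l := [:: k0 *: u; k1 *: v; k2 *: w; x; y])).
- by rewrite /mximg /= mul_mx3_e1 mul_mx3_e2 mul_mx3_e3 M1 -cv3_eta Mz.
- move=> e; rewrite !inE => /or4P[/eqP->|/eqP->|/eqP->|/orP[]/eqP->].
  + by exists u => //; apply: proj_eq_scale.
  + by exists v => //; apply: proj_eq_scale.
  + by exists w => //; apply: proj_eq_scale.
  + by exists x => //; apply: proj_eq_refl.
  + by exists y => //; apply: proj_eq_refl.
- move=> e; rewrite (perm_mem P) !inE => /or4P[/eqP->|/eqP->|/eqP->|/orP[]/eqP->].
  + by exists (k0 *: u); rewrite ?inE ?eqxx ?orbT //; apply/proj_eq_sym/proj_eq_scale.
  + by exists (k1 *: v); rewrite ?inE ?eqxx ?orbT //; apply/proj_eq_sym/proj_eq_scale.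
  + by exists (k2 *: w); rewrite ?inE ?eqxx ?orbT //; apply/proj_eq_sym/proj_eq_scale.
  + by exists x; rewrite ?inE ?eqxx ?orbT //; apply: proj_eq_refl.
  + by exists y; rewrite ?inE ?eqxx ?orbT //; apply: proj_eq_refl.
Qed.

Lemma collinear_good : uniq s -> (size s <= 5)%N ->
  (forall u v w, u \in s -> v \in s -> w \in s -> det3 u v w = 0) -> good s.
Proof.
move=> Us s5 col; case sE : s => [|u [|v l]]; first by apply: fixed_good.
  have u0 : u != 0 by apply: s_neq0; rewrite sE mem_head.
  have [v [w D]] := extend_basis1 u0.
  have <- : mximg (mx3 u v w) [:: e1] = [:: u] by rewrite /mximg /= mul_mx3_e1.
  apply: good_coord; first by rewrite mx3_unit.
  apply: fixed_good => sigma x; rewrite inE => /eqP->.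
  by rewrite cv3_map rmorph0 rmorph1.
rewrite -sE.
have [us vs] : u \in s /\ v \in s by rewrite sE !inE !eqxx orbT.
have uv : u != v by move: Us; rewrite sE /= inE negb_or => /andP[/andP[]].
have [w D] := extend_basis2 (s_neq0 us) (s_neq0 vs) (s_neq us vs uv).
pose P := mx3 u v w; have PU : P \in unitmx by rewrite mx3_unit.
pose f (y : 'cV[K]_3) := cv2 ((invmx P *m y) x0 0) ((invmx P *m y) x1 0).
have fE y : y \in s -> emb (f y) = invmx P *m y.
  move=> ys; have [a [b yE]] := det3_eq0_span (s_neq0 us) (s_neq0 vs) (s_neq us vs uv) (col _ _ _ us vs ys).
  have EP : invmx P *m y = cv3 a b 0.
    have -> : y = P *m cv3 a b 0 by rewrite mul_mx3 !cv3E scale0r addr0.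
    by rewrite mulmxA mulVmx // mul1mx.
  by rewrite /emb !cv2E EP !cv3E.
have -> : s = mximg P [seq emb z | z <- [seq f y | y <- s]].
  rewrite /mximg -!map_comp -[LHS]map_id; apply/eq_in_map => y ys /=.
  by rewrite fE // mulmxA mulmxV // mul1mx.
apply: good_coord => //.
have f0 y : y \in s -> f y != 0.
  move=> ys; apply: contraNneq (s_neq0 ys) => E; rewrite -(mulKVmx PU y) -fE // E.
  rewrite (_ : emb 0 = 0) ?mulmx0 //; by apply: eq_cv3; rewrite !mxE.
have dist : pairwise (fun u v : 'cV[K]_2 => br u v != 0) [seq f y | y <- s].
  rewrite pairwise_map; apply: pairwise_of_mem => // y z ys zs yz.
  apply/eqP => /(proj_eq_br (f0 _ ys) (f0 _ zs)) E; apply: (s_neq ys zs yz).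
  have PU' : invmx P \in unitmx by rewrite unitmx_inv.
  by apply: (proj_eq_mul_inj PU'); rewrite -!fE //; apply/emb_proj_eq.
apply: emb_good => //; first by rewrite size_map sE.
apply: (line_good sep_closed char2 _ dist); last by rewrite size_map.
by move=> _ /mapP[y ys ->]; apply: f0.
Qed.

Lemma plane_good : uniq s -> (size s <= 5)%N -> good s.
Proof.
move=> Us s5; have [col|] := pselect (forall u v w, u \in s -> v \in s -> w \in s -> det3 u v w = 0).
  exact: collinear_good.
move=> ncol; have [u [v [w [us vs ws D]]]] : exists u v w,
    [/\ u \in s, v \in s, w \in s & det3 u v w != 0].
  apply: contrapT => H; apply: ncol => u v w us vs ws; apply/eqP; apply: contraT => D.
  by case: H; exists u, v, w.
have [uv uw vw] : [/\ u != v, u != w & v != w].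
  by split; apply: contraNneq D => ->; apply/eqP; rewrite /det3; ring.
have [l [P szl]] := perm_3rest Us us vs ws uv uw vw.
pose M := mx3 u v w; have MU : M \in unitmx by rewrite mx3_unit.
have Ms x y t : perm_eq s [:: u, v, w & t] -> mximg M [:: e1, e2, e3 & mximg (invmx M) t] = [:: u, v, w & t].
  move=> _; rewrite /= mul_mx3_e1 mul_mx3_e2 mul_mx3_e3; congr [:: _, _, _ & _].
  by rewrite -/(mximg M _) -mximgM mulmxV // mximg1.
have s_l t : perm_eq s t -> pincl t s /\ pincl s t.
  by move=> Pt; split; apply: sub_pincl => x; rewrite (perm_mem Pt).
have [l_s s_l'] := s_l _ P.
case: l P szl l_s s_l' => [|x [|y [|z l]]] //= P szl l_s s_l'; last 1 first.
- by move: s5; rewrite szl !ltnS.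
- apply: (good_of_coord MU _ (Ms 0 0 _ P) l_s s_l').
  apply: fixed_good => sigma x; rewrite !inE => /or3P[]/eqP->;
  by rewrite cv3_map ?rmorph0 ?rmorph1.
- exact: (good_of_coord MU (frame_point_good _) (Ms 0 0 _ P) l_s s_l').
have [[a [b [c [as_ [bs [cs [ab [ac [bc D0]]]]]]]]]|gen] := pselect (exists a b c, a \in s /\
    b \in s /\ c \in s /\ a != b /\ a != c /\ b != c /\ det3 a b c = 0); last first.
  apply: five_general P Us _ => a b c as_ bs cs ab ac bc; apply/eqP => D0.
  by apply: gen; exists a, b, c.
have [l [Pl szl']] := perm_3rest Us as_ bs cs ab ac bc.
case: l Pl szl' => [|p [|q [|r l]]] Pl; rewrite szl //= => _.
have [p0|p0] := eqVneq (det3 a b p) 0; last exact: five_with_collinear_triple Pl Us D0 p0.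
have Pl' : perm_eq s [:: a; b; c; q; p].
  by apply: perm_trans Pl _; rewrite !perm_cons; exact/permEl/(perm_catC [:: p] [:: q]).
have [q0|] := eqVneq (det3 a b q) 0; last exact: five_with_collinear_triple Pl' Us D0.
(* With [p] and [q] also on the line through [a] and [b], all of [s] would be collinear, against
   [D]. *)
have sp z : z \in s -> exists i j, z = i *: a + j *: b.
  move=> zs; apply: det3_eq0_span (s_neq0 as_) (s_neq0 bs) (s_neq as_ bs ab) _.
  move: zs; rewrite (perm_mem Pl) !inE => /or4P[/eqP->|/eqP->|/eqP->|/orP[]/eqP->] //.
    by rewrite /det3; ring.
  by rewrite /det3; ring.
exfalso; move/eqP: D; apply.
have [i1 [j1 ->]] := sp u us; have [i2 [j2 ->]] := sp v vs; have [i3 [j3 ->]] := sp w ws.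
by rewrite /det3 !mxE; ring.
Qed.

End FivePlanePoints.

End PlaneCases.

(** * Descent and Galois stability *)

Section Points.
Variable K : fieldType.
Implicit Types (p q : P2 K) (sigma : {rmorphism K -> K}) (g : GL3 K).

Lemma val_coords p : val p = <[coords p]>%VS.
Proof.
apply/esym/eqP; rewrite eqEdim -memvE memv_pick /=.
by rewrite dim_vline coords_neq0 (eqP (valP p)).
Qed.

Lemma coords_point (v : 'cV[K]_3) (nz_v : v != 0) : coords (point nz_v) === v.
Proof.
have /vlineP[c cE] : coords (point nz_v) \in <[v]>%VS by apply: memv_pick.
exists c => //; apply: contraTneq (coords_neq0 (point nz_v)) => c0.
by rewrite cE c0 scale0r eqxx.
Qed.

Lemma coords_inj p q : coords p === coords q -> p = q.
Proof.
case=> c c0 E; apply: val_inj; rewrite !val_coords E.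
apply/eqP; rewrite eqEdim !dim_vline scaler_eq0 (negPf c0) /= leqnn andbT.
by rewrite -memvE memvZ ?memv_line.
Qed.

Lemma coords_GL3_act g p : coords (GL3_act g p) === val g *m coords p.
Proof. exact: coords_point. Qed.

Lemma coords_aut_act sigma p : coords (aut_act sigma p) === map_mx sigma (coords p).
Proof. exact: coords_point. Qed.

Lemma aut_act_inj sigma : injective (aut_act sigma).
Proof.
move=> p q E; apply: coords_inj.
apply: (proj_eq_map_inj (coords_neq0 p) (coords_neq0 q)) (_ : map_mx sigma _ === _).
apply: proj_eq_trans (proj_eq_sym (coords_aut_act sigma p)) _.
by rewrite E; apply: coords_aut_act.
Qed.

Definition ev (f : {mpoly K[3]}) (v : 'cV[K]_3) := f.@[fun i => v i 0].

Lemma ev_scale (f : {mpoly K[3]}) d (c : K) v : f \is d.-homog ->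
  ev f (c *: v) = c ^+ d * ev f v.
Proof.
move=> /dhomogP homf; rewrite /ev !mevalE mulr_sumr.
apply: eq_big_seq => m /homf /= md; rewrite mulrCA; congr (_ * _).
rewrite -md mdegE -prodrXr -big_split /=; apply: eq_bigr => i _.
by rewrite mxE exprMn.
Qed.

Lemma ev_proj_eq (f : {mpoly K[3]}) d u v : f \is d.-homog -> u === v ->
  (ev f u == 0) = (ev f v == 0).
Proof.
move=> homf [c c0 ->]; rewrite (ev_scale _ _ homf) mulf_eq0 expf_eq0.
by rewrite (negPf c0) andbF.
Qed.

Lemma ev_map sigma (f : {mpoly K[3]}) v :
  ev (map_mpoly sigma f) (map_mx sigma v) = sigma (ev f v).
Proof.
rewrite /ev !mevalE (perm_big _ (msupp_map_mpoly f (@fmorph_inj _ _ sigma))) /=.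
rewrite rmorph_sum; apply: eq_bigr => m _; rewrite mcoeff_map_mpoly rmorphM rmorph_prod.
by congr (_ * _); apply: eq_bigr => i _; rewrite mxE rmorphXn.
Qed.

Lemma map_mpoly_homog sigma (f : {mpoly K[3]}) d :
  f \is d.-homog -> map_mpoly sigma f \is d.-homog.
Proof.
move=> /dhomogP homf; apply/dhomogP => m.
by rewrite (perm_mem (msupp_map_mpoly f (@fmorph_inj _ _ sigma))) => /homf.
Qed.

Lemma in_ideal_ev (G : {mpoly K[3]} -> Prop) (f : {mpoly K[3]}) v :
  (forall h, G h -> ev h v = 0) -> in_ideal G f -> ev f v = 0.
Proof.
move=> G0 [r [rG ->]]; rewrite /ev raddf_sum /= big_seq big1 // => c cr.
by rewrite mevalM [X in _ * X](G0 _ (rG _ cr)) mulr0.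
Qed.

Lemma saturated_ev (G : {mpoly K[3]} -> Prop) (f : {mpoly K[3]}) v : v != 0 ->
  (forall h, G h -> ev h v = 0) ->
  (forall i : 'I_3, exists m : nat, in_ideal G ('X_i ^+ m * f)) -> ev f v = 0.
Proof.
move=> v0 G0 Hf; have [i vi] : exists i, v i 0 != 0.
  apply/existsP; apply: contraNT v0 => /existsPn v0.
  by apply/eqP/matrixP => i j; rewrite ord1 mxE; apply/eqP/negPn/v0.
have [m /(in_ideal_ev G0)] := Hf i.
rewrite /ev mevalM rmorphXn /= mevalXU => /eqP.
by rewrite mulf_eq0 expf_eq0 (negPf vi) andbF => /eqP.
Qed.

Section Descent.
Variables (H : {rmorphism K -> K} -> Prop) (k' : K -> Prop).
Hypothesis fixed_k' : forall x, (forall sigma, H sigma -> sigma x = x) -> k' x.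
Variable W : {mpoly K[3]} -> Prop.
Hypothesis W_sub : forall (c : K) f h, W f -> W h -> W (f - c *: h).
Hypothesis W_map : forall sigma f, H sigma -> W f -> W (map_mpoly sigma f).

Let W_scale (c : K) f : W f -> W (c *: f).
Proof.
move=> Wf; have W0 : W 0 by rewrite -(subrr f) -{2}[f]scale1r; apply: W_sub.
by rewrite -[c *: f]opprK -scaleNr -[- _]add0r; apply: W_sub.
Qed.

(* A form of W with minimal support and one coefficient equal to 1 is fixed by H. *)
Lemma fixed_form f : W f -> f != 0 -> exists h,
  [/\ W h, h != 0, forall m, k' h@_m & {subset msupp h <= msupp f}].
Proof.
have [n] := ubnP (size (msupp f)); elim: n f => // n IHn f; rewrite ltnS => szf Wf f0.
have [m0 m0f] : exists m, m \in msupp f.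
  by move: f0; rewrite -msupp_eq0; case: (msupp f) => // m l _; exists m; rewrite mem_head.
have fm0 : f@_m0 != 0 by rewrite -mcoeff_msupp.
pose h := (f@_m0)^-1 *: f.
have hE m : h@_m = (f@_m0)^-1 * f@_m by rewrite mcoeffZ.
have Wh : W h by apply: W_scale.
have hm0 : h@_m0 = 1 by rewrite hE mulVf.
have supph m : (m \in msupp h) = (m \in msupp f).
  by rewrite !mcoeff_msupp hE mulf_eq0 invr_eq0 (negPf fm0).
have [fix_h|] := pselect (forall sigma, H sigma -> map_mpoly sigma h = h).
  exists h; split=> //.
  - by rewrite scaler_eq0 invr_eq0 (negPf fm0).
  - by move=> m; apply: fixed_k' => sigma /fix_h E; rewrite -mcoeff_map_mpoly E.
  - by move=> m; rewrite supph.
move=> nfix; have [sigma Hs sh] : exists2 sigma, H sigma & map_mpoly sigma h != h.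
  apply: contrapT => nex; apply: nfix => sigma Hs; apply/eqP; apply: contraT => sh.
  by case: nex; exists sigma.
(* The coefficient 1 of [h] at [m0] cancels, so [e] has smaller support. *)
pose e := map_mpoly sigma h - 1 *: h.
have We : W e by apply: W_sub => //; apply: W_map.
have eE m : e@_m = sigma h@_m - h@_m by rewrite mcoeffB mcoeff_map_mpoly scale1r.
have suppe : {subset msupp e <= rem m0 (msupp f)}.
  move=> m; rewrite mem_rem_uniq ?msupp_uniq // inE mcoeff_msupp eE => em.
  apply/andP; split; first by apply: contraNneq em => ->; rewrite hm0 rmorph1 subrr.
  by rewrite -supph mcoeff_msupp; apply: contraNneq em => ->; rewrite rmorph0 subrr.
have [||h' [Wh' h'0 k'h' supph']] := IHn e _ We.
- apply: leq_ltn_trans (uniq_leq_size (msupp_uniq _) suppe) _.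
  rewrite size_rem // prednK //.
  by case: (msupp f) m0f.
- by rewrite /e scale1r subr_eq0.
- by exists h'; split=> // m /supph'/suppe/mem_rem.
Qed.

(** Subtracting a multiple of a fixed form supported inside the support of [f] removes a monomial
    and introduces none. *)
Lemma fixed_forms_span f : W f ->
  in_ideal (fun h => W h /\ forall m, k' h@_m) f.
Proof.
have [n] := ubnP (size (msupp f)); elim: n f => // n IHn f; rewrite ltnS => szf Wf.
have [->|f0] := eqVneq f 0; first by exists [::]; rewrite big_nil.
have [h [Wh h0 k'h supph]] := fixed_form Wf f0.
have [m0 m0h] : exists m, m \in msupp h.
  by move: h0; rewrite -msupp_eq0; case: (msupp h) => // m l _; exists m; rewrite mem_head.
have hm0 : h@_m0 != 0 by rewrite -mcoeff_msupp.
pose c := f@_m0 / h@_m0; pose e := f - c *: h.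
have suppe : {subset msupp e <= rem m0 (msupp f)}.
  move=> m; rewrite mem_rem_uniq ?msupp_uniq // inE mcoeff_msupp mcoeffB mcoeffZ => em.
  apply/andP; split; first by apply: contraNneq em => ->; rewrite divfK // subrr.
  apply: contraR em => mf; have mh : m \notin msupp h by apply: contra mf => /supph.
  by rewrite !memN_msupp_eq0 // mulr0 subrr.
have [||r [rG eE]] := IHn e.
- apply: leq_ltn_trans (uniq_leq_size (msupp_uniq _) suppe) _.
  rewrite size_rem ?supph // prednK //.
  by case: (msupp f) (supph _ m0h).
- exact: W_sub.
exists ((c%:MP, h) :: r); split.
  by move=> d; rewrite inE => /predU1P[->|/rG].
by rewrite big_cons -eE /= mul_mpolyC addrC subrK.
Qed.

End Descent.

(** The equations are all forms over [k'] vanishing on [T]. In each degree they span the forms over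
    [K] vanishing on [T], so the ideal is already saturated and the exponent 0 suffices in
    [defines_reduced]. *)
Lemma stable_descends (H : {rmorphism K -> K} -> Prop) (k' : K -> Prop)
    (S : {fset P2 K}) g (T := [fset GL3_act g p | p in S]%fset) :
  (forall x, (forall sigma, H sigma -> sigma x = x) -> k' x) ->
  (forall sigma p, H sigma -> p \in T -> aut_act sigma p \in T) ->
  descends_to k' S.
Proof.
move=> fixed_k' T_stable.
pose W d f := f \is d.-homog /\ forall p, p \in T -> vanishes_at f p.
pose G f := exists d, W d f /\ forall m, k' f@_m.
exists G, g; split=> [f [d [[homf _] k'f]]|d f homf]; first by split=> //; exists d.
(* Injective on the finite set [T], [sigma] is onto; thus a conjugated form, which vanishes at the
   images of [T], vanishes on all of [T]. *)
have T_surj sigma p : H sigma -> p \in T -> exists2 q, q \in T & p = aut_act sigma q.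
  move=> Hs pT; pose T' := [fset aut_act sigma q | q in T]%fset.
  have T'T : (T' `<=` T)%fset by apply/fsubsetP => _ /imfsetP[q /= qT ->]; apply: T_stable.
  have ET : T' = T.
    apply/eqP; rewrite eqEfcard T'T /=.
    by have /card_in_imfsetP/eqP-> : {in T &, injective (aut_act sigma)}
      by move=> x y _ _; apply: aut_act_inj.
  by move: pT; rewrite -{1}ET => /imfsetP[q /= qT ->]; exists q.
have W_sub (c : K) (e h : {mpoly K[3]}) : W d e -> W d h -> W d (e - c *: h).
  move=> [home e0] [homh h0]; split; first by rewrite rpredB ?dhomogZ.
  move=> p pT; rewrite /vanishes_at mevalB mevalZ [X in X - _](e0 p pT).
  by rewrite [X in _ * X](h0 p pT) mulr0 subrr.
have W_map sigma e : H sigma -> W d e -> W d (map_mpoly sigma e).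
  move=> Hs [home e0]; split; first exact: map_mpoly_homog.
  move=> p /(T_surj sigma _ Hs)[q qT ->]; apply/eqP.
  rewrite -[meval _ _]/(ev _ _) (ev_proj_eq (map_mpoly_homog sigma home) (coords_aut_act _ _)).
  by rewrite ev_map [ev _ _](e0 q qT) rmorph0.
split=> [sat p pT|f0 i].
  apply: saturated_ev sat; first exact: coords_neq0.
  by move=> h [e [[_ h0] _]]; apply: h0.
exists 0%N; rewrite expr0 mul1r.
have [|r [rG fE]] := fixed_forms_span fixed_k' W_sub W_map (f := f); first by split.
by exists r; split=> // c /rG[Wc k'c]; exists d.
Qed.

End Points.

Lemma five_points_descend (k K : fieldType) (iota : {rmorphism k -> K}) (S : {fset P2 K}) :
  2%N \notin [pchar k] -> separable_closure iota -> (#|` S| <= 5)%N ->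
  descends_to (field_of_moduli iota S) S.
Proof.
move=> char2 [_ sep_closed] S5.
have char2K : 2%N \notin [pchar K].
  apply: contra char2; rewrite !inE /= => /eqP K2.
  by rewrite -(fmorph_eq0 iota) rmorph_nat K2.
pose s := [seq coords p | p <- enum_fset S].
have sP u : u \in s -> exists2 p, p \in S & u = coords p.
  by case/mapP => p pS ->; exists p.
have mem_s p : p \in S -> coords p \in s by move=> pS; apply: map_f.
have [|||//|g gU Hg] := @plane_good K sep_closed char2K s.
- by move=> _ /sP[p _ ->]; apply: coords_neq0.
- by move=> _ _ /sP[p _ ->] /sP[q _ ->] pq /coords_inj E; rewrite E eqxx in pq.
- rewrite map_inj_uniq ?fset_uniq // => p q E; apply: coords_inj; rewrite E.
  exact: proj_eq_refl.
- by rewrite size_map.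
pose g' : GL3 K := exist _ g gU.
pose H sigma := galois_aut iota sigma /\
  linearly_equivalent [fset aut_act sigma p | p in S]%fset S.
apply: (@stable_descends _ H _ S g').
  by move=> x Hx sigma gal lin; apply: Hx.
move=> sigma _ [_ [h hS]] /imfsetP[p /= pS ->].
have : pincl (conjs sigma (mximg g s)) (mximg g s).
  apply: Hg; exists (val h); first exact: (valP h).
  move=> _ /mapP[_ /mapP[_ /sP[q qS ->] ->] ->].
  exists (coords (GL3_act h (aut_act sigma q))).
    by apply: mem_s; rewrite -hS; apply/in_imfset/in_imfset.
  apply: proj_eq_sym; apply: proj_eq_trans (coords_GL3_act _ _) _.
  exact/proj_eq_mul/coords_aut_act.
move=> Hs; have [_ /mapP[_ /sP[q qS ->] ->] E] := Hs (map_mx sigma (g *m coords p))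
  (map_f _ (map_f _ (mem_s p pS))).
suff -> : aut_act sigma (GL3_act g' p) = GL3_act g' q by apply: in_imfset.
apply: coords_inj; apply: proj_eq_trans (coords_aut_act _ _) _.
apply: proj_eq_trans (proj_eq_map _ (coords_GL3_act _ _)) _.
exact: proj_eq_trans E (proj_eq_sym (coords_GL3_act g' q)).
Qed.

Import Order.TTheory Num.Theory.

(** * Sets with real field of moduli and no real model *)

Section Proportional.
Variable K : fieldType.

(** The matrix [invmx h *m g] has three pairwise independent eigenvectors in a plane, so it is
    scalar. *)
Lemma proportional_of_proj_eq (g h : 'M[K]_2) (u v w : 'cV[K]_2) : h \in unitmx ->
  br u v != 0 -> br u w != 0 -> br v w != 0 ->
  g *m u === h *m u -> g *m v === h *m v -> g *m w === h *m w ->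
  exists2 c : K, c != 0 & g = c *: h.
Proof.
move=> hU uv uw vw gu gv gw; pose k := invmx h *m g.
have kE (x : 'cV[K]_2) : g *m x === h *m x -> exists2 c : K, c != 0 & k *m x = c *: x.
  by case=> c c0 E; exists c => //; rewrite -mulmxA E -scalemxAr mulKmx.
have [a _ ku] := kE u gu; have [b _ kv] := kE v gv; have [c c0 kw] := kE w gw.
have brl (x : K) (y z : 'cV[K]_2) : br (x *: y) z = x * br y z.
  by rewrite /br !mxE; ring.
have brr (x : K) (y z : 'cV[K]_2) : br y (x *: z) = x * br y z.
  by rewrite /br !mxE; ring.
have P := plucker u v w.
have wv : br w v != 0 by rewrite br_anti oppr_eq0.
have ca : c = a.
  have : c * (br u v * br w v) = a * (br w v * br u v).
    transitivity (br (k *m (br u v *: w)) v).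
      by rewrite -scalemxAr kw !brl; ring.
    rewrite P mulmxDr -!scalemxAr ku kv /br !mxE; ring.
  by rewrite [X in c * X]mulrC; apply: mulIf; rewrite mulf_neq0.
have cb : c = b.
  have : c * (br u v * br u w) = b * (br u w * br u v).
    transitivity (br u (k *m (br u v *: w))).
      by rewrite -scalemxAr kw !brr; ring.
    rewrite P mulmxDr -!scalemxAr ku kv /br !mxE; ring.
  by rewrite [X in c * X]mulrC; apply: mulIf; rewrite mulf_neq0.
have MU : mx2 u v \in unitmx by rewrite mx2_unit.
have kc : k = c%:M.
  have : k *m mx2 u v = c%:M *m mx2 u v.
    apply/matrixP => i j; rewrite mul_scalar_mx [RHS]mxE !mxE.
    have Eu : (k *m u) i 0 = c * u i 0 by rewrite ku -ca mxE.
    have Ev : (k *m v) i 0 = c * v i 0 by rewrite kv -cb mxE.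
    case: ifP => j0; [rewrite -Eu mxE | rewrite -Ev mxE]; apply: eq_bigr => l _;
    by rewrite ?mxE ?j0.
  by move/(congr1 (mulmx^~ (invmx (mx2 u v)))); rewrite !mulmxK.
by exists c => //; rewrite -(mulKVmx hU g) -/k kc mul_mx_scalar.
Qed.

End Proportional.

(** * A cross ratio that detects real points *)

Section RealCrossRatio.
Variable R : realType.
Local Notation C := R[i].
Local Open Scope complex_scope.

Definition real_pt (p q : R) : 'cV[C]_2 := cv2 (p +i* 0) (q +i* 0).
Definition w1 : 'cV[C]_2 := cv2 (0 +i* 2%:R) (1 +i* 0).
Definition w2 : 'cV[C]_2 := cv2 (0 +i* -1) (2%:R +i* 0).

Lemma br_real p q p' q' : br (real_pt p q) (real_pt p' q') = (p * q' - q * p') +i* 0.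
Proof. by apply/eqP; rewrite eq_complex /br !mxE /=; apply/andP; split; apply/eqP; ring. Qed.
Lemma br_w1_real p q : br w1 (real_pt p q) = (- p) +i* (2%:R * q).
Proof. by apply/eqP; rewrite eq_complex /br !mxE /=; apply/andP; split; apply/eqP; ring. Qed.
Lemma br_w2_real p q : br w2 (real_pt p q) = (- (2%:R * p)) +i* (- q).
Proof. by apply/eqP; rewrite eq_complex /br !mxE /=; apply/andP; split; apply/eqP; ring. Qed.
Lemma br_real_w1 p q : br (real_pt p q) w1 = p +i* (- (2%:R * q)).
Proof. by apply/eqP; rewrite eq_complex /br !mxE /=; apply/andP; split; apply/eqP; ring. Qed.
Lemma br_real_w2 p q : br (real_pt p q) w2 = (2%:R * p) +i* q.
Proof. by apply/eqP; rewrite eq_complex /br !mxE /=; apply/andP; split; apply/eqP; ring. Qed.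
Lemma br_w1_w2 : br w1 w2 = 0 +i* 5%:R.
Proof. by apply/eqP; rewrite eq_complex /br !mxE /=; apply/andP; split; apply/eqP; ring. Qed.
Lemma br_w2_w1 : br w2 w1 = 0 +i* (- 5%:R).
Proof. by apply/eqP; rewrite eq_complex /br !mxE /=; apply/andP; split; apply/eqP; ring. Qed.

Definition brE := (br_real, br_w1_real, br_w2_real, br_real_w1, br_real_w2,
  br_w1_w2, br_w2_w1).

Definition mixed (v : 'cV[C]_2) := [\/ exists p q, v = real_pt p q, v = w1 | v = w2].

(* The cross ratio is -1/49, that of 2, -1/2, 3, -1/3, without denominators. *)
Definition cr49 (b1 b2 b3 b4 : 'cV[C]_2) :=
  49%:R * (br b1 b3 * br b2 b4) + br b1 b4 * br b2 b3 = 0.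

(** A real cross ratio puts four points on a circle, so a nonreal [b1] excludes three real
    companions. If both [w1] and [w2] occur, a circle is possible and the value -1/49 matters: the
    real part of the relation gives [p p' + q q' = 0], the imaginary part a relation between [p q']
    and [p' q] with positive coefficients. *)
Lemma cr49_real (b1 b2 b3 b4 : 'cV[C]_2) :
  mixed b1 -> mixed b2 -> mixed b3 -> mixed b4 ->
  pairwise (fun u v => br u v != 0) [:: b1; b2; b3; b4] ->
  cr49 b1 b2 b3 b4 -> exists p q, b1 = real_pt p q.
Proof.
have c49 : 49%:R = 49%:R +i* 0 :> C by rewrite -(rmorph_nat (real_complex R)).
(* The two relations make a sum of squares with positive weights vanish. *)
have key (al be p q p' q' : R) : 0 < al -> 0 < be -> p * q' - q * p' != 0 ->
    p * p' + q * q' = 0 -> al * (p * q') = be * (p' * q) -> False.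
  move=> al0 be0 D E1 E2.
  have E3 : al * (p * q') ^+ 2 + be * (p * p') ^+ 2 = 0.
    transitivity ((al * (p * q')) * (p * q') + be * (p * p') ^+ 2); first by ring.
    rewrite E2; transitivity (be * (p * p') * (p * p' + q * q')); first by ring.
    by rewrite E1 mulr0.
  have E4 : p * q' = 0.
    apply/eqP; rewrite -sqrf_eq0; apply/eqP/(mulfI (lt0r_neq0 al0)).
    have := mulr_ge0 (ltW al0) (sqr_ge0 (p * q')).
    have := mulr_ge0 (ltW be0) (sqr_ge0 (p * p')); lra.
  have E5 : p' * q = 0 by apply: (mulfI (lt0r_neq0 be0)); rewrite -E2 E4 !mulr0.
  by move/eqP: D; apply; rewrite E4 mulrC E5 subrr.
have one (s p2 q2 p3 q3 p4 q4 : R) : s != 0 -> p2 * q4 - q2 * p4 != 0 -> p3 * q4 - q3 * p4 != 0 ->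
    s * (49%:R * p3 * (p2 * q4 - q2 * p4) + p4 * (p2 * q3 - q2 * p3)) = 0 ->
    49%:R * q3 * (p2 * q4 - q2 * p4) + q4 * (p2 * q3 - q2 * p3) = 0 -> False.
  move=> s0 D24 D34 /eqP; rewrite mulf_eq0 (negPf s0) /= => /eqP E1 E2.
  have : 49%:R * ((p2 * q4 - q2 * p4) * (p3 * q4 - q3 * p4)) = 0.
    transitivity ((49%:R * p3 * (p2 * q4 - q2 * p4) + p4 * (p2 * q3 - q2 * p3)) * q4 -
      (49%:R * q3 * (p2 * q4 - q2 * p4) + q4 * (p2 * q3 - q2 * p3)) * p4); first by ring.
    by rewrite E1 E2 !mul0r subrr.
  by move/eqP; rewrite !mulf_eq0 (negPf D24) (negPf D34) pnatr_eq0.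
move=> m1 m2 m3 m4; rewrite /= !andbT => /andP[/and3P[d12 d13 d14] /andP[/andP[d23 d24] d34]].
have rneq (x : R) : x +i* 0 != 0 -> x != 0 by apply: contraNneq => ->.
have two0 : 2%:R != 0 :> R by rewrite pnatr_eq0.
have brw1 : br w1 w1 = 0 by rewrite /br mulrC subrr.
have brw2 : br w2 w2 = 0 by rewrite /br mulrC subrr.
rewrite /cr49 c49 => E; case: m1 => [//|E1|E1]; exfalso; subst b1;
case: m2 => [[p2 [q2 E2]]|E2|E2]; subst b2; rewrite ?brw1 ?brw2 ?eqxx // in d12;
case: m3 => [[p3 [q3 E3]]|E3|E3]; subst b3; rewrite ?brw1 ?brw2 ?eqxx // in d13 d23;
case: m4 => [[p4 [q4 E4]]|E4|E4]; subst b4; rewrite ?brw1 ?brw2 ?eqxx // in d14 d24 d34;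
rewrite !brE in d23 d24 d34 E; move/eqP: E; rewrite eq_complex /= => /andP[/eqP ER /eqP EI].
- apply: (one 1 p2 q2 p3 q3 p4 q4); rewrite ?oner_neq0 //; [exact: rneq | exact: rneq | lra | lra].
(* The numbers are the coefficients of the imaginary part, here 49 * 4 + 5 and 49 + 5, where 5 comes
   from [br w1 w2]. *)
- apply: (key 201%:R 54%:R p2 q2 p3 q3); rewrite ?ltr0n //; [exact: rneq | lra | lra].
- apply: (key 249%:R 246%:R p2 q2 p4 q4); rewrite ?ltr0n //; [exact: rneq | lra | lra].
- apply: (key 45%:R 195%:R p3 q3 p4 q4); rewrite ?ltr0n //; [exact: rneq | lra | lra].
- apply: (one 2%:R p2 q2 p3 q3 p4 q4) => //; [exact: rneq | exact: rneq | lra | lra].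
- apply: (key 54%:R 201%:R p2 q2 p3 q3); rewrite ?ltr0n //; [exact: rneq | lra | lra].
- apply: (key 246%:R 249%:R p2 q2 p4 q4); rewrite ?ltr0n //; [exact: rneq | lra | lra].
- apply: (key 195%:R 45%:R p3 q3 p4 q4); rewrite ?ltr0n //; [exact: rneq | lra | lra].
Qed.

End RealCrossRatio.

(** * The antipodal configuration on a line *)

Section AntipodalPoints.
Variable R : realType.
Local Notation C := R[i].
Local Open Scope complex_scope.
Local Notation cj := (@conjc R : {rmorphism C -> C}).
Local Notation real_pt := (@real_pt R).
Local Notation w1 := (@w1 R).
Local Notation w2 := (@w2 R).

(* Stable under the antipodal map z |-> -1/conj z, where (x, y) stands for z = x/y. *)
Definition antipodal_pts (m : nat) : seq 'cV[C]_2 :=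
  [seq real_pt k%:R 1 | k <- iota 2 m] ++ [seq real_pt (-1) k%:R | k <- iota 2 m] ++
  [:: w1; w2].

Lemma size_antipodal_pts m : size (antipodal_pts m) = (m.+1).*2.
Proof. by rewrite !size_cat !size_map !size_iota /= addnA addnn addn2 doubleS. Qed.

Lemma mem_antipodal_pts m v : v \in antipodal_pts m ->
  (exists2 k, (2 <= k)%N /\ k \in iota 2 m & v = real_pt k%:R 1 \/ v = real_pt (-1) k%:R) \/
  v = w1 \/ v = w2.
Proof.
rewrite !mem_cat => /or3P[/mapP[k kI ->]|/mapP[k kI ->]|].
- by left; exists k; [split=> //; move: kI; rewrite mem_iota => /andP[] | left].
- by left; exists k; [split=> //; move: kI; rewrite mem_iota => /andP[] | right].
- by rewrite !inE => /orP[]/eqP->; right; [left | right].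
Qed.

Lemma antipodal_pts_real m k : k \in iota 2 m ->
  real_pt k%:R 1 \in antipodal_pts m /\ real_pt (-1) k%:R \in antipodal_pts m.
Proof.
by move=> kI; split; rewrite !mem_cat; apply/or3P; [constructor 1 | constructor 2];
  apply/mapP; exists k.
Qed.

Lemma antipodal_pts_w m : w1 \in antipodal_pts m /\ w2 \in antipodal_pts m.
Proof. by rewrite !mem_cat !inE !eqxx !orbT. Qed.

Lemma antipodal_pts_mixed m v : v \in antipodal_pts m -> mixed v.
Proof.
case/mem_antipodal_pts => [[k _ [->|->]]|[->|->]].
- by constructor 1; exists k%:R, 1.
- by constructor 1; exists (-1), k%:R.
- by constructor 2.
- by constructor 3.
Qed.

Lemma complex_neq0 (x y : R) : (x +i* y != 0) = (x != 0) || (y != 0).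
Proof. by rewrite eq_complex /= negb_and. Qed.

Lemma antipodal_pts_distinct m : pairwise (fun u v => br u v != 0) (antipodal_pts m).
Proof.
have pos k : k \in iota 2 m -> 0 < k%:R :> R.
  by rewrite mem_iota ltr0n => /andP[/ltnW].
rewrite /antipodal_pts !pairwise_cat !pairwise_map !allrel_catr; apply/and4P; split.
- apply/andP; split; apply/allrelP => _ y /mapP[k kI ->].
    case/mapP => l lI ->; rewrite br_real complex_neq0 mulrN1 opprK.
    by rewrite gt_eqF // addr_gt0 ?mulr_gt0 ?pos.
  rewrite !inE => /orP[]/eqP->; rewrite !brE complex_neq0.
    by rewrite gt_eqF ?pos.
  by rewrite oner_neq0 orbT.
- have := iota_uniq 2 m; rewrite uniq_pairwise; apply: sub_pairwise => k l kl.
  by rewrite /= br_real complex_neq0 mulr1 mul1r subr_eq0 eqr_nat [k != l]kl.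
- apply/allrelP => _ y /mapP[k kI ->]; rewrite !inE => /orP[]/eqP->;
  rewrite !brE complex_neq0.
    by rewrite oppr_eq0 oner_neq0.
  by rewrite (gt_eqF (pos k kI)) orbT.
apply/andP; split.
  have := iota_uniq 2 m; rewrite uniq_pairwise; apply: sub_pairwise => k l kl.
  by rewrite /= br_real complex_neq0 mulN1r mulrN1 opprK addrC subr_eq0 eqr_nat [k != l]kl.
by rewrite /= br_w1_w2 complex_neq0 pnatr_eq0 orbT.
Qed.

Lemma conj_mxK n1 n2 (A : 'M[C]_(n1, n2)) : map_mx cj (map_mx cj A) = A.
Proof. by apply/matrixP => i j; rewrite !mxE; apply: conjcK. Qed.

Lemma conj_real_pt p q : map_mx cj (real_pt p q) = real_pt p q.
Proof. by apply: eq_cv2; rewrite !mxE /=; apply/eqP; rewrite eq_complex /= oppr0 !eqxx. Qed.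

Lemma conj_w1 : map_mx cj w1 = cv2 (0 +i* - 2%:R) (1 +i* 0).
Proof. by apply: eq_cv2; rewrite !mxE /=; apply/eqP; rewrite eq_complex /= ?oppr0 !eqxx. Qed.

Lemma conj_w2 : map_mx cj w2 = cv2 (0 +i* 1) (2%:R +i* 0).
Proof. by apply: eq_cv2; rewrite !mxE /=; apply/eqP; rewrite eq_complex /= ?oppr0 ?opprK !eqxx. Qed.

(** The map z -> -1/z, so conjugation followed by it is the antipodal map. Its square is -1, the
    sign responsible for the missing real structure. *)
Definition quarter_turn : 'M[C]_2 := mx2 (cv2 0 1) (cv2 (-1) 0).

Lemma mul_quarter_turn v : quarter_turn *m v = cv2 (- v 1 0) (v 0 0).
Proof. by apply: eq_cv2; rewrite mul_mx2 !mxE /=; ring. Qed.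

Lemma quarter_turn_unit : quarter_turn \in unitmx.
Proof. by rewrite mx2_unit /br !cv2E mul0r sub0r mulrN1 opprK oner_neq0. Qed.

Lemma antipodal_pts_conj m :
  pincl (mximg quarter_turn (conjs cj (antipodal_pts m))) (antipodal_pts m).
Proof.
have [w1L w2L] := antipodal_pts_w m.
have N1 : (-1 : C) != 0 by rewrite oppr_eq0 oner_neq0.
have i0 (x : R) : x != 0 -> 0 +i* x != 0 by rewrite complex_neq0 orbC => ->.
move=> _ /mapP[_ /mapP[v vL ->] ->].
case/mem_antipodal_pts: vL => [[k [_ /antipodal_pts_real[k1 k2]]]|].
  case=> ->; rewrite conj_real_pt mul_quarter_turn /real_pt !cv2E.
    exists (real_pt (-1) k%:R) => //; rewrite (_ : - (1 +i* 0) = (-1) +i* 0).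
      exact: proj_eq_refl.
    by apply/eqP; rewrite eq_complex /= oppr0 !eqxx.
  exists (real_pt k%:R 1) => //; exists (-1) => //.
  by apply: eq_cv2; rewrite !mxE /=; apply/eqP; rewrite eq_complex /=;
     apply/andP; split; apply/eqP; ring.
case=> ->; rewrite ?conj_w1 ?conj_w2 mul_quarter_turn !cv2E.
  exists w2 => //; exists (0 +i* -1); first by rewrite i0 ?oppr_eq0 ?oner_neq0.
  by apply: eq_cv2; rewrite !mxE /=; apply/eqP; rewrite eq_complex /=;
     apply/andP; split; apply/eqP; ring.
exists w1 => //; exists (0 +i* 1); first by rewrite i0 ?oner_neq0.
by apply: eq_cv2; rewrite !mxE /=; apply/eqP; rewrite eq_complex /=;
   apply/andP; split; apply/eqP; ring.
Qed.

Lemma br_w_conj : [/\ br w1 (map_mx cj w1) != 0, br w2 (map_mx cj w2) != 0,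
  br w1 (map_mx cj w2) != 0 & br (map_mx cj w1) (map_mx cj w2) != 0].
Proof.
rewrite conj_w1 conj_w2 /br !cv2E !eq_complex /= !negb_and; split; apply/orP; right;
by apply/eqP; lra.
Qed.

(** The real map underlying [h] must carry the conjugates of [w1] and [w2] to [w1] and [w2] in some
    order, which leaves z -> -z and z -> -1/z. The first moves 2 out of the set; the second has
    [h *m map_mx cj h] negative. *)
Lemma antipodal_pts_no_real_structure m (h : 'M[C]_2) : (2 <= m)%N ->
  h *m map_mx cj h = 1%:M ->
  pincl (mximg h (conjs cj (antipodal_pts m))) (antipodal_pts m) -> False.
Proof.
move=> m2 hh hL; set L := antipodal_pts m in hL.
have hU : h \in unitmx by have [] := mulmx1_unit hh.
have [i2 i3] : 2 \in iota 2 m /\ 3 \in iota 2 m by rewrite !mem_iota; split; lia.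
have [a1L a2L] := antipodal_pts_real i2; have [a3L a4L] := antipodal_pts_real i3.
pose a1 := real_pt 2%:R 1; pose a2 := real_pt (-1) 2%:R.
pose a3 := real_pt 3%:R 1; pose a4 := real_pt (-1) 3%:R.
have hE v : v \in L -> exists2 y, y \in L & h *m map_mx cj v === y.
  by move=> vL; apply: hL; do 2!apply: map_f.
have [b1 b1L E1] := hE _ a1L; have [b2 b2L E2] := hE _ a2L.
have [b3 b3L E3] := hE _ a3L; have [b4 b4L E4] := hE _ a4L.
rewrite !conj_real_pt -/a1 -/a2 -/a3 -/a4 in E1 E2 E3 E4.
have neq (x y : R) : x != 0 -> x +i* y != 0 by rewrite complex_neq0 => ->.
have [d12 d13 d14] : [/\ br a1 a2 != 0, br a1 a3 != 0 & br a1 a4 != 0].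
  by split; rewrite br_real neq //; apply/eqP; lra.
have [d23 d24 d34] : [/\ br a2 a3 != 0, br a2 a4 != 0 & br a3 a4 != 0].
  by split; rewrite br_real neq //; apply/eqP; lra.
have brb (x y x' y' : 'cV[C]_2) : h *m x === x' -> h *m y === y' -> br x y != 0 ->
    br x' y' != 0.
  move=> hx hy xy; apply: br_neq0_proj_eq (proj_eq_sym hx) (proj_eq_sym hy) _.
  by rewrite br_mul mulf_neq0 // -unitfE -unitmxE.
have c49 : 49%:R = 49%:R +i* 0 :> C by rewrite -(rmorph_nat (real_complex R)).
have cr_a : cr49 a1 a2 a3 a4.
  rewrite /cr49 !br_real c49; apply/eqP; rewrite eq_complex /=.
  by apply/andP; split; apply/eqP; ring.
have cr_b : cr49 b1 b2 b3 b4.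
  have [c1 _ ->] := proj_eq_sym E1; have [c2 _ ->] := proj_eq_sym E2.
  have [c3 _ ->] := proj_eq_sym E3; have [c4 _ ->] := proj_eq_sym E4.
  rewrite /cr49 !br_scale !br_mul; transitivity (c1 * c2 * c3 * c4 * \det h ^+ 2 *
    (49%:R * (br a1 a3 * br a2 a4) + br a1 a4 * br a2 a3)); first by ring.
  by rewrite cr_a mulr0.
have [e12 e13 e14] := And3 (brb _ _ _ _ E1 E2 d12) (brb _ _ _ _ E1 E3 d13) (brb _ _ _ _ E1 E4 d14).
have [e23 e24 e34] := And3 (brb _ _ _ _ E2 E3 d23) (brb _ _ _ _ E2 E4 d24) (brb _ _ _ _ E3 E4 d34).
have anti (u v : 'cV[C]_2) : br u v != 0 -> br v u != 0 by rewrite br_anti oppr_eq0.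
have [m1 m2' m3 m4] := And4 (antipodal_pts_mixed b1L) (antipodal_pts_mixed b2L)
  (antipodal_pts_mixed b3L) (antipodal_pts_mixed b4L).
have cj_real v : (exists p q, v = real_pt p q) -> map_mx cj v = v.
  by case=> p [q ->]; apply: conj_real_pt.
(* The relation [cr49] is invariant under double transpositions, so each image can be brought to the
   first place, the one [cr49_real] speaks about. *)
have r1 : map_mx cj b1 = b1.
  apply/cj_real/(cr49_real m1 m2' m3 m4 _ cr_b).
  by rewrite /= e12 e13 e14 e23 e24 e34.
have r2 : map_mx cj b2 = b2.
  apply/cj_real/(cr49_real m2' m1 m4 m3 _ _).
    by rewrite /= (anti _ _ e12) e13 e14 e23 e24 (anti _ _ e34).
  by rewrite /cr49 [br b2 b4 * _]mulrC [br b2 b3 * _]mulrC.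
have r3 : map_mx cj b3 = b3.
  apply/cj_real/(cr49_real m3 m4 m1 m2' _ _).
    by rewrite /= !(anti _ _ e13, anti _ _ e14, anti _ _ e23, anti _ _ e24) e12 e34.
  rewrite /cr49 -[RHS]cr_b (br_anti b1 b3) (br_anti b2 b4) (br_anti b2 b3) (br_anti b1 b4); ring.
have hcj (x y : 'cV[C]_2) : h *m map_mx cj x === y -> map_mx cj h *m x === map_mx cj y.
  move=> /(proj_eq_map cj); by rewrite map_mxM conj_mxK.
have hba (a b : 'cV[C]_2) : map_mx cj a = a -> map_mx cj b = b -> h *m a === b -> h *m b === a.
  move=> ra rb; rewrite -{1}ra => /hcj; rewrite rb => /(proj_eq_mul h).
  by rewrite mulmxA hh mul1mx => /proj_eq_sym.
have [ra1 ra2 ra3] : [/\ map_mx cj a1 = a1, map_mx cj a2 = a2 & map_mx cj a3 = a3].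
  by split; apply: conj_real_pt.
(* Conjugating shows that [h] exchanges each real point with its real image, so [h *m h] agrees with
   the identity at three points. Together with [hh] this makes [h] proportional to its conjugate. *)
have [l l0 hhl] : exists2 l : C, l != 0 & h *m h = l *: 1%:M.
  have sq (a b : 'cV[C]_2) : map_mx cj a = a -> map_mx cj b = b -> h *m a === b ->
      (h *m h) *m a === 1%:M *m a.
    move=> ra rb hab; rewrite -mulmxA mul1mx; apply: proj_eq_trans (proj_eq_mul h hab) _.
    exact: hba.
  exact: (proportional_of_proj_eq (unitmx1 _ _) d12 d13 d23 (sq _ _ ra1 r1 E1)
    (sq _ _ ra2 r2 E2) (sq _ _ ra3 r3 E3)).
have hcE : map_mx cj h = l^-1 *: h.
  apply: (can_inj (mulKmx hU)); rewrite hh -scalemxAr hhl scalerA mulVf // scale1r.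
  by [].
have h_real (x y : 'cV[C]_2) : h *m map_mx cj x === y -> h *m x === map_mx cj y.
  move/hcj; rewrite hcE -scalemxAl; apply: proj_eq_trans.
  by apply/proj_eq_sym/proj_eq_scale; rewrite invr_eq0.
have [n1 n2 n12 n3] := br_w_conj.
have [w1L w2L] := antipodal_pts_w m.
have [y1 y1L Y1] := hE _ w1L; have [y2 y2L Y2] := hE _ w2L.
have Y1' := h_real _ _ Y1; have Y2' := h_real _ _ Y2.
(* A real image would also be the image of the conjugate point, against injectivity. *)
have y1w : y1 = w1 \/ y1 = w2.
  case: (antipodal_pts_mixed y1L) => [/cj_real r|->|->]; [|by left|by right].
  have E : h *m map_mx cj w1 === h *m w1 by apply: proj_eq_trans Y1 _; rewrite -r; apply: proj_eq_sym.
  by have := n1; rewrite br_anti (br_proj_eq (proj_eq_mul_inj hU E)) oppr0 eqxx.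
have y2w : y2 = w1 \/ y2 = w2.
  case: (antipodal_pts_mixed y2L) => [/cj_real r|->|->]; [|by left|by right].
  have E : h *m map_mx cj w2 === h *m w2 by apply: proj_eq_trans Y2 _; rewrite -r; apply: proj_eq_sym.
  by have := n2; rewrite br_anti (br_proj_eq (proj_eq_mul_inj hU E)) oppr0 eqxx.
have y12 : y1 <> y2.
  move=> y12; have E : h *m map_mx cj w1 === h *m map_mx cj w2.
    by apply: proj_eq_trans Y1 _; rewrite y12; apply: proj_eq_sym.
  by have := n3; rewrite (br_proj_eq (proj_eq_mul_inj hU E)) eqxx.
have agree (D : 'M[C]_2) z1 z2 : D \in unitmx -> h *m map_mx cj w1 === z1 ->
    h *m map_mx cj w2 === z2 -> D *m map_mx cj w1 === z1 -> D *m map_mx cj w2 === z2 ->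
    D *m w1 === map_mx cj z1 -> exists2 c : C, c != 0 & h = c *: D.
  move=> DU hz1 hz2 Dz1 Dz2 Dw1.
  apply: (proportional_of_proj_eq DU n3 (anti _ _ n1) (anti _ _ n12)).
  - exact: proj_eq_trans hz1 (proj_eq_sym Dz1).
  - exact: proj_eq_trans hz2 (proj_eq_sym Dz2).
  - exact: proj_eq_trans (h_real _ _ hz1) (proj_eq_sym Dw1).
have N1 : (-1 : C) != 0 by rewrite oppr_eq0 oner_neq0.
have ci (x : R) : x != 0 -> 0 +i* x != 0 by rewrite complex_neq0 orbC => ->.
case: y1w => y1E; case: y2w => y2E; rewrite y1E y2E // in y12 Y1 Y2.
(* The map z -> -z. *)
- pose D : 'M[C]_2 := mx2 (cv2 1 0) (cv2 0 (-1)).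
  have DE (v : 'cV[C]_2) : D *m v = cv2 (v 0 0) (- v 1 0).
    by apply: eq_cv2; rewrite mul_mx2 !mxE /=; ring.
  have DU : D \in unitmx by rewrite mx2_unit /br !cv2E mulr0 subr0 mul1r.
  have [c c0 hD] : exists2 c : C, c != 0 & h = c *: D.
    apply: (agree _ _ _ DU Y1 Y2); rewrite DE ?conj_w1 ?conj_w2; exists (-1) => //;
    by apply: eq_cv2; rewrite !mxE /=; apply/eqP; rewrite eq_complex /=;
       apply/andP; split; apply/eqP; ring.
  (* The point 2 would go to -2, but the real points of the set are [k] and [-1/k] with [k] at least
     2. *)
  have E : real_pt 2%:R (-1) === b1.
    apply: proj_eq_trans E1; rewrite hD -scalemxAl DE.
    apply: proj_eq_trans (proj_eq_sym (proj_eq_scale _ c0)).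
    rewrite (_ : cv2 _ _ = real_pt 2%:R (-1)); first exact: proj_eq_refl.
    by apply: eq_cv2; rewrite !mxE //=; apply/eqP; rewrite eq_complex /= oppr0 !eqxx.
  have := br_proj_eq E.
  case/mem_antipodal_pts: b1L => [[k [k2 _]]|]; last by case=> ->; rewrite brE => -[]; lra.
  have k2' : 2%:R <= k%:R :> R by rewrite ler_nat.
  by case=> ->; rewrite br_real => -[]; lra.
(* The map z -> -1/z; its matrix is real with square -1. *)
pose D : 'M[C]_2 := mx2 (cv2 0 (-1)) (cv2 1 0).
have DE (v : 'cV[C]_2) : D *m v = cv2 (v 1 0) (- v 0 0).
  by apply: eq_cv2; rewrite mul_mx2 !mxE /=; ring.
have DU : D \in unitmx by rewrite mx2_unit /br !cv2E mulr0 mulN1r opprK add0r oner_neq0.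
have [c c0 hD] : exists2 c : C, c != 0 & h = c *: D.
  apply: (agree _ _ _ DU Y1 Y2); rewrite DE ?conj_w1 ?conj_w2.
  - exists (0 +i* 1); first by rewrite ci ?oner_neq0.
    by apply: eq_cv2; rewrite !mxE /=; apply/eqP; rewrite eq_complex /=;
       apply/andP; split; apply/eqP; ring.
  - exists (0 +i* -1); first by rewrite ci ?oppr_eq0 ?oner_neq0.
    by apply: eq_cv2; rewrite !mxE /=; apply/eqP; rewrite eq_complex /=;
       apply/andP; split; apply/eqP; ring.
  - exists (0 +i* -1); first by rewrite ci ?oppr_eq0 ?oner_neq0.
    by apply: eq_cv2; rewrite !mxE /=; apply/eqP; rewrite eq_complex /=;
       apply/andP; split; apply/eqP; ring.
have : (h *m map_mx cj h *m cv2 1 0) 0 0 = - (c * c^*).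
  rewrite hD map_mxZ -scalemxAl -scalemxAr scalerA -scalemxAl -mulmxA.
  have -> : map_mx cj D = D.
    apply/matrixP => i j; rewrite !mxE; do 2!case: ifP => _;
    by rewrite ?rmorphN ?rmorph0 ?rmorph1.
  by rewrite !DE !cv2E mxE cv2E mulrN1.
rewrite hh mul1mx cv2E => E.
have := mulcJ_ge0 c; rewrite -[c * _]opprK -E oppr_ge0.
by rewrite ler10.
Qed.

End AntipodalPoints.

(** * Galois stability of the points of a descended scheme *)

Section StabilityOfDescent.
Variable K : fieldType.
Implicit Types (p q : P2 K) (sigma : {rmorphism K -> K}) (g : GL3 K).

Lemma separating_line (u v : 'cV[K]_3) : u != 0 -> v != 0 -> ~ u === v ->
  exists2 l : {mpoly K[3]}, l \is 1.-homog & ev l u = 0 /\ ev l v != 0.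
Proof.
move=> u0 v0 uv.
have [i [j ij]] : exists i j, u i 0 * v j 0 != u j 0 * v i 0.
  apply: contrapT => H; apply: uv; apply: proj_eq_minors => // i j.
  by apply/eqP; apply: contraT => ij; case: H; exists i, j.
have evE w : ev (u i 0 *: 'X_j - u j 0 *: 'X_i) w = u i 0 * w j 0 - u j 0 * w i 0.
  by rewrite /ev mevalB !mevalZ !mevalXU.
exists (u i 0 *: 'X_j - u j 0 *: 'X_i).
  have X1 k : ('X_k : {mpoly K[3]}) \is 1.-homog by rewrite dhomogX /= mdeg1.
  by rewrite rpredB ?dhomogZ.
by rewrite !evE mulrC subrr subr_eq0.
Qed.

(** A product of lines, one through each point of [T] and none through [v]. *)
Lemma separating_form (T : seq (P2 K)) (v : 'cV[K]_3) : v != 0 ->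
  (forall p, p \in T -> ~ coords p === v) ->
  exists d (f : {mpoly K[3]}), [/\ f \is d.-homog,
    forall p, p \in T -> vanishes_at f p & ev f v != 0].
Proof.
move=> v0; elim: T => [_|p T IHT HT].
  by exists 0%N, 1; split=> //; rewrite ?dhomog1 // /ev meval1 oner_neq0.
have [|d [f [homf f0 fv]]] := IHT; first by move=> q qT; apply: HT; rewrite inE qT orbT.
have [l homl [lp lv]] := separating_line (coords_neq0 p) v0 (HT p (mem_head _ _)).
exists (1 + d)%N, (l * f); split; first exact: dhomogM.
  move=> q; rewrite /vanishes_at mevalM inE => /predU1P[->|/f0 fq].
    by rewrite [X in X * _](lp) mul0r.
  by rewrite [X in _ * X]fq mulr0.
by rewrite /ev mevalM mulf_neq0.
Qed.

(** The equations have coefficients fixed by [sigma], so they vanish at the conjugate point as well.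
    Were it outside [T], a form vanishing on [T] but not there would lie in the saturated ideal of
    these equations, a contradiction. *)
Lemma descends_stable (k' : K -> Prop) sigma (G : {mpoly K[3]} -> Prop) (T : {fset P2 K}) :
  (forall x, k' x -> sigma x = x) -> equations_over k' G -> defines_reduced G T ->
  forall p, p \in T -> aut_act sigma p \in T.
Proof.
move=> k'fix GE GT p pT; apply: contraT => npT.
have [q qT Eq|d [f [homf fT fp]]] := separating_form (T := enum_fset T)
    (coords_neq0 (aut_act sigma p)).
  by move: npT; rewrite -(coords_inj Eq) qT.
have G0 h : G h -> ev h (coords (aut_act sigma p)) = 0.
  move=> Gh; have [[e homh] k'h] := GE h Gh.
  have hp : ev h (coords p) = 0.
    apply: (iffLR (GT e h homh)) pT => i; exists 0%N; rewrite expr0 mul1r.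
    exists [:: (1, h)]; split; first by move=> c; rewrite inE => /eqP->.
    by rewrite big_seq1 mul1r.
  apply/eqP; rewrite (ev_proj_eq homh (coords_aut_act sigma p)).
  have hE : map_mpoly sigma h = h.
    by apply/mpolyP => m; rewrite mcoeff_map_mpoly; apply: k'fix (k'h m).
  by rewrite -{1}hE ev_map hp rmorph0.
have /eqP := saturated_ev (coords_neq0 _) G0 (iffRL (GT d f homf) fT).
by rewrite (negPf fp).
Qed.

Lemma ublk_mulmx_conj (h k : 'M[K]_3) : h x2 x0 = 0 -> h x2 x1 = 0 ->
  k x2 x0 = 0 -> k x2 x1 = 0 -> h *m k = 1%:M -> ublk h *m ublk k = 1%:M.
Proof.
move=> h0 h1 k0 k1 hk; apply/matrixP => i j.
have E (v : 'cV[K]_2) : (ublk h *m ublk k) *m v = v.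
  by apply: (@emb_inj K); rewrite -mulmxA -!ublk_emb // mulmxA hk mul1mx.
by have := E (delta_mx j 0); rewrite -colE => /matrixP/(_ i 0); rewrite !mxE andbT.
Qed.

Lemma e1_neq0 : e1 K != 0.
Proof. by apply: (@cv3_neq0 _ _ x0); rewrite cv3E oner_neq0. Qed.

(* A default point when v = 0. *)
Definition pt (v : 'cV[K]_3) : P2 K := insubd (point e1_neq0) <[v]>%VS.

Lemma coords_pt (v : 'cV[K]_3) : v != 0 -> coords (pt v) === v.
Proof.
move=> v0; suff -> : pt v = point v0 by apply: coords_point.
by apply: val_inj; rewrite val_insubd dim_vline v0.
Qed.

Lemma card_pts (s : seq 'cV[K]_3) : (forall v, v \in s -> v != 0) -> uniq s ->
  (forall u v, u \in s -> v \in s -> u === v -> u = v) ->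
  #|` seq_fset tt [seq pt v | v <- s]| = size s.
Proof.
move=> s0 Us s_inj; rewrite size_seq_fset undup_id ?size_map // map_inj_in_uniq //.
move=> u v us vs E; apply: s_inj => //.
apply: proj_eq_trans (proj_eq_sym (coords_pt (s0 _ us))) _.
by rewrite E; apply: coords_pt; apply: s0.
Qed.

End StabilityOfDescent.

(** * The counterexample in the plane *)

Section RealCounterexample.
Variable R : realType.
Local Notation C := R[i].
Local Notation cj := (@conjc R : {rmorphism C -> C}).

Definition plane_pts (b : bool) (m : nat) : seq 'cV[C]_3 :=
  nseq b (e3 C) ++ [seq emb v | v <- antipodal_pts R m].

Lemma plane_pts_neq0 b m v : v \in plane_pts b m -> v != 0.
Proof.
rewrite mem_cat mem_nseq => /orP[/andP[_ /eqP->]|/mapP[u uL ->]].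
  by apply: (@cv3_neq0 _ _ x2); rewrite cv3E oner_neq0.
have u0 : u != 0.
  have [w1L w2L] := antipodal_pts_w R m.
  have D := pairwise_mem (@br_neq0_sym C) (antipodal_pts_distinct R m).
  have [uw|uw] := eqVneq u (w1 R); last by have [] := br_neq0 (D _ _ uL w1L uw).
  have w12 : br (w1 R) (w2 R) != 0.
    by rewrite br_w1_w2 complex_neq0 pnatr_eq0 orbT.
  by rewrite uw; have [] := br_neq0 w12.
by apply: contraNneq u0 => E; apply/eqP/(@emb_inj C); rewrite E; apply: eq_cv3; rewrite !mxE.
Qed.

Lemma plane_pts_proj_inj b m u v : u \in plane_pts b m -> v \in plane_pts b m ->
  u === v -> u = v.
Proof.
have D := pairwise_mem (@br_neq0_sym C) (antipodal_pts_distinct R m).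
have off w : ~ e3 C === emb w.
  by case=> c _ /matrixP/(_ x2 0); rewrite !mxE /= mulr0 => /eqP; rewrite oner_eq0.
rewrite !mem_cat !mem_nseq => /orP[/andP[_ /eqP->]|/mapP[u' uL ->]];
  case/orP=> [/andP[_ /eqP->]|/mapP[v' vL ->]] // E.
- by case: (off v' E).
- by case: (off u' (proj_eq_sym E)).
- congr emb; apply/eqP; apply: contraT => uv; have := D _ _ uL vL uv.
  by rewrite (br_proj_eq (iffLR (emb_proj_eq _ _) E)) eqxx.
Qed.

Lemma plane_pts_uniq b m : uniq (plane_pts b m).
Proof.
have UL : uniq (antipodal_pts R m).
  rewrite uniq_pairwise; apply: sub_pairwise (antipodal_pts_distinct R m) => u v.
  by apply: contraNneq => ->; rewrite br_proj_eq //; apply: proj_eq_refl.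
rewrite cat_uniq (map_inj_uniq (@emb_inj C)) UL andbT.
apply/andP; split; first by case: b.
apply/hasPn => _ /mapP[v _ ->].
rewrite /= mem_nseq; apply/negP => /andP[_ /eqP/matrixP/(_ x2 0)].
by rewrite !mxE /= => /esym/eqP; rewrite oner_eq0.
Qed.

Lemma size_plane_pts b m : size (plane_pts b m) = (b + (m.+1).*2)%N.
Proof. by rewrite size_cat size_nseq size_map size_antipodal_pts. Qed.

Lemma conj_e3 : map_mx cj (e3 C) = e3 C.
Proof. by rewrite cv3_map !rmorph0 rmorph1. Qed.

Lemma plane_pts_conj b m :
  pincl (mximg (blk (quarter_turn R)) (conjs cj (plane_pts b m))) (plane_pts b m).
Proof.
move=> _ /mapP[_ /mapP[v vL ->] ->]; move: vL.
rewrite mem_cat mem_nseq => /orP[/andP[b0 /eqP->]|/mapP[u uL ->]].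
  exists (e3 C); first by rewrite mem_cat mem_nseq b0 eqxx.
  by rewrite conj_e3 blk_e3; apply: proj_eq_refl.
have [u' u'L E] := antipodal_pts_conj (map_f _ (map_f _ uL)).
exists (emb u'); first by rewrite mem_cat map_f ?orbT.
by rewrite emb_map blk_emb; apply/emb_proj_eq.
Qed.

(** The matrix [h] preserves the line of the antipodal points, and its block there satisfies the
    cocycle identity exactly. The sign obstruction on the line would be lost if the identity held
    only up to a scalar. *)
Lemma plane_pts_no_real_structure b m (h : 'M[C]_3) : (2 <= m)%N ->
  h *m map_mx cj h = 1%:M ->
  pincl (mximg h (conjs cj (plane_pts b m))) (plane_pts b m) -> False.
Proof.
move=> m2 hh hL; have hU : h \in unitmx by have [] := mulmx1_unit hh.
have L3 : (2 < size (antipodal_pts R m))%N by rewrite size_antipodal_pts; lia.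
have dist := antipodal_pts_distinct R m.
have hE v : v \in antipodal_pts R m -> exists2 v', v' \in antipodal_pts R m &
    h *m emb (map_mx cj v) === emb v'.
  case: b hL => hL; first exact: line_image dist L3 hU hL v.
  move=> vL; rewrite -emb_map.
  by have [_ /mapP[v' v'L ->] E] := hL _ (map_f _ (map_f _ (map_f _ vL))); exists v'.
have h2 v : v \in antipodal_pts R m -> (h *m emb (map_mx cj v)) x2 0 = 0.
  by move=> /hE[v' _ [c _ ->]]; rewrite mxE cv3E mulr0.
have [h0 h1] : h x2 x0 = 0 /\ h x2 x1 = 0.
  have [w1L w2L] := antipodal_pts_w R m; have [_ _ _ w12] := br_w_conj R.
  by apply: (plane_line_block w12); apply: h2.
apply: (@antipodal_pts_no_real_structure R m (ublk h) m2).
  have -> : map_mx cj (ublk h) = ublk (map_mx cj h).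
    by apply/matrixP => i j; rewrite /ublk !mxE; case: (j == 0); case: (i == 0).
  by apply: ublk_mulmx_conj => //; rewrite mxE ?h0 ?h1 rmorph0.
move=> _ /mapP[_ /mapP[v vL ->] ->]; have [v' v'L E] := hE v vL; exists v' => //.
by apply/emb_proj_eq; rewrite -ublk_emb.
Qed.

Lemma conj_galois_aut : galois_aut (real_in_complex R) cj.
Proof.
split; first by exists cj => x; apply: conjcK.
by move=> a; apply: conjc_real.
Qed.

Lemma real_of_conj (z : C) : cj z = z -> is_real_number z.
Proof.
case: z => a b /eqP; rewrite eq_complex /= => /andP[_ /eqP bN]; exists a.
by congr Complex; lra.
Qed.

Lemma moduli_not_definition (n : nat) : (6 <= n)%N ->
  exists S : {fset P2 C},
    [/\ #|` S| = n,
        (forall z : C, field_of_moduli (real_in_complex R) S z <-> is_real_number z)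
      & ~ descends_to (@is_real_number R) S].
Proof.
(* There are [m] antipodal pairs of real points and one of nonreal points; [6 <= n] gives [2 <= m],
   so the pairs of 2 and 3 are present. *)
move=> n6; pose m := (n./2).-1; pose b := odd n.
have nE : n = (b + (m.+1).*2)%N.
  by rewrite /m /b prednK ?odd_double_half //; lia.
have m2 : (2 <= m)%N by rewrite /m; lia.
pose vs := plane_pts b m; pose S := seq_fset tt [seq pt v | v <- vs].
have memS p : (p \in S) -> exists2 v, v \in vs & p = pt v.
  by rewrite seq_fsetE => /mapP[v vL ->]; exists v.
have ptS v : v \in vs -> pt v \in S by move=> vL; rewrite seq_fsetE map_f.
have vs0 := @plane_pts_neq0 b m.
have cS : #|` S| = n.
  rewrite card_pts ?size_plane_pts //; first exact: plane_pts_uniq.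
  exact: plane_pts_proj_inj.
exists S; split=> //.
  move=> z; split; last by move=> [r ->] sigma [_ fixR] _; apply: fixR.
  move=> /(_ cj conj_galois_aut) H; apply: real_of_conj; apply: H.
  have QU : blk (quarter_turn R) \in unitmx by rewrite blk_unit quarter_turn_unit.
  pose Q : GL3 C := exist (fun g => g \in unitmx) _ QU; exists Q.
  apply/eqP; rewrite eqEfcard; apply/andP; split.
    apply/fsubsetP => _ /imfsetP[_ /imfsetP[_ /memS[v vL ->] ->] ->].
    have [v' v'L E] := plane_pts_conj (map_f _ (map_f _ vL)).
    suff -> : GL3_act Q (aut_act cj (pt v)) = pt v' by apply: ptS.
    apply: coords_inj; apply: proj_eq_trans (coords_GL3_act _ _) _.
    apply: proj_eq_trans (proj_eq_mul _ (coords_aut_act _ _)) _.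
    apply: proj_eq_trans (proj_eq_mul _ (proj_eq_map _ (coords_pt (vs0 _ vL)))) _.
    exact: proj_eq_trans E (proj_eq_sym (coords_pt (vs0 _ v'L))).
  have inj1 : {in S &, injective (aut_act cj)} by move=> x y _ _; apply: aut_act_inj.
  have inj2 : {in [fset aut_act cj p | p in S]%fset &, injective (GL3_act Q)}.
    move=> x y _ _ E; apply: coords_inj; apply: (proj_eq_mul_inj QU).
    apply: proj_eq_trans (proj_eq_sym (coords_GL3_act Q x)) _.
    by rewrite E; apply: (coords_GL3_act Q y).
  by rewrite (eqP (introT (card_in_imfsetP _ _) inj2)) (eqP (introT (card_in_imfsetP _ _) inj1)).
move=> [G [g [GE GT]]].
have cj_fix x : is_real_number x -> cj x = x by case=> r ->; apply: conjc_real.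
have stab := descends_stable cj_fix GE GT.
have gU : val g \in unitmx := valP g.
have scU : map_mx cj (val g) \in unitmx by rewrite map_unitmx.
(* If [g] takes the set to a conjugation-stable one, then [g^-1] times the conjugate of [g] maps the
   conjugate set into the set and satisfies the cocycle identity exactly. *)
apply: (@plane_pts_no_real_structure b m (invmx (val g) *m map_mx cj (val g)) m2).
  rewrite map_mxM map_invmx conj_mxK mulmxA -[_ *m invmx (map_mx _ _)]mulmxA.
  by rewrite mulmxV // mulmx1 mulVmx.
move=> _ /mapP[_ /mapP[v vL ->] ->].
have vT : GL3_act g (pt v) \in [fset GL3_act g p | p in S]%fset.
  by apply: in_imfset; apply: ptS.
have /imfsetP[_ /= /memS[v' v'L ->] E] := stab _ vT.
exists v' => //; apply: (proj_eq_mul_inj gU); rewrite !mulmxA mulmxV // mul1mx -map_mxM.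
have cE u : u \in vs -> coords (GL3_act g (pt u)) === val g *m u.
  move=> uL; apply: proj_eq_trans (coords_GL3_act _ _) _.
  exact/proj_eq_mul/coords_pt/vs0.
apply: proj_eq_trans (cE _ v'L); rewrite -E.
apply: proj_eq_trans _ (proj_eq_sym (coords_aut_act _ _)).
exact/proj_eq_map/proj_eq_sym/cE.
Qed.

End RealCounterexample.

Theorem theorem1 :
  (forall (k K : fieldType) (iota : {rmorphism k -> K}) (S : {fset P2 K}),
     2%N \notin [pchar k] ->
     separable_closure iota ->
     (#|` S| <= 5)%N ->
     descends_to (field_of_moduli iota S) S) /\
  (forall (R : realType) (n : nat), (6 <= n)%N ->
     exists S : {fset P2 R[i]},
       [/\ #|` S| = n,
           (forall z : R[i],
              field_of_moduli (real_in_complex R) S z <-> is_real_number z)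
         & ~ descends_to (@is_real_number R) S]).
Proof.
split; first exact: five_points_descend.
exact: moduli_not_definition.
Qed.
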